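(* Let $G=(V,E,J)$ be a connected, unimodular, transitive weighted graph that is normalised so that $\sum_{e\in E^\rightarrow_o} J_e=1$. Then \[ \chi_\beta \leq \left(1+\frac{\beta_c-\beta}{3\beta \beta_c} \right) \left[ \int_\beta^{\beta_c} \frac{1}{3 \lambda^2 \nabla_\lambda^2} \, d\lambda \right]^{-1} \] for every $0< \beta < \beta_c$.
   Context: A weighted graph $G=(V,E,J)$ is a countable (unoriented) graph $(V,E)$ together with non-negative weights $\{J_e:e\in E\}$ such that $\sum_{e\in E^\rightarrow_v}J_e<\infty$ for each $v\in V$, where $E^\rightarrow_v$ is the set of oriented edges emanating from $v$ (each unoriented edge corresponds to a pair of oppositely oriented edges). An automorphism of $G$ is a graph automorphism of $(V,E)$ preserving the weights; $\mathrm{Aut}(G)$ is the group of automorphisms. $G$ is transitive if any vertex can be mapped to any other by an automorphism; $o$ denotes a fixed vertex. A connected transitive weighted graph is unimodular if $\sum_{x\in V}F(o,x)=\sum_{x\in V}F(x,o)$ for every $F:V\times V\to[0,\infty]$ with $F(\gamma x,\gamma y)=F(x,y)$ for all $x,y\in V$, $\gamma\in\mathrm{Aut}(G)$. For $\beta\ge 0$, Bernoulli-$\beta$ bond percolation on $G$ is the random subgraph in which each edge $e$ is independently retained (open) with probability $1-e^{-\beta J_e}$ and otherwise deleted (closed); its law is $\mathbb{P}_\beta$, with expectation $\mathbb{E}_\beta$. $K$ denotes the cluster (connected component) of $o$, and $\chi_\beta=\mathbb{E}_\beta|K|$. $T_\beta(x,y)=\mathbb{P}_\beta(x\leftrightarrow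 y)$ is the probability that $x$ and $y$ are connected by an open path, and $\nabla_\beta=\sum_{x,y\in V}T_\beta(o,x)T_\beta(x,y)T_\beta(y,o)$ is the triangle diagram. The critical parameter is $\beta_c=\inf\{\beta\ge0:\mathbb{P}_\beta(|K|=\infty)>0\}$; by sharpness of the phase transition $\chi_\beta<\infty$ for every $0\le\beta<\beta_c$ (and $\chi_{\beta_c}=\infty$ when $\beta_c<\infty$). If $\beta_c=\infty$, the expression $\frac{\beta_c-\beta}{\beta\beta_c}$ is read as $\frac1\beta-\frac1{\beta_c}=\frac1\beta$. *)

(* Defs.v *)
From HB Require Import structures.
From mathcomp Require Import all_boot all_order all_algebra.
From mathcomp Require Import all_classical all_reals all_analysis.

Set Implicit Arguments.
Unset Strict Implicit.
Unset Printing Implicit Defensive.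
Import Order.TTheory GRing.Theory Num.Theory.
Local Open Scope classical_set_scope.
Local Open Scope ring_scope.

(* Unoriented edges are abstract; [ends e] lists the two endpoints of [e] in an
   arbitrary order which no notion below depends on.  The oriented edge
   [(e, b)] is [e] oriented so as to start at the first ([b = false]) or at the
   second ([b = true]) of its listed endpoints.  Simple graphs are the case
   where distinct edges have distinct pairs of distinct endpoints. *)
Definition origin (V E : Type) (ends : E -> V * V) (a : E * bool) : V :=
  if a.2 then (ends a.1).2 else (ends a.1).1.

Record weighted_graph (R : realType) := WeightedGraph {
  vertex : countType;
  edge : countType;
  ends : edge -> vertex * vertex;
  weight : edge -> R;
  weight_ge0 : forall e, 0 <= weight e;
  weight_summable : forall v : vertex,
    (\esum_(a in [set a : edge * bool | origin ends a = v]) (weight a.1)%:E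
       < +oo)%E
}.

Section WeightedGraph.
Context {R : realType} (G : weighted_graph R).
Local Notation V := (vertex G).
Local Notation E := (edge G).

Definition out_edges (v : V) : set (E * bool) :=
  [set a | origin (@ends R G) a = v].

Definition out_weight (v : V) : \bar R :=
  \esum_(a in out_edges v) (weight a.1)%:E.

Definition joins (e : E) (x y : V) : bool :=
  (ends e == (x, y)) || (ends e == (y, x)).

(* [w : E -> bool] stands for the subgraph whose edges are the [e] with [w e]. *)
Definition step (w : E -> bool) : rel V :=
  fun x y => `[< exists2 e, w e & joins e x y >].

Definition linked (w : E -> bool) (x y : V) : Prop :=
  exists2 p : seq V, path (step w) x p & last x p = y.

Definition connected_graph : Prop := forall x y : V, linked xpredT x y.

Definition automorphism (f : V -> V) : Prop :=
  bijective f /\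
  exists2 g : E -> E, bijective g &
    forall e, joins (g e) (f (ends e).1) (f (ends e).2) /\
              weight (g e) = weight e.

Definition transitive_graph : Prop :=
  forall x y : V, exists2 f, automorphism f & f x = y.

Definition unimodular (o : V) : Prop :=
  forall F : V -> V -> \bar R,
    (forall x y, (0 <= F x y)%E) ->
    (forall f, automorphism f -> forall x y, F (f x) (f y) = F x y) ->
    (\esum_(x in [set: V]) F o x = \esum_(x in [set: V]) F x o)%E.

(* Generators of the product sigma-algebra on [E -> bool]. *)
Definition open_events : set (set (E -> bool)) :=
  [set A | exists e : E, A = [set w : E -> bool | w e]].

Definition config := g_sigma_algebraType open_events.

(* [mu] is the product over [e] of the Bernoulli laws of parameter
   [1 - expR (- (b * weight e))], described by its values on cylinders. *)
Definition percolation_law (b : R) (mu : probability config R) : Prop :=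
  forall (s : seq E) (h : E -> bool), uniq s ->
    mu [set w | {in s, forall e, w e = h e}] =
    (\prod_(e <- s) (if h e then 1 - expR (- (b * weight e))
                     else expR (- (b * weight e))))%:E.

Definition cluster (o : V) (w : config) : set V := [set x | linked w o x].

Section Percolation.
Variables (P : R -> probability config R) (o : V).
Local Open Scope ereal_scope.

Definition susceptibility (b : R) : \bar R :=
  \int[P b]_w counting (cluster o w).

Definition two_point (b : R) (x y : V) : \bar R := P b [set w | linked w x y].

Definition triangle (b : R) : \bar R :=
  \esum_(p in [set: V * V])
    (two_point b o p.1 * two_point b p.1 p.2 * two_point b p.2 o).

Definition beta_c : \bar R :=
  ereal_inf [set b%:E | b in
    [set b : R | (0 <= b)%R /\ 0 < P b [set w | infinite_set (cluster o w)]]].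

End Percolation.
End WeightedGraph.

(* [(bc - b) / (b * bc)], read as [1 / b] when [bc = +oo]; the value at
   [bc = -oo] is irrelevant. *)
Definition critical_gap {R : realType} (b : R) (bc : \bar R) : R :=
  if bc is c%:E then (c - b) / (b * c) else b^-1.

(* Main.v *)
Require Import Defs.
From mathcomp Require Import finmap all_boot all_order all_algebra.
From mathcomp Require Import all_classical all_reals all_analysis.
From mathcomp Require Import measurable_realfun zify lra ring.

(** The susceptibility [chi] satisfies, at every subcritical parameter [b] and
    with [N] the triangle diagram, the differential inequality
      [chi' >= (chi - N)_+ ^ 2 / (3 b ^ 2 N ^ 2)],
    and the theorem is the integrated form of it.

    For the inequality, explore the cluster [K] of the root and take an
    independent configuration.  There, a connection from the root to [x] either
    ends in [K] or leaves [K] for the last time along an edge.  Summed over [x]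
    and weighted by [|K|], the first case contributes at most [chi N] by the
    three-point tree bound.  In the second one the connection off [K] may be
    moved back to the original configuration, where the edge is then pivotal;
    mass transport takes the root to the inner end of that edge
    ([leaving_cluster]).  The result is [chi ^ 2 - chi N <= b W], where [W]
    differs from a lower bound for the derivative of [chi] given by Russo's
    formula ([growth_le_pivotal]) only by a weight [phi], the sum of [T o u]
    over the [u] in the cluster of the root [o], with [T] the connection
    probability.
    The Cauchy--Schwarz inequality ([quadratic_growth]) bounds [W ^ 2] by
    [chi'] times the second moment of [phi], and the four-point tree bound
    estimates the latter by [3 chi ^ 2 N ^ 2] ([second_moment]).

    This last estimate rests on positive semidefiniteness.  The kernel [T] is
    an average of equivalence relations, so its form satisfies the
    Cauchy--Schwarz inequality ([random_equivalence_form]); hence its third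
    convolution power is largest on the diagonal ([conv3_le]).  The pairings of
    the four points lead to two diagrams joining two points by three paths: one
    with lengths one, two and three, which is at most [N ^ 2], and one with
    three paths of length two, which is at most the other ([theta_mirror]).
    The latter comparison is positive semidefiniteness again, now of two
    independent copies of [T], between two mass transports.

    All of this is about finite quantities because [chi] is finite below the
    critical parameter.  That is proved here in the manner of Duminil-Copin and
    Tassion ([chi_finite]).  The tree bounds come from the inequality of van den
    Berg and Kesten ([BK]), itself proved by decoupling one edge at a time, and
    derivatives are replaced by increments produced by sprinkling
    ([sprinkle]).

    Finally [y = 1 / chi] and [h = 1 / N] satisfy
    [- y' >= (h - y)_+ ^ 2 / (3 l ^ 2)], which [integrate_inequality] turns into
    a bound of the integral of [h ^ 2 / (3 l ^ 2)] by a multiple of [y]. *)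

Import Order.TTheory GRing.Theory Num.Theory.
Local Open Scope classical_set_scope.
Local Open Scope ring_scope.
Set Implicit Arguments.
Unset Strict Implicit.
Unset Printing Implicit Defensive.
Local Open Scope ereal_scope.

(** * Nonnegative sums over countable types *)

Definition tsum {R : realType} {T : countType} (f : T -> \bar R) : \bar R :=
  \esum_(x in [set: T]) f x.

Notation "\S_ x F" := (tsum (fun x => F))
  (at level 41, x name, F at level 41, right associativity).

Section CountableSums.
Context {R : realType}.
Implicit Types T U : countType.

Lemma tsum_ge0 T (f : T -> \bar R) : (forall x, 0 <= f x) -> 0 <= tsum f.
Proof. by move=> f0; apply: esum_ge0 => x _. Qed.

Lemma le_tsum T (f g : T -> \bar R) :
  (forall x, f x <= g x) -> tsum f <= tsum g.
Proof. by move=> fg; apply: le_esum => x _. Qed.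

Lemma eq_tsum T (f g : T -> \bar R) : (forall x, f x = g x) -> tsum f = tsum g.
Proof. by move=> fg; apply: eq_esum => x _. Qed.

Lemma tsum0 T : tsum (fun _ : T => 0 : \bar R) = 0.
Proof. by apply: esum1. Qed.

Lemma tsumD T (f g : T -> \bar R) :
  (forall x, 0 <= f x) -> (forall x, 0 <= g x) ->
  \S_ x (f x + g x) = tsum f + tsum g.
Proof. by move=> f0 g0; apply: esumD. Qed.

Definition tterm {T} (f : T -> \bar R) (n : nat) : \bar R :=
  if pickle_inv n is Some x then f x else 0.

(** Along the enumeration of a countable type, these sums inherit what is known
    about series. *)
Lemma tsumE T (f : T -> \bar R) : (forall x, 0 <= f x) ->
  tsum f = \sum_(n <oo) tterm f n.
Proof.
move=> f0; rewrite nneseries_esumT; last first.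
  by move=> n; rewrite /tterm; case: pickle_inv.
pose A := [set n | pickle_inv n <> None :> option T].
have bij : set_bij [set: T] A pickle.
  split; first by move=> x _; rewrite /A /= pickleK_inv.
    by move=> x y _ _ /(congr1 (@pickle_inv T)); rewrite !pickleK_inv => -[].
  move=> n; rewrite /A /=; case E : (pickle_inv n) => [x|] // _.
  by exists x => //; have := @pickle_invK T n; rewrite E.
have -> : tsum f = \esum_(n in A) tterm f n.
  rewrite (reindex_esum [set: T] A pickle) //.
  by apply: eq_esum => x _; rewrite /tterm pickleK_inv.
rewrite esum_mkcond; apply: eq_esum => n _; rewrite /tterm /A.
by case: ifPn => //; rewrite notin_setE /= => /contrapT ->.
Qed.

Lemma tterm_ge0 T (f : T -> \bar R) n : (forall x, 0 <= f x) -> 0 <= tterm f n.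
Proof. by move=> f0; rewrite /tterm; case: pickle_inv. Qed.

Lemma tsum_ge_fsum T (f : T -> \bar R) (s : seq T) : uniq s ->
  (forall x, 0 <= f x) -> \sum_(x <- s) f x <= tsum f.
Proof.
move=> us f0; apply: esum_ge; exists [set` s].
  by split => //; exact: finite_seq.
by rewrite -fsbig_seq.
Qed.

Lemma tsum_ge_term T (f : T -> \bar R) a : (forall x, 0 <= f x) -> f a <= tsum f.
Proof. by move=> f0; have := @tsum_ge_fsum _ f [:: a] isT f0; rewrite big_seq1. Qed.

Lemma tsum_le T (f : T -> \bar R) c :
  (forall s : seq T, uniq s -> \sum_(x <- s) f x <= c) -> tsum f <= c.
Proof.
move=> H; apply: ge_ereal_sup => _ [A [fA _] <-].
by rewrite fsbig_finite //=; apply: H; exact: finmap.fset_uniq.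
Qed.

Lemma tsumZl T (f : T -> \bar R) c : (forall x, 0 <= f x) -> 0 <= c ->
  \S_ x (c * f x) = c * tsum f.
Proof.
move=> f0; case: c => [c| |] // c0.
  rewrite !tsumE //; last by move=> x; rewrite mule_ge0.
  rewrite -nneseriesZl; last by move=> n _; exact: tterm_ge0.
  by apply: eq_eseriesr => n _; rewrite /tterm; case: pickle_inv => //; rewrite mule0.
have [z|] := pselect (forall x, f x = 0).
  by rewrite (eq_tsum (g := fun=> 0)) ?(eq_tsum (f := f) (g := fun=> 0)) // ?tsum0
    ?mule0 // => x; rewrite z mule0.
move=> /existsNP[a /eqP fa].
have fa0 : 0 < f a by rewrite lt_neqAle eq_sym fa f0.
rewrite gt0_mulye; last by rewrite (lt_le_trans fa0) // tsum_ge_term.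
apply/eqP; rewrite eq_le leey /=.
have := @tsum_ge_term _ (fun x => +oo * f x) a; rewrite gt0_mulye //; apply => x.
by rewrite mule_ge0.
Qed.

Lemma tsumZr T (f : T -> \bar R) c : (forall x, 0 <= f x) -> 0 <= c ->
  \S_ x (f x * c) = tsum f * c.
Proof.
by move=> f0 c0; rewrite muleC -tsumZl //; apply: eq_tsum => x; rewrite muleC.
Qed.

Lemma tsum_pair T U (f : T -> U -> \bar R) : (forall x y, 0 <= f x y) ->
  \S_ x \S_ y f x y = \S_ p f p.1 p.2.
Proof.
move=> f0; rewrite /tsum esum_esum //.
congr esum; by apply/seteqP.
Qed.

Lemma reindex_tsum T U (e : T -> U) (f : U -> \bar R) : bijective e ->
  \S_ x f (e x) = tsum f.
Proof.
move=> [e' ee' e'e]; rewrite /tsum (reindex_esum [set: T] [set: U] e) //.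
split => //; first by move=> x y _ _; exact: (can_inj ee').
by move=> y _; exists (e' y).
Qed.

Lemma exchange_tsum T U (f : T -> U -> \bar R) : (forall x y, 0 <= f x y) ->
  \S_ x \S_ y f x y = \S_ y \S_ x f x y.
Proof.
move=> f0; rewrite !tsum_pair //.
rewrite -(@reindex_tsum _ _ (fun p : U * T => (p.2, p.1))) //.
by exists (fun p => (p.2, p.1)) => -[].
Qed.

Lemma tsum_delta T (f : T -> \bar R) a : (forall x, 0 <= f x) ->
  \S_ x (((x == a)%:R)%:E * f x) = f a.
Proof.
move=> f0; apply/eqP; rewrite eq_le; apply/andP; split; last first.
  have := @tsum_ge_term _ (fun x => ((x == a)%:R)%:E * f x) a.
  by rewrite eqxx mul1e; apply => x; rewrite mule_ge0 // lee_fin.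
apply: tsum_le => s us.
have [aS|aS] := boolP (a \in s); last first.
  rewrite big_seq big1 // => x xs; case: eqP => [xa|]; last by rewrite mul0e.
  by rewrite -xa xs in aS.
rewrite (bigD1_seq a) //= eqxx mul1e big1 ?adde0 // => x /negbTE ->.
by rewrite mul0e.
Qed.

Lemma tsum_single T (f : T -> \bar R) a : (forall x, 0 <= f x) ->
  (forall x, x != a -> f x = 0) -> tsum f = f a.
Proof.
move=> f0 fa; rewrite -[RHS](@tsum_delta _ f a) //; apply: eq_tsum => x.
by case: eqP => [|/eqP /fa ->]; rewrite ?mul1e // mule0.
Qed.

Lemma tsum_indic T (D : set T) (f : T -> \bar R) :
  \esum_(x in D) f x = \S_ x (if x \in D then f x else 0).
Proof. by rewrite esum_mkcond. Qed.

Lemma countingE T (D : set T) :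
  counting D = \S_ x ((\1_D x : R)%:E).
Proof.
rewrite [RHS](_ : _ = \esum_(x in D) 1%:E); last first.
  by rewrite esum_mkcond; apply: eq_esum => x _; rewrite indicE; case: ifP.
rewrite /counting; case: asboolP => fD.
  rewrite esum_fset; [|by []|by move=> i _; rewrite lee_fin].
  rewrite fsbig_finite //= sumEFin.
  rewrite big_const_seq count_predT iter_addr_0 //.
apply/esym/eqyP => M M0.
have [X XD cX] := infinite_set_fset (Num.truncn M).+1 fD.
move: XD; set Y := (Y in Y `<=` _) => XD.
apply: esum_ge; exists Y; first by split => //; exact: finite_fset.
rewrite fsbig_finite; last exact: finite_fset.
rewrite /Y set_fsetK.
rewrite sumEFin big_const_seq count_predT iter_addr_0.
rewrite lee_fin (le_trans (ltW (truncnS_gt M))) // ler_nat; exact: cX.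
Qed.

End CountableSums.

Section CountableSumsMeasure.
Context {R : realType} d {Om : measurableType d} (mu : {measure set Om -> \bar R}).
Implicit Types T : countType.

Lemma le_measure_sub (A B : set Om) :
  measurable A -> measurable B -> A `<=` B -> mu A <= mu B.
Proof. by move=> mA mB; apply: le_measure; rewrite inE. Qed.

Lemma countable_bigcup_measurable T (A : T -> set Om) (D : set T) :
  (forall x, measurable (A x)) -> measurable (\bigcup_(x in D) A x).
Proof.
move=> mA.
rewrite (_ : \bigcup_(x in D) A x = \bigcup_n
    (if pickle_inv n is Some x then if `[<D x>] then A x else set0 else set0)).
  apply: bigcup_measurable => n _; case: pickle_inv => // x; by case: ifP.
apply/seteqP; split => w.
  by move=> [x Dx Axw]; exists (pickle x) => //; rewrite pickleK_inv asboolT.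
move=> [n _]; case: pickle_inv => // x; case: asboolP => // Dx Axw.
by exists x.
Qed.

Lemma countable_bigcap_measurable T (A : T -> set Om) (D : set T) :
  (forall x, measurable (A x)) -> measurable (\bigcap_(x in D) A x).
Proof.
move=> mA; rewrite -[X in measurable X]setCK setC_bigcap; apply: measurableC.
by apply: countable_bigcup_measurable => x; exact: measurableC.
Qed.

Lemma measure_le_tsum T (A : set Om) (B : T -> set Om) :
  measurable A -> (forall x, measurable (B x)) ->
  (forall w, A w -> exists x, B x w) -> mu A <= \S_ x mu (B x).
Proof.
move=> mA mB AB; rewrite tsumE //.
pose B' n := if pickle_inv n is Some x then B x else set0.
rewrite (_ : \sum_(n <oo) _ = \sum_(n <oo) mu (B' n)); last first.
  apply: eq_eseriesr => n _; rewrite /tterm /B'; case: pickle_inv => [x|] //=.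
apply: measure_sigma_subadditive => //; first by move=> n; rewrite /B'; case: pickle_inv.
by move=> w /AB[x Bxw]; exists (pickle x) => //; rewrite /B' pickleK_inv.
Qed.

Lemma measure_tsum_partition T (A : set Om) (B : T -> set Om) :
  measurable A -> (forall x, measurable (B x)) ->
  (forall w, A w -> exists x, B x w) ->
  (forall x y w, B x w -> B y w -> x = y) ->
  mu A = \S_ x mu (A `&` B x).
Proof.
move=> mA mB AB dB; rewrite tsumE //.
pose B' n := if pickle_inv n is Some x then A `&` B x else set0.
rewrite (_ : \sum_(n <oo) _ = \sum_(n <oo) mu (B' n)); last first.
  apply: eq_eseriesr => n _; rewrite /tterm /B'; case: pickle_inv => [x|] //=.
have mB' n : measurable (B' n).
  by rewrite /B'; case: pickle_inv => // x; exact: measurableI.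
rewrite -measure_semi_bigcup //; last exact: bigcup_measurable.
  congr (mu _); apply/seteqP; split => w.
    by move=> Aw; have [x Bxw] := AB _ Aw; exists (pickle x) => //;
      rewrite /B' pickleK_inv.
  by move=> [n _]; rewrite /B'; case: pickle_inv => // x [].
apply/trivIsetP => i j _ _ ij; apply/seteqP; split => // w [].
rewrite /B'; case Ei : (pickle_inv i) => [x|] //; case Ej : (pickle_inv j) => [y|] //.
move=> [_ Bx] [_ By]; have xy := dB _ _ _ Bx By; rewrite xy in Ei.
have := @pickle_invK T i; have := @pickle_invK T j; rewrite Ei Ej /= => -> ji.
by rewrite ji eqxx in ij.
Qed.

Lemma integral_tsum T (f : T -> Om -> \bar R) :
  (forall x, measurable_fun [set: Om] (f x)) -> (forall x w, 0 <= f x w) ->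
  \int[mu]_w (\S_ x f x w) = \S_ x \int[mu]_w f x w.
Proof.
move=> mf f0; rewrite tsumE; last by move=> x; exact: integral_ge0.
transitivity (\int[mu]_w (\sum_(n <oo) tterm (fun x => f x w) n)).
  by apply: eq_integral => w _; rewrite tsumE.
rewrite integral_nneseries //; last by move=> n w _; exact: tterm_ge0.
  apply: eq_eseriesr => n _; rewrite /tterm; case: pickle_inv => // .
  by rewrite integral0.
by move=> n; rewrite /tterm; case: pickle_inv.
Qed.

Lemma measurable_tsum T (f : T -> Om -> \bar R) :
  (forall x, measurable_fun [set: Om] (f x)) -> (forall x w, 0 <= f x w) ->
  measurable_fun [set: Om] (fun w => \S_ x f x w).
Proof.
move=> mf f0; rewrite (_ : (fun w => _) =
    (fun w => \sum_(n <oo) tterm (fun x => f x w) n)); last first.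
  by apply/funext => w; rewrite tsumE.
apply: ge0_emeasurable_sum; first by move=> n w _ _; exact: tterm_ge0.
by move=> n _; rewrite /tterm; case: pickle_inv.
Qed.

End CountableSumsMeasure.

(** For the nonnegativity side conditions of the lemmas on sums. *)
Ltac nng := cbv beta; lazymatch goal with
  | |- is_true (Order.le _ (tsum _)) => apply: tsum_ge0; intro; nng
  | |- is_true (Order.le _ (_ * _)) => apply: mule_ge0; nng
  | |- is_true (Order.le _ (EFin _)) => rewrite lee_fin; nng
  | |- forall _, _ => intro; nng
  | |- _ => first [by auto | apply: adde_ge0; nng]
  end.

(** * The percolation law *)

Section Law.
Context {R : realType} (G : weighted_graph R).
Local Notation V := (vertex G).
Local Notation E := (edge G).
Local Notation config := (config G).
Implicit Types (s : seq E) (w : config) (I : set E) (A B : set config).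

Definition closed_prob (b : R) (e : E) : R := expR (- (b * weight e)).

Definition all_closed (s : seq E) : set config :=
  [set w : config | all (fun e => ~~ (w : E -> bool) e) s].

Lemma measurable_coordinate e : measurable [set w : config | (w : E -> bool) e].
Proof. by apply: sub_sigma_algebra; exists e. Qed.

Lemma measurable_coordinate_eq e v :
  measurable [set w : config | (w : E -> bool) e = v].
Proof.
case: v; first exact: (@measurable_coordinate e).
rewrite (_ : [set w | _] = ~` [set w : config | (w : E -> bool) e]).
  by apply: measurableC; exact: (@measurable_coordinate e).
by apply/seteqP; split => w /=; [move=> -> //|move/negP/negbTE].
Qed.

Lemma all_closed_measurable s : measurable (all_closed s).
Proof.
rewrite (_ : all_closed s =
    \bigcap_(e in [set` s]) ~` [set w : config | (w : E -> bool) e]).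
  apply: countable_bigcap_measurable => e.
  by apply: measurableC; exact: (@measurable_coordinate e).
apply/seteqP; split => w; first by move=> /allP H e /= /H /negP.
by move=> H; apply/allP => e es; apply/negP; exact: H.
Qed.

Lemma law_all_closed b (P : probability config R) s :
  percolation_law b P -> uniq s ->
  P (all_closed s) = (\prod_(e <- s) closed_prob b e)%:E.
Proof.
move=> lP us; rewrite -(lP s (fun=> false) us); congr (P _).
apply/seteqP; split => w /=.
  by move=> /allP H e /H /negbTE.
by move=> H; apply/allP => e es; rewrite H.
Qed.

(** The events that finitely many given edges are closed form a pi-system
    generating the product sigma-algebra, so they determine the law. *)
Lemma law_unique d (Om : measurableType d) (mu : probability Om R)
    (f : Om -> config) b (P : probability config R) :
  percolation_law b P ->
  (forall e, measurable [set x | (f x : E -> bool) e]) ->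
  (forall s, uniq s ->
     mu (f @^-1` all_closed s) = (\prod_(e <- s) closed_prob b e)%:E) ->
  forall A, measurable A -> measurable (f @^-1` A) /\ mu (f @^-1` A) = P A.
Proof.
move=> lP mf muE.
have mmf : measurable_fun [set: Om] f.
  apply: (@measurability _ _ Om config [set: Om] f (@open_events R G)) => //.
  move=> _ [_ [e ->]] <-; rewrite setTI; exact: mf.
have mfA A : measurable A -> measurable (f @^-1` A).
  by move=> mA; rewrite -[X in measurable X]setTI; exact: mmf.
move=> A mA; split; first exact: mfA.
pose C := [set A | exists s, uniq s /\ A = all_closed s].
have m0 : C [set: config].
  by exists [::]; split => //; apply/seteqP; split.
have Cm : C `<=` measurable by move=> _ [s [_ ->]]; exact: all_closed_measurable.
have sub : <<s C >> A.
  have : <<s @open_events R G >> A by [].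
  move=> + B [sB CB] => /(_ B); apply; split => // _ [e ->].
  have -> : [set w : E -> bool | w e] = setT `\` all_closed [:: e].
    by apply/seteqP; split => w; rewrite /all_closed /= andbT;
      [move=> we; split => //; rewrite we|move=> [_ /negP /negPn]].
  case: sB => _ sBD _; apply: sBD; apply: CB.
  by exists [:: e].
pose nu := pushforward mu f.
have <- : nu A = P A; last by [].
apply: (@g_sigma_algebra_measure_unique _ _ _ C Cm (fun=> setT)
  (fun=> m0) _ nu P) => //.
- by apply/seteqP; split => // x _; exists 0%N.
- move=> _ _ [s [us ->]] [t [ut ->]]; exists (undup (s ++ t)).
  split; first exact: undup_uniq.
  apply/seteqP; split => w /=; rewrite /all_closed /=.
    move=> [/allP Hs /allP Ht]; apply/allP => e.
    by rewrite mem_undup mem_cat => /orP[/Hs|/Ht].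
  move=> /allP H; split; apply/allP => e es; apply: H;
    by rewrite mem_undup mem_cat es ?orbT.
- move=> _ [s [us ->]]; apply: (eq_trans (muE s us)).
  by apply/esym; exact: (law_all_closed lP us).
- move=> _; apply: le_lt_trans (_ : mu setT < +oo).
    by rewrite probability_setT probability_le1 //; exact: mfA.
  by rewrite probability_setT ltry.
Qed.

Lemma product_probabilityE (P Q : probability config R) A B :
  measurable A -> measurable B -> (P \x Q) (A `*` B) = P A * Q B.
Proof. exact: product_measure1E. Qed.

Lemma measurable_fst_coordinate e :
  measurable [set x : config * config | (x.1 : E -> bool) e].
Proof.
rewrite (_ : [set x | _] = [set w : config | (w : E -> bool) e] `*` setT).
  by apply: measurableX => //; exact: measurable_coordinate.
by apply/seteqP; split => [x|x []] //=.
Qed.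

Lemma measurable_snd_coordinate e :
  measurable [set x : config * config | (x.2 : E -> bool) e].
Proof.
rewrite (_ : [set x | _] = setT `*` [set w : config | (w : E -> bool) e]).
  by apply: measurableX => //; exact: measurable_coordinate.
by apply/seteqP; split => [x|x []] //=.
Qed.

Definition mix (I : set E) (x : config * config) : config :=
  fun e => if `[< I e >] then (x.1 : E -> bool) e else (x.2 : E -> bool) e.

Lemma law_mix b (P : probability config R) I A :
  percolation_law b P -> measurable A ->
  measurable (mix I @^-1` A) /\ (P \x P) (mix I @^-1` A) = P A.
Proof.
move=> lP mA; apply: (law_unique (b := b)) => //.
  move=> e; rewrite /mix; case: asboolP => _.
    exact: measurable_fst_coordinate.
  exact: measurable_snd_coordinate.
move=> s us.
rewrite (_ : _ @^-1` _ = all_closed [seq e <- s | `[< I e >]] `*`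
                         all_closed [seq e <- s | ~~ `[< I e >]]).
  apply: (eq_trans (product_probabilityE P P (all_closed_measurable _)
    (all_closed_measurable _))).
  rewrite !(law_all_closed lP) ?filter_uniq // -EFinM; congr (_ %:E).
  by rewrite !big_filter [RHS](bigID (fun e => `[< I e >])) /=.
apply/seteqP; split => -[w1 w2]; rewrite /mix /all_closed /=.
  move=> /allP H; split; apply/allP => e; rewrite mem_filter => /andP[Ie es];
    by move: (H e es); rewrite ?Ie // (negbTE Ie).
move=> [/allP H1 /allP H2]; apply/allP => e es.
by case: ifPn => Ie; [apply: H1|apply: H2]; rewrite mem_filter es Ie.
Qed.

Definition depends_on I A :=
  forall w w', (forall e, I e -> (w : E -> bool) e = (w' : E -> bool) e) ->
  A w -> A w'.

(** Resampling the edges outside [I] by an independent copy preserves the law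
    and decouples an event depending on [I] from one depending on its
    complement. *)
Lemma law_indep b (P : probability config R) I A B :
  percolation_law b P -> measurable A -> measurable B ->
  depends_on I A -> depends_on (~` I) B ->
  P (A `&` B) = P A * P B.
Proof.
move=> lP mA mB dA dB.
have [_ <-] := law_mix I lP (measurableI _ _ mA mB).
rewrite -product_probabilityE //; congr ((P \x P)%E _).
have mixI w1 w2 e : I e -> (mix I (w1, w2) : E -> bool) e = (w1 : E -> bool) e.
  by move=> Ie; rewrite /mix asboolT.
have mixC w1 w2 e : ~ I e -> (mix I (w1, w2) : E -> bool) e = (w2 : E -> bool) e.
  by move=> Ie; rewrite /mix asboolF.
apply/seteqP; split => -[w1 w2] /= [Aw Bw]; split.
- by apply: dA Aw => e; exact: mixI.
- by apply: dB Bw => e; exact: mixC.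
- by apply: dA Aw => e Ie; rewrite mixI.
- by apply: dB Bw => e Ie; rewrite mixC.
Qed.

Definition union (x : config * config) : config :=
  fun e => (x.1 : E -> bool) e || (x.2 : E -> bool) e.

(** The probabilities of being closed multiply, because they are exponentials.
    This is the basis of sprinkling: raising the parameter by [c] amounts to
    opening further edges independently. *)
Lemma law_union b c (P Q S : probability config R) A :
  percolation_law b P -> percolation_law c Q -> percolation_law (b + c) S ->
  measurable A ->
  measurable (union @^-1` A) /\ (P \x Q) (union @^-1` A) = S A.
Proof.
move=> lP lQ lS mA; apply: (law_unique (b := b + c)) => //.
  move=> e; rewrite (_ : [set x | _] =
    [set x : config * config | (x.1 : E -> bool) e] `|`
    [set x : config * config | (x.2 : E -> bool) e]).
    by apply: measurableU; [exact: measurable_fst_coordinate|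
      exact: measurable_snd_coordinate].
  by apply/seteqP; split => x /=; rewrite /union => /orP.
move=> s us.
rewrite (_ : _ @^-1` _ = all_closed s `*` all_closed s).
  apply: (eq_trans (product_probabilityE P Q (all_closed_measurable _)
    (all_closed_measurable _))).
  rewrite (law_all_closed lP) // (law_all_closed lQ) // -EFinM; congr (_ %:E).
  rewrite -big_split /=; apply: eq_bigr => e _.
  by rewrite /closed_prob -expRD mulrDl opprD.
apply/seteqP; split => -[w1 w2]; rewrite /union /all_closed /=.
  move=> /allP H; split; apply/allP => e /H; rewrite negb_or => /andP[] //.
by move=> [/allP H1 /allP H2]; apply/allP => e es; rewrite negb_or H1 ?H2.
Qed.

Lemma law_reindex b (P : probability config R) (g : E -> E) A :
  percolation_law b P -> bijective g ->
  (forall e, weight (g e) = weight e) -> measurable A ->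
  P [set w : config | A (fun e => (w : E -> bool) (g e))] = P A.
Proof.
move=> lP bg wg mA.
pose f (w : config) : config := fun e => (w : E -> bool) (g e).
have [] := @law_unique _ _ P f b P lP _ _ A mA => //.
  by move=> e; exact: measurable_coordinate.
move=> s us; rewrite (_ : _ @^-1` _ = all_closed (map g s)).
  rewrite (law_all_closed lP) ?map_inj_uniq //; last exact: bij_inj.
  by rewrite big_map; congr (_ %:E); apply: eq_bigr => e _; rewrite /closed_prob wg.
by apply/seteqP; split => w; rewrite /f /all_closed /= all_map.
Qed.

Lemma law_open b (P : probability config R) e : percolation_law b P ->
  P [set w : config | (w : E -> bool) e] = (1 - closed_prob b e)%:E.
Proof.
move=> lP; have := lP [:: e] (fun=> true) isT; rewrite big_seq1 => <-.
congr (P _); apply/seteqP; split => w /=.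
  by move=> we x; rewrite inE => /eqP ->.
by apply; rewrite inE.
Qed.

Lemma law_open_le b (P : probability config R) e : percolation_law b P ->
  P [set w : config | (w : E -> bool) e] <= (b * weight e)%:E.
Proof.
move=> lP; rewrite (law_open _ lP) lee_fin /closed_prob.
have := expR_ge1Dx (- (b * weight e)); lra.
Qed.

End Law.

(** * The van den Berg--Kesten inequality *)

Section FiniteBK.
Context {R : realType} {E : countType} (p : E -> R).
Local Open Scope ring_scope.
Implicit Types (s t : seq E) (v w : E -> bool) (X Y : set (seq E)).

Definition upd w (e : E) (b : bool) : E -> bool :=
  fun x => if x == e then b else w x.

Lemma updC w e x b c : e != x -> upd (upd w e b) x c = upd (upd w x c) e b.
Proof.
move=> ex; apply/funext => y; rewrite /upd.
by case: eqP => // ->; rewrite eq_sym (negbTE ex).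
Qed.

(** Means over the states of finitely many edges are computed by recursion on
    the list of edges, so that two copies of a configuration can be made
    independent one edge at a time. *)
Fixpoint mean s (f : (E -> bool) -> R) w : R :=
  if s is e :: s' then
    p e * mean s' f (upd w e true) + (1 - p e) * mean s' f (upd w e false)
  else f w.

Fixpoint coupled_mean s (f : (E -> bool) -> (E -> bool) -> R) v w : R :=
  if s is e :: s' then
    p e * coupled_mean s' f (upd v e true) (upd w e true) +
    (1 - p e) * coupled_mean s' f (upd v e false) (upd w e false)
  else f v w.

Fixpoint indep_mean s (f : (E -> bool) -> (E -> bool) -> R) v w : R :=
  if s is e :: s' then
    p e * (p e * indep_mean s' f (upd v e true) (upd w e true) +
           (1 - p e) * indep_mean s' f (upd v e true) (upd w e false)) +
    (1 - p e) * (p e * indep_mean s' f (upd v e false) (upd w e true) +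
           (1 - p e) * indep_mean s' f (upd v e false) (upd w e false))
  else f v w.

Hypothesis p01 : forall e, 0 <= p e <= 1.

Let p0 e : 0 <= p e. Proof. by have /andP[] := p01 e. Qed.
Let q0 e : 0 <= 1 - p e. Proof. by have /andP[_] := p01 e; rewrite subr_ge0. Qed.

Lemma coupled_mean_diag s f w : coupled_mean s f w w = mean s (fun v => f v v) w.
Proof. by elim: s w => [//|e s IH] w /=; rewrite !IH. Qed.

Lemma eq_mean s f g w : (forall v, f v = g v) -> mean s f w = mean s g w.
Proof. by move=> fg; elim: s w => [|e s IH] w /=; rewrite ?fg // !IH. Qed.

Lemma indep_mean_prod s (f g : (E -> bool) -> R) v w :
  indep_mean s (fun x y => f x * g y) v w = mean s f v * mean s g w.
Proof. by elim: s v w => [//|e s IH] v w /=; rewrite !IH; ring. Qed.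

(** A pointwise inequality between sharing the state of [e] and drawing it twice
    survives averaging over the other edges. *)
Lemma coupled_mean_split s e (f g : (E -> bool) -> (E -> bool) -> R) :
  e \notin s ->
  (forall v w,
    p e * f (upd v e true) (upd w e true) +
    (1 - p e) * f (upd v e false) (upd w e false) <=
    p e * (p e * g (upd v e true) (upd w e true) +
           (1 - p e) * g (upd v e true) (upd w e false)) +
    (1 - p e) * (p e * g (upd v e false) (upd w e true) +
           (1 - p e) * g (upd v e false) (upd w e false))) ->
  forall v w,
    p e * coupled_mean s f (upd v e true) (upd w e true) +
    (1 - p e) * coupled_mean s f (upd v e false) (upd w e false) <=
    p e * (p e * coupled_mean s g (upd v e true) (upd w e true) +
           (1 - p e) * coupled_mean s g (upd v e true) (upd w e false)) +
    (1 - p e) * (p e * coupled_mean s g (upd v e false) (upd w e true) +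
           (1 - p e) * coupled_mean s g (upd v e false) (upd w e false)).
Proof.
move=> + fg; elim: s => [//|x s IH] /=; rewrite inE negb_or => /andP[ex es] v w.
rewrite !(updC _ _ _ ex).
have := ler_wpM2l (p0 x) (IH es (upd v x true) (upd w x true)).
have := ler_wpM2l (q0 x) (IH es (upd v x false) (upd w x false)).
set a1 := coupled_mean _ _ _ _; set a2 := coupled_mean _ _ _ _.
set a3 := coupled_mean _ _ _ _; set a4 := coupled_mean _ _ _ _.
set a5 := coupled_mean _ _ _ _; set a6 := coupled_mean _ _ _ _.
set a7 := coupled_mean _ _ _ _; set a8 := coupled_mean _ _ _ _.
set a9 := coupled_mean _ _ _ _; set b1 := coupled_mean _ _ _ _.
set b2 := coupled_mean _ _ _ _; set b3 := coupled_mean _ _ _ _.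
move=> H1 H2; lra.
Qed.

(** Disjoint occurrence when [v = w] and [D] contains all edges, independent
    occurrence when [D] is empty: [D] lists the edges still shared by the two
    configurations, on which the witnesses must be disjoint. *)
Definition witnesses X Y (D : seq E) v w : Prop :=
  exists S T, [/\ X S, Y T, all v S, all w T &
    forall e, e \in D -> e \in S -> e \notin T].

Local Notation ind X Y D := (fun v w => (`[< witnesses X Y D v w >]%:R : R)).

Lemma witnesses_mono X Y D v w v' w' :
  (forall e, v e -> v' e) -> (forall e, w e -> w' e) ->
  witnesses X Y D v w -> witnesses X Y D v' w'.
Proof.
move=> vv ww [S [T [XS YT /allP Sv /allP Tw d]]]; exists S, T; split => //.
  by apply/allP => e /Sv; exact: vv.
by apply/allP => e /Tw; exact: ww.
Qed.

(** Drawing the state of an edge twice can only help: of two disjoint witnesses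
    in the shared configuration at most one uses this edge. *)
Lemma coupled_le_indep X Y s v w : uniq s ->
  coupled_mean s (ind X Y s) v w <= indep_mean s (ind X Y [::]) v w.
Proof.
elim: s v w => [//|e s IH] v w /= /andP[es us].
apply: le_trans (_ : p e * (p e * coupled_mean s (ind X Y s) (upd v e true) (upd w e true) +
   (1 - p e) * coupled_mean s (ind X Y s) (upd v e true) (upd w e false)) +
   (1 - p e) * (p e * coupled_mean s (ind X Y s) (upd v e false) (upd w e true) +
   (1 - p e) * coupled_mean s (ind X Y s) (upd v e false) (upd w e false)) <= _);
  last first.
  by rewrite lerD // ler_wpM2l // lerD // ler_wpM2l //; exact: IH.
apply: coupled_mean_split es _ _ _ => {}v {}w /=.
have mono (b b' : bool) (x : E -> bool) : (b ==> b') ->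
    forall y, upd x e b y -> upd x e b' y.
  by move=> bb' y; rewrite /upd; case: eqP => // _; move/implyP: bb'.
have D00 : witnesses X Y (e :: s) (upd v e false) (upd w e false) ->
    witnesses X Y s (upd v e false) (upd w e false).
  move=> [S [T [XS YT Sv Tw d]]]; exists S, T; split => // x xs.
  by apply: d; rewrite inE xs orbT.
(* A witness of the shared configuration uses [e] on one side only. *)
have D11 : witnesses X Y (e :: s) (upd v e true) (upd w e true) ->
    witnesses X Y s (upd v e true) (upd w e false) \/
    witnesses X Y s (upd v e false) (upd w e true).
  move=> [S [T [XS YT /allP Sv /allP Tw d]]].
  have ds x : x \in s -> x \in S -> x \notin T.
    by move=> xs; apply: d; rewrite inE xs orbT.
  have [eS|eS] := boolP (e \in S).
    left; exists S, T; split => //; first exact/allP.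
    apply/allP => x xT; have := Tw x xT; rewrite /upd; case: eqP => // xe.
    by move: (d e); rewrite inE eqxx eS -xe xT => /(_ isT isT).
  right; exists S, T; split => //; last exact/allP.
  apply/allP => x xS; have := Sv x xS; rewrite /upd; case: eqP => // xe.
  by rewrite -xe xS in eS.
case: (asboolP (witnesses X Y s (upd v e false) (upd w e false))) => H00.
  have H01 : witnesses X Y s (upd v e false) (upd w e true).
    by apply: witnesses_mono H00; exact: mono.
  have H10 : witnesses X Y s (upd v e true) (upd w e false).
    by apply: witnesses_mono H00; exact: mono.
  have H11 : witnesses X Y s (upd v e true) (upd w e true).
    by apply: witnesses_mono H00; exact: mono.
  rewrite (asboolT H01) (asboolT H10) (asboolT H11).
  have := p0 e; have := q0 e.
  by do 2![case: (asboolP (witnesses X Y (e :: s) _ _)) => _] => /=; nra.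
rewrite [X in (1 - p e) * X](_ : _ = 0); last by rewrite asboolF // => /D00.
rewrite mulr0 addr0.
case: (asboolP (witnesses X Y (e :: s) _ _)) => [/D11|_]; last first.
  rewrite mulr0; have := p0 e; have := q0 e => ? ?.
  by rewrite addr_ge0 // mulr_ge0 // addr_ge0 // mulr_ge0.
move=> H; have H11 : witnesses X Y s (upd v e true) (upd w e true).
  by case: H => H; apply: witnesses_mono H; exact: mono.
rewrite (asboolT H11); have := p0 e; have := q0 e.
case: H => H; rewrite (asboolT H); case: asboolP => _ /=; nra.
Qed.

End FiniteBK.

Section BK.
Context {R : realType} (G : weighted_graph R) (b : R).
Hypothesis b0 : (0 <= b)%R.
Variable P : probability (config G) R.
Hypothesis lP : percolation_law b P.
Local Notation V := (vertex G).
Local Notation E := (edge G).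
Local Notation config := (config G).
Implicit Types (s t : seq E) (w : config) (X Y : set (seq E)) (A : set config).

Let p (e : E) : R := (1 - closed_prob b e)%R.

Let p01 e : (0 <= p e <= 1)%R.
Proof.
rewrite /p /closed_prob subr_ge0 lerBlDr lerDl expR_ge0 andbT.
by rewrite -expR0 ler_expR oppr_le0 mulr_ge0 // weight_ge0.
Qed.

Definition cyl s (h : E -> bool) : set config :=
  [set w | {in s, forall e, (w : E -> bool) e = h e}].

Lemma cyl_measurable s h : measurable (cyl s h).
Proof.
rewrite (_ : cyl s h = \bigcap_(e in [set` s])
    [set w : config | (w : E -> bool) e = h e]).
  apply: countable_bigcap_measurable => e.
  exact: (@measurable_coordinate_eq _ _ e).
by apply/seteqP; split => w H e; exact: H.
Qed.

Lemma prob_mean_cyl A s t (h : E -> bool) : measurable A -> uniq (s ++ t) ->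
  depends_on [set` s ++ t] A ->
  P (A `&` cyl t h) = P (cyl t h) * (mean p s (fun w => (`[< A w >]%:R : R)%R) h)%:E.
Proof.
move=> mA; elim: s t h => [|e s IH] t h /=.
  move=> _ dA; case: asboolP => Ah; last first.
    rewrite mule0 (_ : _ `&` _ = set0) ?measure0 //; apply/seteqP; split => // w.
    by move=> [Aw wh]; apply: Ah; apply: dA Aw => e /= et; exact: wh.
  rewrite mule1; congr (P _); apply/seteqP; split => [w []//|w wh]; split => //.
  by apply: dA Ah => e /= et; rewrite wh.
move=> /andP[est us] dA.
have et : e \notin t by move: est; rewrite mem_cat negb_or => /andP[].
have ust : uniq (s ++ e :: t).
  by rewrite -cat1s uniq_catCA /= est us.
have dA' : depends_on [set` s ++ e :: t] A.
  move=> w w' H; apply: dA => x /= xest; apply: H => /=.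
  by move: xest; rewrite !inE !mem_cat inE; case: (x == e); case: (x \in s).
have ut : uniq t by move: us; rewrite cat_uniq => /and3P[].
have split_cyl B : measurable B -> P (B `&` cyl t h) =
    P (B `&` cyl (e :: t) (upd h e true)) + P (B `&` cyl (e :: t) (upd h e false)).
  move=> mB; rewrite -measureU; try by apply: measurableI => //; exact: cyl_measurable.
    congr (P _); apply/seteqP; split => w.
      move=> [Bw wh]; case we : ((w : E -> bool) e); [left|right]; split => //;
        move=> x; rewrite inE /upd; case: eqP => [-> //|_ /=]; exact: wh.
    move=> [[Bw wh]|[Bw wh]]; split => // x xt; have := wh x; rewrite inE xt orbT;
      by move=> /(_ isT) ->; rewrite /upd; case: eqP => // xe; rewrite -xe xt in et.
  apply/seteqP; split => // w [[_ w1] [_ w2]].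
  have := w1 e; have := w2 e; rewrite inE eqxx => /(_ isT) -> /(_ isT).
  by rewrite /upd eqxx.
have cylP c : P (cyl (e :: t) (upd h e c)) =
    P (cyl t h) * (if c then p e else 1 - p e)%:E.
  rewrite /cyl (lP _ (_ : uniq (e :: t))) /= ?et // (lP _ ut) -EFinM.
  rewrite big_cons mulrC; congr (_ * _)%:E.
    rewrite !big_seq; apply: eq_bigr => x xt; rewrite /upd.
    by case: eqP => // xe; rewrite -xe xt in et.
  by rewrite /upd eqxx /p /closed_prob; case: c => //; lra.
rewrite (split_cyl A mA) !(IH _ _ ust dA') !cylP.
have [r ->] : exists r, P (cyl t h) = r%:E by eexists; exact: (lP _ ut).
by rewrite -!EFinM -EFinD; congr (_ %:E); ring.
Qed.

Lemma prob_mean A s : measurable A -> uniq s -> depends_on [set` s] A ->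
  P A = (mean p s (fun w => (`[< A w >]%:R : R)%R) (fun=> false))%:E.
Proof.
move=> mA us dA; have := @prob_mean_cyl A s [::] (fun=> false) mA.
rewrite cats0 => /(_ us dA).
rewrite (_ : cyl [::] _ = setT); last by apply/seteqP; split.
by rewrite setIT probability_setT mul1e.
Qed.

(** An increasing event is encoded by the finite edge sets whose openness
    witnesses it; disjoint occurrence is then a concatenation of families. *)
Definition occurs X : set config :=
  [set w | exists2 S, X S & all (w : E -> bool) S].

Definition disjointly X Y : set (seq E) :=
  [set U | exists S T, [/\ X S, Y T, U = S ++ T & forall e, e \in S -> e \notin T]].

Lemma occurs_measurable X : measurable (occurs X).
Proof.
rewrite (_ : occurs X = \bigcup_(S in X) cyl S (fun=> true)).
  by apply: countable_bigcup_measurable => S; exact: cyl_measurable.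
apply/seteqP; split => w.
  by move=> [S XS /allP wS]; exists S.
by move=> [S XS wS]; exists S => //; apply/allP => e /wS.
Qed.

Lemma BK_finite (L M : seq (seq E)) :
  P (occurs (disjointly [set` L] [set` M])) <=
  P (occurs [set` L]) * P (occurs [set` M]).
Proof.
pose s := undup (flatten L ++ flatten M).
have us : uniq s by exact: undup_uniq.
have sL S e : S \in L -> e \in S -> e \in s.
  move=> SL eS; rewrite mem_undup mem_cat; apply/orP; left.
  by apply/flattenP; exists S.
have sM S e : S \in M -> e \in S -> e \in s.
  move=> SL eS; rewrite mem_undup mem_cat; apply/orP; right.
  by apply/flattenP; exists S.
have dep X : (forall S e, X S -> e \in S -> e \in s) -> depends_on [set` s] (occurs X).
  move=> Xs w w' ww' [S XS /allP wS]; exists S => //; apply/allP => e eS.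
  by rewrite -ww' ?wS //; exact: Xs eS.
have depL : depends_on [set` s] (occurs [set` L]).
  by apply: dep => S e /=; exact: sL.
have depM : depends_on [set` s] (occurs [set` M]).
  by apply: dep => S e /=; exact: sM.
have depD : depends_on [set` s] (occurs (disjointly [set` L] [set` M])).
  apply: dep => _ e [S [T [LS MT -> _]]]; rewrite mem_cat => /orP[].
    exact: sL.
  exact: sM.
rewrite (prob_mean (occurs_measurable _) us depL).
rewrite (prob_mean (occurs_measurable _) us depM).
rewrite (prob_mean (occurs_measurable _) us depD) -EFinM lee_fin.
rewrite -indep_mean_prod.
apply: le_trans (_ : coupled_mean p s (fun v w =>
  (`[< witnesses [set` L] [set` M] s v w >]%:R : R)%R) (fun=> false) (fun=> false) <= _)%R.
  rewrite coupled_mean_diag le_eqVlt; apply/orP; left; apply/eqP; apply: eq_mean => v.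
  congr ((nat_of_bool _)%:R)%R; apply/asbool_equiv_eq; split.
    move=> [_ [S [T [LS MT -> d]]]]; rewrite all_cat => /andP[vS vT].
    by exists S, T; split => // e _; exact: d.
  move=> [S [T [LS MT vS vT d]]]; exists (S ++ T); last by rewrite all_cat vS vT.
  by exists S, T; split => // e eS; apply: d => //; exact: sL eS.
apply: le_trans (coupled_le_indep p01 _ _ _ _ us) _.
rewrite le_eqVlt; apply/orP; left; apply/eqP.
have ext f g v w : (forall x y, f x y = g x y) ->
    indep_mean p s f v w = indep_mean p s g v w.
  by move=> fg; elim: (s) v w => [|e s1 IH] v w /=; rewrite ?fg // !IH.
apply: ext => v w; rewrite -natrM mulnb -asbool_and; congr ((nat_of_bool _)%:R)%R.
apply/asbool_equiv_eq; split.
  by move=> [S [T [LS MT vS vT _]]]; split; [exists S|exists T].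
by move=> [[S LS vS] [T MT vT]]; exists S, T; split.
Qed.

(** Edge lists are countably many, so the disjoint occurrence of two families is
    the increasing union of that of their finite subfamilies. *)
Lemma BK X Y : P (occurs (disjointly X Y)) <= P (occurs X) * P (occurs Y).
Proof.
pose F X n := [seq S <- pmap unpickle (iota 0 n) | `[< X S >]] : seq (seq E).
have memF X' n S : (S \in F X' n) <-> X' S /\ exists2 k, (k < n)%N & unpickle k = Some S.
  rewrite mem_filter; split.
    move=> /andP[/asboolP XS]; rewrite mem_pmap => /mapP[k].
    by rewrite mem_iota add0n => /andP[_ kn] e; split => //; exists k.
  move=> [XS [k kn e]]; rewrite asboolT //= mem_pmap; apply/mapP; exists k => //.
  by rewrite mem_iota add0n.
have subF X' n : occurs [set` F X' n] `<=` occurs X'.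
  by move=> w [S /memF[XS _] wS]; exists S.
have monoF X' m n : (m <= n)%N -> {subset F X' m <= F X' n}.
  move=> mn S /memF[XS [k km e]]; apply/memF; split => //; exists k => //.
  exact: leq_trans mn.
pose D n := occurs (disjointly [set` F X n] [set` F Y n]).
have DE : occurs (disjointly X Y) = \bigcup_n D n.
  apply/seteqP; split => w.
    move=> [_ [S [T [XS YT -> d]]] wST]; exists (maxn (pickle S) (pickle T)).+1 => //.
    exists (S ++ T) => //; exists S, T; split => //=; apply/memF; split => //.
      by exists (pickle S); rewrite ?pickleK // ltnS leq_maxl.
    by exists (pickle T); rewrite ?pickleK // ltnS leq_maxr.
  move=> [n _ [_ [S [T [/= /memF[XS _] /memF[YT _] -> d]]] wST]].
  by exists (S ++ T) => //; exists S, T.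
rewrite DE; have mD n : measurable (D n) by exact: occurs_measurable.
have cvgD : P \o D @ \oo --> P (\bigcup_n D n).
  apply: nondecreasing_cvg_mu => //; first exact: bigcup_measurable.
  move=> m n mn; apply/subsetPset => w [_ [S [T [LS MT -> d]]] wST].
  by exists (S ++ T) => //; exists S, T; split => //=; exact: (monoF _ _ _ mn).
have := cvg_lim _ cvgD; move=> <- //.
apply: lime_le; first by apply/cvg_ex; eexists; exact: cvgD.
apply: nearW => n; apply: le_trans (BK_finite _ _) _.
by apply: lee_pmul => //; apply: le_measure_sub;
  try exact: occurs_measurable; exact: subF.
Qed.

End BK.

(** * Walks and connection events *)

Section Walks.
Context {R : realType} (G : weighted_graph R).
Local Notation V := (vertex G).
Local Notation E := (edge G).
Implicit Types (s t : seq E) (w : E -> bool) (U W : set V) (x y z a c : V) (e : E).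

Lemma joinsC e x y : joins e x y = joins e y x.
Proof. by rewrite /joins orbC. Qed.

Lemma joins_same e x y a c : joins e x y -> joins e a c ->
  (a = x /\ c = y) \/ (a = y /\ c = x).
Proof.
rewrite /joins.
by move=> /orP[]/eqP -> /orP[]/eqP[-> ->]; auto.
Qed.

(** Walks are lists of edges rather than of vertices, because disjoint occurrence
    concerns edges. *)
Fixpoint walk U x s y : Prop :=
  U x /\ if s is e :: s' then exists2 z, joins e x z & walk U z s' y else x = y.

Definition linked_in U w x y : Prop := exists2 s, walk U x s y & all w s.

Lemma walk_start U x s y : walk U x s y -> U x.
Proof. by case: s => [|e s] []. Qed.

Lemma walk_end U x s y : walk U x s y -> U y.
Proof.
elim: s x => [|e s IH] x /=; first by move=> [Ux <-].
by move=> [_ [z _]] /IH.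
Qed.

Lemma walk_cat U x s t y : walk U x (s ++ t) y <->
  exists2 z, walk U x s z & walk U z t y.
Proof.
elim: s x => [|e s IH] x /=; split.
- by move=> H; exists x => //; split => //; exact: walk_start H.
- by move=> [z [_ ->]].
- by move=> [Ux [z xz]] /IH[a za ay]; exists a => //; split => //; exists z.
- by move=> [a [Ux [z xz za]] ay]; split => //; exists z => //; apply/IH; exists a.
Qed.

Lemma walk_rev U x s y : walk U x s y -> walk U y (rev s) x.
Proof.
elim: s x => [|e s IH] x /=; first by move=> [Ux <-].
move=> [Ux [z xz zy]]; rewrite rev_cons -cats1; apply/walk_cat; exists z.
  exact: IH.
by split; [exact: walk_start zy|exists x => //; rewrite joinsC].
Qed.

Lemma walk_sub U W x s y : U `<=` W -> walk U x s y -> walk W x s y.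
Proof.
move=> UW; elim: s x => [|e s IH] x /= [/UW Wx] //.
by move=> [z xz] /IH zy; split => //; exists z.
Qed.

Lemma linked_inE w x y : linked_in setT w x y <-> linked w x y.
Proof.
split.
  move=> [s]; elim: s x => [|e s IH] x /=; first by move=> [_ <-] _; exists [::].
  move=> [_ [z xz zy]] /andP[we ws]; have [p pz lz] := IH z zy ws.
  by exists (z :: p) => //=; rewrite pz andbT; apply/asboolP; exists e.
move=> [p]; elim: p x => [|z p IH] x /=; first by move=> _ <-; exists [::].
move=> /andP[/asboolP[e we xz]] pz lz; have [s zy ws] := IH z pz lz.
by exists (e :: s) => /=; [split => //; exists z|rewrite we].
Qed.

Lemma linked_in_refl U w x : U x -> linked_in U w x x.
Proof. by move=> Ux; exists [::]. Qed.

Lemma linked_in_sym U w x y : linked_in U w x y -> linked_in U w y x.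
Proof. by move=> [s xy ws]; exists (rev s); rewrite ?all_rev //; exact: walk_rev. Qed.

Lemma linked_in_trans U w x y z :
  linked_in U w x y -> linked_in U w y z -> linked_in U w x z.
Proof.
move=> [s xy ws] [t yz wt]; exists (s ++ t); last by rewrite all_cat ws.
by apply/walk_cat; exists y.
Qed.

Lemma linked_in_edge U w e x y : U x -> U y -> w e -> joins e x y ->
  linked_in U w x y.
Proof. by move=> Ux Uy we xy; exists [:: e]; rewrite /= ?we //; split => //; exists y. Qed.

Lemma linked_in_sub U W w w' x y : U `<=` W -> (forall e, w e -> w' e) ->
  linked_in U w x y -> linked_in W w' x y.
Proof.
move=> UW ww [s xy ws]; exists s; first exact: walk_sub xy.
by apply/allP => e es; apply: ww; exact: (allP ws).
Qed.

Definition inside U : set E := [set e | U (ends e).1 /\ U (ends e).2].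

Lemma joins_inside U e x y : joins e x y -> inside U e <-> U x /\ U y.
Proof. by rewrite /joins /inside /= => /orP[]/eqP -> /=; tauto. Qed.

Lemma walk_inside U x s y e : walk U x s y -> e \in s -> inside U e.
Proof.
elim: s x => [//|e' s IH] x /= [Ux [z xz zy]]; rewrite inE => /orP[/eqP ->|].
  by apply/(joins_inside _ xz); split => //; exact: walk_start zy.
exact: IH zy.
Qed.

Lemma linked_in_depends U x y :
  depends_on (G := G) (inside U) [set w | linked_in U w x y].
Proof.
move=> w w' ww' [s xy ws]; exists s => //; apply/allP => e es.
have <- : (w : E -> bool) e = (w' : E -> bool) e.
  by apply: ww'; exact: walk_inside xy es.
exact: (allP ws).
Qed.

(** A repeated edge is traversed either in the same direction, and the part in
    between can be cut out, or in opposite directions, and both occurrences can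
    be cut out as well. *)
Lemma walk_uniq U x s y : walk U x s y ->
  exists t, [/\ walk U x t y, uniq t & {subset t <= s}].
Proof.
elim: s x => [|e s IH] x /=; first by move=> H; exists [::].
move=> [Ux [z xz /IH[t [zy ut ts]]]].
have [et|et] := boolP (e \in t); last first.
  exists (e :: t); split => /=; [by split => //; exists z|by rewrite et|].
  by move=> f; rewrite !inE => /orP[->//|/ts ->]; rewrite orbT.
case/splitPr: et zy ut ts => t1 t2 /walk_cat[a za /= [Ua [c ac cy]]].
rewrite cat_uniq /= => /and3P[_ _ /andP[et2 ut2]] ts.
have t2s f : f \in t2 -> f \in e :: s.
  by move=> ft; rewrite inE ts ?orbT // mem_cat inE ft !orbT.
have [[ax cz]|[az cx]] := joins_same xz ac.
  exists (e :: t2); split => /=; [|by rewrite et2|].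
    by split => //; exists z => //; rewrite -cz.
  by move=> f; rewrite inE => /orP[/eqP ->|/t2s //]; rewrite inE eqxx.
by exists t2; split => //; rewrite -cx.
Qed.

(** Cutting a walk at its first entrance into [W] serves to cross the boundary of
    a cluster, to grow a tree of arms, and to explore from outside a box. *)
Lemma walk_enter U W x s y : walk U x s y -> ~ W x -> W y ->
  exists s1 e s2 a c, [/\ s = s1 ++ e :: s2, walk (U `\` W) x s1 a,
    joins e a c, W c & walk U c s2 y].
Proof.
elim: s x => [|e s IH] x /=; first by move=> [_ ->].
move=> [Ux [z xz zy]] Wx Wy; have [Wz|Wz] := pselect (W z).
  by exists [::], e, s, x, z; split.
have [s1 [f [s2 [a [c [-> za ac Wc cy]]]]]] := IH z zy Wz Wy.
by exists (e :: s1), f, s2, a, c; split => //=; split => //; exists z.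
Qed.

Definition visited x s : set V :=
  [set a | a = x \/ exists2 e, e \in s & exists c, joins e a c].

Lemma visited_split U x s y a : walk U x s y -> visited x s a ->
  exists s1 s2, [/\ s = s1 ++ s2, walk U x s1 a & walk U a s2 y].
Proof.
elim: s x => [|e s IH] x /=.
  by move=> [Ux <-] [->|[]] //; exists [::], [::].
move=> [Ux [z xz zy]] [->|[f]].
  by exists [::], (e :: s); split => //=; split => //; exists z.
rewrite inE => /orP[/eqP -> [c ac]|fs [c ac]].
  have [[-> _]|[-> _]] := joins_same xz ac.
    by exists [::], (e :: s); split => //=; split => //; exists z.
  exists [:: e], s; split => //=; split => //; exists z => //.
  by split => //; exact: walk_start zy.
have [|s1 [s2 [-> za ay]]] := IH z zy; first by right; exists f => //; exists c.
by exists (e :: s1), s2; split => //=; split => //; exists z.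
Qed.

Lemma visited_inside x s e : e \in s -> inside (visited x s) e.
Proof.
move=> es; split; right; exists e => //.
  by exists (ends e).2; rewrite /joins -surjective_pairing eqxx.
by exists (ends e).1; rewrite /joins -surjective_pairing eqxx orbT.
Qed.

(** The walk from [u] is stopped at its first entrance into [W].  If [W] consists
    of the vertices of earlier walks, the new one is thus edge-disjoint from
    them. *)
Lemma linked_attach W w u y : linked_in setT w u y -> W y ->
  exists z s, [/\ W z, walk setT u s z, all w s, uniq s &
    forall e, e \in s -> ~ inside W e].
Proof.
move=> [s0 /walk_uniq[s [uy us ss]] ws0] Wy.
have ws : all w s by apply/allP => e /ss; exact: (allP ws0).
have [Wu|Wu] := pselect (W u); first by exists u, [::]; split.
have [s1 [e [s2 [a [c [sE ua ac Wc _]]]]]] := walk_enter uy Wu Wy.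
rewrite sE all_cat /= in ws; case/and3P: ws => ws1 we _.
exists c, (rcons s1 e); split => //.
- rewrite -cats1; apply/walk_cat; exists a; first exact: walk_sub ua.
  by split => //; exists c.
- by rewrite all_rcons we.
- by move: us; rewrite sE -cat_rcons cat_uniq => /andP[].
- move=> f; rewrite mem_rcons inE => /orP[/eqP ->|fs1].
    by move/(joins_inside _ ac) => [Wa _]; have [] := walk_end ua.
  by move=> [Wf _]; have [[_ ]] := walk_inside ua fs1.
Qed.

Fixpoint disjoint_family (Xs : seq (set (seq E))) : set (seq E) :=
  if Xs is X :: Xs' then disjointly X (disjoint_family Xs') else [set [::]].

Fixpoint members (Xs : seq (set (seq E))) (ss : seq (seq E)) : Prop :=
  match Xs, ss with
  | X :: Xs', s :: ss' => X s /\ members Xs' ss'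
  | [::], [::] => True
  | _, _ => False
  end.

Lemma occurs_disjoint_family Xs ss w : members Xs ss -> uniq (flatten ss) ->
  all w (flatten ss) -> occurs (disjoint_family Xs) w.
Proof.
move=> H u aw; exists (flatten ss) => // {aw}.
elim: Xs ss H u => [|X Xs IH] [|s ss] //= [Xs_ H].
rewrite cat_uniq => /and3P[us /hasPn d u].
exists s, (flatten ss); split => //; first exact: IH.
by move=> e es; apply/negP => /d; rewrite es.
Qed.

(** The branch point is where a walk from [u] first meets a given walk from [a]
    to [o]. *)
Lemma linked3_arms w a o u : linked_in setT w a o -> linked_in setT w a u ->
  exists z, occurs (disjoint_family
    [:: walk setT a ^~ z; walk setT z ^~ o; walk setT u ^~ z]) w.
Proof.
move=> [s0 /walk_uniq[s [ao us ss]] ws0] au.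
have ws : all w s by apply/allP => e /ss; exact: (allP ws0).
have [|z [t [Wz uz wt ut dt]]] := @linked_attach (visited a s) w u a
  (linked_in_sym au); first by left.
have [s1 [s2 [sE az zo]]] := visited_split ao Wz.
exists z; apply: (@occurs_disjoint_family _ [:: s1; s2; t]) => //=.
  rewrite cats0 catA -sE cat_uniq us ut andbT /=; apply/hasPn => e et.
  by apply/negP => es; apply: (dt e et); exact: visited_inside.
by rewrite cats0 catA -sE all_cat ws.
Qed.

Definition arms5 (a o u v y z : V) : seq (set (seq E)) :=
  [:: walk setT a ^~ y; walk setT y ^~ o; walk setT y ^~ z;
      walk setT z ^~ u; walk setT v ^~ z].

(** A walk from the fourth point [v] is attached to the three arms joining the
    other points at [y]; the three cases are the arm that it meets. *)
Lemma linked4_arms w a o u v :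
  linked_in setT w a o -> linked_in setT w a u -> linked_in setT w a v ->
  exists y z, [\/ occurs (disjoint_family (arms5 a o u v y z)) w,
                  occurs (disjoint_family (arms5 a u o v y z)) w |
                  occurs (disjoint_family (arms5 o u a v y z)) w].
Proof.
move=> [s0 /walk_uniq[s [ao us ss]] ws0] au av.
have ws : all w s by apply/allP => e /ss; exact: (allP ws0).
have [|y [t [Wy uy wt ut dt]]] := @linked_attach (visited a s) w u a
  (linked_in_sym au); first by left.
have [s1 [s2 [sE ay yo]]] := visited_split ao Wy.
pose W := visited a s `|` visited u t.
have [|z [r [Wz vz wr ur dr]]] := @linked_attach W w v a (linked_in_sym av).
  by left; left.
have ust : uniq (s1 ++ s2 ++ t ++ r).
  rewrite !catA -sE -catA cat_uniq us cat_uniq ut ur !andbT /=.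
  apply/andP; split; apply/hasPn => e.
    rewrite mem_cat => /orP[et|er]; apply/negP => es.
      by apply: (dt e et); exact: visited_inside.
    by apply: (dr e er); have [] := visited_inside a es; split; left.
  move=> er; apply/negP => et.
  by apply: (dr e er); have [] := visited_inside u et; split; right.
have wst : all w (s1 ++ s2 ++ t ++ r) by rewrite !catA -sE !all_cat ws wt.
have fin (ss' : seq (seq E)) Xs : members Xs ss' ->
    perm_eq (flatten ss') (s1 ++ s2 ++ t ++ r) -> occurs (disjoint_family Xs) w.
  move=> m p; apply: occurs_disjoint_family m _ _; first by rewrite (perm_uniq p).
  by rewrite (perm_all _ p).
have ws12 : visited a s z -> visited a s1 z \/ visited y s2 z.
  rewrite sE => -[->|[e]]; first by left; left.
  by rewrite mem_cat => /orP[] es H; [left|right]; right; exists e.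
case: Wz => [/ws12[]|] Wz.
(* The arm from [v] meets the one from [a] to [y]. *)
- have [p1 [p2 [pE az zy]]] := visited_split ay Wz.
  exists y, z; constructor 3 => //.
  apply: (fin [:: rev s2; rev t; rev p2; rev p1; r]) => /=.
    by split; [exact: walk_rev|split; [exact: walk_rev|split;
      [exact: walk_rev|split; [exact: walk_rev|]]]].
  rewrite pE cats0; apply/permP => q; rewrite !count_cat !count_rev.
  by rewrite !addnA; lia.
- have [p1 [p2 [pE yz zo]]] := visited_split yo Wz.
  exists y, z; constructor 2.
  apply: (fin [:: s1; rev t; p1; p2; r]) => /=; first by do !split => //; exact: walk_rev.
  by rewrite pE cats0; apply/permP => q; rewrite !count_cat !count_rev; lia.
- have [p1 [p2 [pE uz zy]]] := visited_split uy Wz.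
  exists y, z; constructor 1.
  apply: (fin [:: s1; s2; rev p2; rev p1; r]) => /=.
    by do !split => //; exact: walk_rev.
  by rewrite pE cats0; apply/permP => q; rewrite !count_cat !count_rev; lia.
Qed.

End Walks.

(** * Connection probabilities *)

Section Connections.
Context {R : realType} (G : weighted_graph R).
Local Notation V := (vertex G).
Local Notation E := (edge G).
Local Notation config := (config G).
Implicit Types (U W : set V) (x y z a o u v : V) (e : E).

Definition linked_event U x y : set config := [set w | linked_in U w x y].

Lemma linked_event_measurable U x y : measurable (linked_event U x y).
Proof. exact: occurs_measurable. Qed.

Definition coupling x y : \bar R :=
  \S_ e (if joins e x y then (weight e)%:E else 0).

Lemma coupling_ge0 x y : 0 <= coupling x y.
Proof. by apply: tsum_ge0 => e; case: ifP => // _; rewrite lee_fin weight_ge0. Qed.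

Lemma couplingC x y : coupling x y = coupling y x.
Proof. by apply: eq_tsum => e; rewrite joinsC. Qed.

(** A loop at [v] has two orientations, both counted on the right, but occurs once
    on the left. *)
Lemma tsum_coupling v : \S_ y coupling v y <= out_weight v.
Proof.
rewrite exchange_tsum; last first.
  by move=> y e; case: ifP => // _; rewrite lee_fin weight_ge0.
have w0 (c : bool) (e : E) : (0 : \bar R) <= if c then (weight e)%:E else 0.
  by case: c => //; rewrite lee_fin weight_ge0.
have -> : out_weight v = \S_ e \S_ c
    (if (e, c) \in @out_edges R G v then (weight e)%:E else 0).
  rewrite (@tsum_pair _ _ _ (fun (e : E) (c : bool) =>
     if (e, c) \in @out_edges R G v then (weight e)%:E else 0)); last first.
    by move=> e c; exact: w0.
  by rewrite /out_weight tsum_indic; apply: eq_tsum => -[].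
apply: le_tsum => e.
have two_bool (f : bool -> \bar R) : (forall c, 0 <= f c) ->
    f false + f true <= tsum f.
  move=> f0; have := @tsum_ge_fsum R _ f [:: false; true] isT f0.
  by rewrite big_cons big_seq1.
apply: (le_trans _ (two_bool _ _)); last by move=> c; exact: w0.
have outE c : ((e, c) \in @out_edges R G v) =
    ((if c then (ends e).2 else (ends e).1) == v).
  by apply/idP/eqP => [/set_mem|H]; [|apply/mem_set; move: H];
    rewrite /out_edges /origin /=; case: c.
rewrite !outE /=.
apply: le_trans (_ : \S_ y ((if ends e == (v, y) then (weight e)%:E else 0) +
  (if ends e == (y, v) then (weight e)%:E else 0)) <= _).
  apply: le_tsum => y; rewrite /joins; case: eqP => _ /=.
    by rewrite leeDl //; exact: w0.
  by rewrite add0e.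
rewrite tsumD; [|by move=> y; exact: w0|by move=> y; exact: w0].
have one (p q : V) : \S_ y (if (p == v) && (q == y) then (weight e)%:E else 0) <=
    if p == v then (weight e)%:E else 0.
  case: eqP => _ /=; last by rewrite tsum0.
  rewrite -[leRHS](@tsum_delta R _ (fun=> (weight e)%:E) q); last first.
    by move=> _; rewrite lee_fin weight_ge0.
  apply: le_tsum => y; rewrite eq_sym; case: eqP => _; first by rewrite mul1e.
  by rewrite mul0e.
apply: leeD.
  apply: le_trans (one (ends e).1 (ends e).2); apply: le_tsum => y.
  by rewrite [in leLHS](surjective_pairing (ends e)) xpair_eqE.
apply: le_trans (one (ends e).2 (ends e).1); apply: le_tsum => y.
by rewrite [in leLHS](surjective_pairing (ends e)) xpair_eqE andbC.
Qed.

(** ** Automorphisms *)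

Definition lift_aut (f : V -> V) (g : E -> E) : Prop :=
  [/\ bijective f, bijective g, forall e x y, joins (g e) (f x) (f y) = joins e x y
    & forall e, weight (g e) = weight e].

Lemma automorphism_lift (f : V -> V) : automorphism f -> exists g, lift_aut f g.
Proof.
move=> [bf [g bg gP]]; exists g; split => // [e x y|e]; last by have [] := gP e.
have [+ _] := gP e; rewrite /joins.
have fi := bij_inj bf.
case: (ends e) (ends (g e)) => p q [p' q'] /=.
rewrite !xpair_eqE.
by move=> /orP[/andP[/eqP -> /eqP ->]|/andP[/eqP -> /eqP ->]];
  rewrite !(inj_eq fi) // orbC andbC [X in _ || X]andbC.
Qed.

Lemma linked_aut f g (w : config) x y : lift_aut f g ->
  linked_in setT w (f x) (f y) <->
  linked_in setT (fun e => (w : E -> bool) (g e)) x y.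
Proof.
move=> [bf bg gj _]; split; last first.
  move=> [s]; elim: s x => [|e s IH] x /=.
    by move=> [_ <-] _; exact: linked_in_refl.
  move=> [_ [z xz zy]] /andP[we ws].
  apply: linked_in_trans (IH z zy ws).
  by apply: linked_in_edge we _ => //; rewrite gj.
have [f' _ ff'] := bf; have [g' _ gg'] := bg.
move=> [s]; elim: s x => [|e s IH] x /=.
  by move=> [_ /(bij_inj bf) ->] _; exact: linked_in_refl.
move=> [_ [z xz zy]] /andP[we ws]; rewrite -(ff' z) in xz zy.
apply: linked_in_trans (IH _ zy ws).
rewrite -(gg' e) in we xz; rewrite gj in xz.
exact: linked_in_edge we xz.
Qed.

Lemma coupling_aut f x y : automorphism f -> coupling (f x) (f y) = coupling x y.
Proof.
move=> /automorphism_lift[g [_ bg gj gw]].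
rewrite /coupling -(reindex_tsum _ bg); apply: eq_tsum => e.
by rewrite gj gw.
Qed.

Variables (b : R) (P : probability config R).
Hypotheses (b0 : (0 <= b)%R) (lP : percolation_law b P).

Lemma prob_aut f (Q : (V -> V -> Prop) -> Prop) :
  automorphism f ->
  measurable [set w : config | Q (linked_in setT w)] ->
  P [set w : config | Q (fun x y => linked_in setT w (f x) (f y))] =
  P [set w : config | Q (linked_in setT w)].
Proof.
move=> /automorphism_lift[g fg] mQ.
have [_ bg _ gw] := fg.
rewrite -(law_reindex lP bg gw mQ); congr (P _); apply/seteqP; split => w /=;
  congr Q; apply/funext => x; apply/funext => y; apply/propext;
  by have := linked_aut w x y fg; tauto.
Qed.

Definition conn U x y : \bar R := P (linked_event U x y).
Local Notation T := (conn setT).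

Lemma conn_ge0 U x y : 0 <= conn U x y. Proof. exact: measure_ge0. Qed.

Lemma conn_sym U x y : conn U x y = conn U y x.
Proof.
by congr (P _); apply/seteqP; split => w; exact: linked_in_sym.
Qed.

Lemma conn_sub U W x y : U `<=` W -> conn U x y <= conn W x y.
Proof.
move=> UW; apply: le_measure_sub; try exact: linked_event_measurable.
by move=> w; exact: linked_in_sub.
Qed.

Lemma conn_le1 U x y : conn U x y <= 1.
Proof. by apply: probability_le1; exact: linked_event_measurable. Qed.

Lemma conn_refl x : T x x = 1.
Proof.
rewrite /conn (_ : linked_event _ _ _ = setT) ?probability_setT //.
by apply/seteqP; split => // w _; exact: linked_in_refl.
Qed.

Lemma two_pointE x y : P [set w | linked w x y] = T x y.
Proof.
by congr (P _); apply/seteqP; split => w /=; move/linked_inE.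
Qed.

Lemma conn_aut f x y : automorphism f -> T (f x) (f y) = T x y.
Proof.
move=> af; apply: (@prob_aut f (fun l => l x y) af).
exact: linked_event_measurable.
Qed.

(** ** Consequences of the van den Berg--Kesten inequality *)

Lemma BK_family Xs : P (occurs (disjoint_family Xs)) <=
  foldr (fun X r => P (occurs X) * r) 1 Xs.
Proof.
elim: Xs => [|X Xs IH] /=; first by apply: probability_le1; exact: occurs_measurable.
apply: le_trans (BK b0 lP _ _) _.
by apply: lee_wpmul2l => //.
Qed.

Lemma prob_linked3 a o u :
  P (linked_event setT a o `&` linked_event setT a u) <=
  \S_ z (T a z * T z o * T u z).
Proof.
apply: le_trans (@measure_le_tsum _ _ _ P _ _ (fun z => occurs (disjoint_family
    [:: walk setT a ^~ z; walk setT z ^~ o; walk setT u ^~ z])) _ _ _) _.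
- by apply: measurableI; exact: linked_event_measurable.
- by move=> z; exact: occurs_measurable.
- by move=> w [ao au]; exact: linked3_arms.
- apply: le_tsum => z; apply: le_trans (BK_family _) _.
  by rewrite /= mule1 muleA.
Qed.

Lemma prob_linked4 a o u v :
  P (linked_event setT a o `&` linked_event setT a u `&` linked_event setT a v) <=
  \S_ y \S_ z (T a y * T y o * T y z * T z u * T v z +
               T a y * T y u * T y z * T z o * T v z +
               T o y * T y u * T y z * T z a * T v z).
Proof.
pose Q (p : V * V) (i : nat) := occurs (disjoint_family
  (nth [::] [:: arms5 a o u v p.1 p.2; arms5 a u o v p.1 p.2; arms5 o u a v p.1 p.2] i)).
rewrite tsum_pair; last first.
  by move=> y z; rewrite !adde_ge0 // !mule_ge0 // conn_ge0.
apply: le_trans (@measure_le_tsum _ _ _ P _ _ (fun p => Q p 0%N `|` Q p 1%N `|` Q p 2%N) _ _ _) _.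
- by do 2?apply: measurableI; exact: linked_event_measurable.
- by move=> p; do 2?apply: measurableU; exact: occurs_measurable.
- move=> w [[ao au] av]; have [y [z H]] := linked4_arms ao au av; exists (y, z).
  by case: H => H; [left; left|left; right|right].
- rewrite {}/Q; apply: le_tsum => -[y z] /=.
  apply: le_trans.
    by apply: measureU2; [apply: measurableU|]; exact: occurs_measurable.
  have arms a' o' u' : P (occurs (disjoint_family (arms5 a' o' u' v y z))) <=
      T a' y * T y o' * T y z * T z u' * T v z.
    by apply: le_trans (BK_family _) _; rewrite /= mule1 !muleA.
  apply: leeD; last exact: arms.
  apply: le_trans; first by apply: measureU2; exact: occurs_measurable.
  by apply: leeD; exact: arms.
Qed.

(** An open path from [x] into [W] has a first edge into [W]; this edge and the
    parts of the path before and after it are disjoint witnesses, and the edge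
    is open with probability at most [b] times its weight. *)
Lemma conn_boundary W x u : ~ W x -> W u ->
  T x u <= \S_ v \S_ a (if a \in W then
    conn (~` W) x v * (b%:E * coupling v a) * T a u else 0).
Proof.
move=> Wx Wu.
pose F (k : V * V * E) := let: (v, a, e) := k in
  if (a \in W) && joins e v a then
    disjoint_family [:: walk (~` W) x ^~ v; [set [:: e]]; walk setT a ^~ u] else set0.
apply: le_trans (@measure_le_tsum _ _ _ P _ _ (fun k => occurs (F k)) _ _ _) _.
- exact: linked_event_measurable.
- by move=> k; exact: occurs_measurable.
- move=> w [s0 /walk_uniq[s [xu us ss]] ws0].
  have ws : all w s by apply/allP => e /ss; exact: (allP ws0).
  have [s1 [e [s2 [v [a [sE xv va Wa au]]]]]] := walk_enter xu Wx Wu.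
  exists (v, a, e); rewrite /F mem_set ?va //.
  apply: (@occurs_disjoint_family _ _ _ [:: s1; [:: e]; s2]); rewrite /= ?cats0 -?sE //.
  by split; [apply: walk_sub xv => c []|].
apply: le_trans (_ : \S_ p \S_ e P (occurs (F (p, e))) <= _).
  by rewrite (@tsum_pair _ _ _ (fun p e => P (occurs (F (p, e))))) //;
    apply: le_tsum => -[].
rewrite (@tsum_pair _ _ _ (fun v a => if a \in W then _ else 0)); last first.
  by move=> v a; case: ifP => // _; rewrite !mule_ge0 ?conn_ge0 ?coupling_ge0.
apply: le_tsum => -[v a] /=; rewrite /F; case: ifP => Wa /=; last first.
  rewrite (eq_tsum (g := fun=> 0)) ?tsum0 // => e.
  by rewrite (_ : occurs _ = set0) ?measure0 //; apply/seteqP; split => // w [].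
apply: le_trans (_ : \S_ e (conn (~` W) x v * T a u * b%:E *
   (if joins e v a then (weight e)%:E else 0)) <= _).
  apply: le_tsum => e; case: ifP => va; last first.
    rewrite mule0 (_ : occurs _ = set0) ?measure0 //.
    by apply/seteqP; split => // w [].
  apply: le_trans (BK_family [:: walk (~` W) x ^~ v; [set [:: e]];
    walk setT a ^~ u]) _; rewrite /= mule1 -!muleA.
  apply: lee_wpmul2l => //; rewrite muleC; apply: lee_wpmul2l => //.
  apply: le_trans (law_open_le e lP); apply: le_measure_sub.
  - exact: occurs_measurable.
  - exact: measurable_coordinate.
  - by move=> w [_ ->] /=; rewrite andbT.
rewrite tsumZl; first last.
- by rewrite !mule_ge0 ?conn_ge0 // lee_fin.
- by move=> e; case: ifP => // _; rewrite lee_fin weight_ge0.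
by rewrite -/(coupling v a) -!muleA (muleCA (T a u)) (muleC (T a u)) !muleA.
Qed.

(** ** Clusters *)

Definition cluster_event u (S : set V) : set config :=
  [set w | forall x, linked_in setT w u x <-> S x].

Lemma cluster_event_measurable u S : measurable (cluster_event u S).
Proof.
rewrite (_ : cluster_event u S = \bigcap_(x in setT)
  (if `[< S x >] then linked_event setT u x else ~` linked_event setT u x)).
  apply: countable_bigcap_measurable => x; case: ifP => _.
    exact: linked_event_measurable.
  by apply: measurableC; exact: linked_event_measurable.
apply/seteqP; split => w H x; last first.
  by have := H x I; case: asboolP => Sx H'; split.
by move=> _; case: asboolP => Sx; [apply/H|move=> /H].
Qed.

Lemma linked_in_own_cluster w u x : linked_in setT w u x ->
  linked_in [set z | linked_in setT w u z] w u x.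
Proof.
move=> [s us ws].
have : linked_in setT w u u by exact: linked_in_refl.
move: us ws; set U := [set z | _].
have : forall a, walk setT a s x -> all w s -> U a -> linked_in U w a x.
  elim: s => [|e s IH] a /=; first by move=> [_ <-] _ Ua; exact: linked_in_refl.
  move=> [_ [z az zx]] /andP[we ws] Ua.
  have Uz : U z by apply: linked_in_trans Ua _; exact: linked_in_edge we az.
  by apply: linked_in_trans (IH _ zx ws Uz); exact: linked_in_edge we az.
by move=> H us ws uu; exact: H.
Qed.

Lemma cluster_event_linked w u S x : cluster_event u S w -> S x ->
  linked_in S w u x.
Proof.
move=> K Sx; have /linked_in_own_cluster : linked_in setT w u x by apply/K.
by apply: linked_in_sub => // z /K.
Qed.

(** Exploring a cluster reveals only the edges which touch it. *)
Lemma cluster_event_depends u S :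
  depends_on (~` inside (~` S)) (cluster_event u S).
Proof.
move=> w w' ww' K x; split.
  move=> ux; apply: contrapT => Sx.
  have Su : ~ (~` S) u by move=> /(_ _); apply; apply/K; exact: linked_in_refl.
  case: ux => s us ws'.
  have [s1 [e [s2 [a [c [sE ua ac Sc _]]]]]] := walk_enter us Su Sx.
  apply: Sc; apply/K.
  have Sa : S a by have [_ /contrapT] := walk_end ua.
  have we : (w : E -> bool) e.
    rewrite ww'; first by apply: (allP ws'); rewrite sE mem_cat inE eqxx orbT.
    by move/(joins_inside _ ac) => [].
  by apply: linked_in_trans (linked_in_edge _ _ we ac) => //; apply/K.
move=> Sx; have := cluster_event_linked K Sx; move=> [s us ws].
exists s; first exact: walk_sub us.
apply/allP => e es; rewrite -ww'; first exact: (allP ws).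
by move: (walk_inside us es) => [S1 _] [].
Qed.

Lemma cluster_indep u S v x :
  P (cluster_event u S `&` linked_event (~` S) v x) =
  P (cluster_event u S) * conn (~` S) v x.
Proof.
apply: (law_indep (I := ~` inside (~` S)) lP).
- exact: cluster_event_measurable.
- exact: linked_event_measurable.
- exact: cluster_event_depends.
- by rewrite setCK; exact: linked_in_depends.
Qed.

Lemma linked_off_cluster w u S v x : cluster_event u S w -> ~ S v ->
  linked_in setT w v x <-> linked_in (~` S) w v x.
Proof.
move=> K Sv; split; last exact: linked_in_sub.
move=> /linked_in_own_cluster; apply: linked_in_sub => // z vz /K uz.
by apply: Sv; apply/K; apply: linked_in_trans uz _; exact: linked_in_sym.
Qed.

Definition infinite_cluster u : set config :=
  [set w | infinite_set [set x | linked_in setT w u x]].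

Lemma infinite_cluster_measurable u : measurable (infinite_cluster u).
Proof.
rewrite (_ : infinite_cluster u =
    ~` \bigcup_(S in setT) cluster_event u [set` (S : {fset V})]).
  apply: measurableC; apply: countable_bigcup_measurable => S.
  exact: cluster_event_measurable.
apply/seteqP; split => w; rewrite /infinite_cluster /=.
  move=> inf [S _ K]; apply: inf; rewrite (_ : [set x | _] = [set` S]) //.
  by apply/seteqP; split => x /=; move/K.
move=> H fK; apply: H; exists (fset_set [set x | linked_in setT w u x]) => //.
by move=> x /=; rewrite in_fset_set // in_setE.
Qed.

(** Finite sets are countably many, so almost surely finite clusters can be summed
    over. *)
Lemma cluster_partition u A : measurable A -> P (infinite_cluster u) = 0 ->
  P A = tsum (fun S : {fset V} => P (A `&` cluster_event u [set` S])).
Proof.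
move=> mA P0; have mI := infinite_cluster_measurable u.
rewrite (measureDI P mA mI) [X in _ + X](_ : _ = 0) ?adde0; last first.
  apply/eqP; rewrite eq_le measure_ge0 andbT -P0.
  by apply: le_measure_sub => //; exact: measurableI.
pose B (S : {fset V}) := cluster_event u [set` S].
transitivity (tsum (fun S => P ((A `\` infinite_cluster u) `&` B S))).
  apply: measure_tsum_partition.
  - exact: measurableD.
  - by move=> S; exact: cluster_event_measurable.
  - move=> w [_ /contrapT fK]; exists (fset_set [set x | linked_in setT w u x]) => x.
    by rewrite /= in_fset_set // in_setE.
  - move=> S S' w K K'; apply/fsetP => x; apply/idP/idP => xS.
      by apply/K'/K.
    by apply/K/K'.
apply: eq_tsum => S; congr (P _); apply/seteqP; split => w.
  by move=> [[Aw _] K].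
move=> [Aw K]; split => //; split => //; apply.
rewrite (_ : [set x | _] = [set` S]) //.
by apply/seteqP; split => x /=; move/K.
Qed.

End Connections.

(** * Positive semidefiniteness and diagrams *)

Section PositiveSemidefinite.
Context {R : realType}.

Definition kernel_form (W : countType) (K : W -> W -> \bar R) (X Y : W -> \bar R)
  : \bar R := \S_ s \S_ t (X s * K s t * Y t).

Lemma mule_amgm (a c : \bar R) : 0 <= a -> 0 <= c -> a * c + a * c <= a * a + c * c.
Proof.
case: a => [a| |] //; case: c => [c| |] // a0 c0.
- rewrite -!EFinM -!EFinD lee_fin -subr_ge0.
  have -> : (a * a + c * c - (a * c + a * c) = (a - c) ^+ 2)%R by ring.
  exact: sqr_ge0.
all: by rewrite ?mulyy ?addey ?addye ?leey // -EFinM.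
Qed.

Lemma double_le (a c : \bar R) : 0 <= a -> 0 <= c -> a + a <= c + c -> a <= c.
Proof.
case: a => [a| |] //; case: c => [c| |] // a0 c0; rewrite ?leey //.
by rewrite -!EFinD !lee_fin; lra.
Qed.

Let ind (Q : Prop) : \bar R := ((`[< Q >])%:R : R)%:E.

Let ind_ge0 Q : 0 <= ind Q.
Proof. by rewrite lee_fin ler0n. Qed.

(** The form of an equivalence relation is a sum over classes of products of
    class sums, so the arithmetic-geometric inequality applies classwise. *)
Lemma equivalence_form (W : countType) (r : W -> W -> Prop) (K : W -> W -> \bar R)
    (X Y : W -> \bar R) : (forall s t, K s t = ind (r s t)) ->
  (forall s, r s s) -> (forall s t, r s t -> r t s) ->
  (forall s t u, r s t -> r t u -> r s u) ->
  (forall s, 0 <= X s) -> (forall s, 0 <= Y s) ->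
  kernel_form K X Y + kernel_form K X Y <= kernel_form K X X + kernel_form K Y Y.
Proof.
move=> KE rr rs rt X0 Y0.
pose rep s := xget s [set t | r s t].
have r_rep s : r s (rep s) by exact: (xgetI s (rr s)).
have rep_eq s t : r s t <-> rep s = rep t.
  split; last by move=> e; apply: rt (r_rep s) _; rewrite e; apply: rs.
  move=> st; rewrite /rep.
  have -> : [set u | r s u] = [set u | r t u].
    apply/seteqP; split => u /= H; first exact: rt (rs _ _ st) H.
    exact: rt st H.
  by rewrite /xget; case: pselect => // H; exfalso; apply: H; exists t; apply/asboolP; exact: (rr t).
have formE (A B : W -> \bar R) : (forall s, 0 <= A s) -> (forall s, 0 <= B s) ->
    kernel_form K A B = \S_ c ((\S_ s (A s * ind (rep s = c))) *
                               (\S_ t (B t * ind (rep t = c)))).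
  move=> A0 B0; transitivity (\S_ s \S_ t \S_ c
      ((A s * ind (rep s = c)) * (B t * ind (rep t = c)))).
    apply: eq_tsum => s; apply: eq_tsum => t.
    rewrite (eq_tsum (g := fun c => ((c == rep s)%:R)%:E * (A s * B t * ind (rep t = c)))).
      rewrite tsum_delta; last by nng.
      rewrite KE muleAC; congr (_ * _); rewrite /ind; congr ((nat_of_bool _)%:R%:E).
      by apply/asbool_equiv_eq; rewrite rep_eq; split => ->.
    move=> c; rewrite /ind (_ : `[< rep s = c >] = (c == rep s)).
      by rewrite muleACA [RHS]muleC [RHS]muleAC -!muleA.
    by apply/asboolP/eqP.
  have n1 s t c : 0 <= A s * ind (rep s = c) * (B t * ind (rep t = c)).
    by nng.
  rewrite (eq_tsum (g := fun s => \S_ c \S_ t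
      ((A s * ind (rep s = c)) * (B t * ind (rep t = c))))); last first.
    by move=> s; rewrite exchange_tsum.
  rewrite exchange_tsum; last by move=> s c; apply: tsum_ge0 => t.
  apply: eq_tsum => c; rewrite -tsumZr; first last.
  - by nng.
  - by nng.
  by apply: eq_tsum => s; rewrite tsumZl // => [t|]; rewrite mule_ge0.
have s0 (A : W -> \bar R) c : (forall s, 0 <= A s) -> 0 <= \S_ s (A s * ind (rep s = c)).
  by nng.
rewrite !formE // -!tsumD; try by move=> c; rewrite mule_ge0 // s0.
by apply: le_tsum => c; apply: mule_amgm; exact: s0.
Qed.

(** The inequality is linear in the kernel, hence passes to averages. *)
Lemma random_equivalence_form d (Om : measurableType d)
    (mu : probability Om R) (W : countType) (r : Om -> W -> W -> Prop)
    (K : W -> W -> \bar R) (X Y : W -> \bar R) :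
  (forall s t, K s t = mu [set w | r w s t]) ->
  (forall s t, measurable [set w | r w s t]) ->
  (forall w s, r w s s) -> (forall w s t, r w s t -> r w t s) ->
  (forall w s t u, r w s t -> r w t u -> r w s u) ->
  (forall s, 0 <= X s) -> (forall s, 0 <= Y s) ->
  kernel_form K X Y + kernel_form K X Y <= kernel_form K X X + kernel_form K Y Y.
Proof.
move=> KE mr rr rs rt X0 Y0.
have indE s t w : ind (r w s t) = (\1_[set w | r w s t] w)%:E.
  by rewrite /ind indicE; congr ((nat_of_bool _)%:R%:E); apply/asboolP/idP;
    rewrite in_setE.
have mind s t : measurable_fun [set: Om] (fun w => ind (r w s t)).
  under eq_fun do rewrite indE.
  by apply/measurable_EFinP; exact: measurable_indic.
have mterm (A B : W -> \bar R) s t : measurable_fun [set: Om]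
    (fun w => A s * ind (r w s t) * B t).
  apply: emeasurable_funM; last exact: measurable_cst.
  by apply: emeasurable_funM => //; exact: measurable_cst.
have minner (A B : W -> \bar R) s : (forall s, 0 <= A s) -> (forall s, 0 <= B s) ->
   measurable_fun [set: Om] (fun w => \S_ t (A s * ind (r w s t) * B t)).
  by move=> A0 B0; apply: measurable_tsum => // t w; rewrite !mule_ge0.
have mform (A B : W -> \bar R) : (forall s, 0 <= A s) -> (forall s, 0 <= B s) ->
   measurable_fun [set: Om] (fun w => kernel_form (fun s t => ind (r w s t)) A B).
  move=> A0 B0; apply: measurable_tsum => [s|s w]; first exact: minner.
  by nng.
have form0 (A B : W -> \bar R) w : (forall s, 0 <= A s) -> (forall s, 0 <= B s) ->
   0 <= kernel_form (fun s t => ind (r w s t)) A B.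
  by move=> A0 B0; apply: tsum_ge0 => s; apply: tsum_ge0 => t; rewrite !mule_ge0.
have formE (A B : W -> \bar R) : (forall s, 0 <= A s) -> (forall s, 0 <= B s) ->
    kernel_form K A B = \int[mu]_w kernel_form (fun s t => ind (r w s t)) A B.
  move=> A0 B0; rewrite integral_tsum; first last.
  - by nng.
  - by move=> s; exact: minner.
  apply: eq_tsum => s; rewrite integral_tsum; first last.
  - by nng.
  - by move=> t; exact: mterm.
  apply: eq_tsum => t.
  rewrite ge0_integralZr //; first last.
  - by nng.
  - by apply: emeasurable_funM => //; exact: measurable_cst.
  rewrite ge0_integralZl //.
  rewrite KE; congr (_ * _ * _); under eq_integral do rewrite indE.
  by rewrite integral_indic // setIT.
rewrite !formE // -!ge0_integralD //; try by move=> w _; exact: form0.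
all: try exact: mform.
apply: ge0_le_integral => //.
- by move=> w _; rewrite adde_ge0 // form0.
- by apply: emeasurable_funD; exact: mform.
- by apply: emeasurable_funD; exact: mform.
- by move=> w _; apply: (@equivalence_form _ (r w)) => //; [exact: rs|exact: rt].
Qed.

End PositiveSemidefinite.

Lemma tsum5D {R : realType} (V : countType) (f g h : V -> V -> V -> V -> V -> \bar R) :
  (forall x u v y z, 0 <= f x u v y z) -> (forall x u v y z, 0 <= g x u v y z) ->
  (forall x u v y z, 0 <= h x u v y z) ->
  \S_ x \S_ u \S_ v \S_ y \S_ z (f x u v y z + g x u v y z + h x u v y z) =
  \S_ x \S_ u \S_ v \S_ y \S_ z f x u v y z +
  \S_ x \S_ u \S_ v \S_ y \S_ z g x u v y z +
  \S_ x \S_ u \S_ v \S_ y \S_ z h x u v y z.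
Proof.
move=> f0 g0 h0.
do 4 (rewrite -!tsumD; [|by nng..]; apply: eq_tsum => ?).
by rewrite -!tsumD //; by nng.
Qed.

Section Diagrams.
Context {R : realType} (V : countType) (T : V -> V -> \bar R).
Hypotheses (T0 : forall x y, 0 <= T x y) (TC : forall x y, T x y = T y x).

Definition conv2 x y := \S_ z (T x z * T z y).
Definition conv3 x y := \S_ z (T x z * conv2 z y).

Lemma conv2_ge0 x y : 0 <= conv2 x y.
Proof. by apply: tsum_ge0 => z; rewrite mule_ge0. Qed.

Lemma conv3_ge0 x y : 0 <= conv3 x y.
Proof. by apply: tsum_ge0 => z; rewrite mule_ge0 // conv2_ge0. Qed.

Lemma conv2C x y : conv2 x y = conv2 y x.
Proof. by apply: eq_tsum => z; rewrite (TC x z) (TC z y) muleC. Qed.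

Lemma conv3E x y : conv3 x y = \S_ z \S_ v (T x z * T z v * T v y).
Proof.
apply: eq_tsum => z; rewrite /conv2 -tsumZl; [|by nng|by []].
by apply: eq_tsum => v; rewrite muleA.
Qed.

Lemma conv3E' x y : conv3 x y = \S_ z (conv2 x z * T z y).
Proof.
rewrite conv3E exchange_tsum; last by nng.
apply: eq_tsum => v; rewrite /conv2 -tsumZr; [by []|by nng|by []].
Qed.

Lemma conv3C x y : conv3 x y = conv3 y x.
Proof.
rewrite conv3E'; apply: eq_tsum => z.
by rewrite muleC (TC z y) (conv2C x z).
Qed.

Lemma triangleE o : conv3 o o =
  \esum_(p in [set: V * V]) (T o p.1 * T p.1 p.2 * T p.2 o).
Proof.
rewrite conv3E (@tsum_pair _ _ _ (fun z v => T o z * T z v * T v o)) //.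
by nng.
Qed.

Lemma conv3_form x y : conv3 x y = kernel_form T (T x) (fun z => T z y).
Proof. exact: conv3E. Qed.

Hypothesis T_psd : forall X Y : V -> \bar R,
  (forall s, 0 <= X s) -> (forall s, 0 <= Y s) ->
  kernel_form T X Y + kernel_form T X Y <= kernel_form T X X + kernel_form T Y Y.

(** Cauchy--Schwarz for the form of [T] at the functions [T x] and [T y], whose
    values on the diagonal are [conv3 x x] and [conv3 y y]. *)
Lemma conv3_le (N : \bar R) x y : (forall z, conv3 z z = N) -> conv3 x y <= N.
Proof.
move=> HN; apply: double_le; [exact: conv3_ge0|by rewrite -(HN x) conv3_ge0|].
rewrite conv3_form; apply: le_trans (T_psd _ _) _ => //.
rewrite -{1}(HN x) -(HN y) !conv3_form.
have e z : T z = T ^~ z by apply/funext => v; rewrite TC.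
by rewrite -!e.
Qed.

(** The connection probability of pairs of vertices in two independent copies. *)
Definition TT (s t : V * V) : \bar R := T s.1 t.1 * T s.2 t.2.

Hypothesis TT_psd : forall X Y : V * V -> \bar R,
  (forall s, 0 <= X s) -> (forall s, 0 <= Y s) ->
  kernel_form TT X Y + kernel_form TT X Y <= kernel_form TT X X + kernel_form TT Y Y.

Let exch4 (f : V -> V -> V -> V -> \bar R) : (forall p q p' q', 0 <= f p q p' q') ->
  \S_ s \S_ t f s.1 s.2 t.1 t.2 = \S_ p \S_ q \S_ p' \S_ q' f p q p' q'.
Proof.
move=> f0; rewrite (@tsum_pair _ _ _ (fun p q => \S_ p' \S_ q' f p q p' q')).
  apply: eq_tsum => -[p q] /=.
  by rewrite (@tsum_pair _ _ _ (fun p' q' => f p q p' q')).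
by move=> p q; apply: tsum_ge0 => p'; apply: tsum_ge0 => q'.
Qed.

(** The diagram with three paths of length two between [a] and [z] is compared
    with the one with paths of lengths one, two and three: rooted at the middle
    of one of the paths of length two, the remaining pair of paths is the form
    of [T (x) T] at two functions which are mirror images of each other. *)
Lemma theta_mirror o :
  \S_ a \S_ z (T a o * T z o * (conv2 a z * conv2 a z)) <=
  \S_ a \S_ z (T a o * T z o * (T a z * conv3 a z)).
Proof.
pose X (s : V * V) := T s.1 o * T s.1 s.2.
pose Y (s : V * V) := T s.1 s.2 * T s.2 o.
have X0 s : 0 <= X s by rewrite mule_ge0.
have Y0 s : 0 <= Y s by rewrite mule_ge0.
have sum0 (f : V -> V -> V -> \bar R) x : (forall y z, 0 <= f x y z) -> 
    0 <= \S_ y \S_ z f x y z.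
  by move=> f0; apply: tsum_ge0 => y; apply: tsum_ge0 => z.
have XY : kernel_form TT X Y =
    \S_ a \S_ z (T a o * T z o * (conv2 a z * conv2 a z)).
  rewrite /kernel_form (@exch4 (fun p q p' q' =>
    (T p o * T p q) * (T p p' * T q q') * (T p' q' * T q' o))); last first.
    by nng.
  apply: eq_tsum => p.
  transitivity (\S_ q \S_ q' \S_ p' ((T p o * T p q) * (T p p' * T q q') * (T p' q' * T q' o))).
    by apply: eq_tsum => q; rewrite exchange_tsum // => x y; rewrite !mule_ge0.
  rewrite exchange_tsum; last by nng.
  apply: eq_tsum => q'.
  transitivity (\S_ q (T p o * T q' o * (T p q * T q q' * conv2 p q'))).
    apply: eq_tsum => q.
    rewrite muleA -tsumZl; [|by nng|by nng].
    apply: eq_tsum => p'.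
    by rewrite (AC ((2*2)*2) ((1*6)*(2*4)*(3*5))).
  rewrite tsumZl; [|by move=> q; rewrite !mule_ge0 // conv2_ge0|by nng].
  congr (_ * _); rewrite tsumZr //; last exact: conv2_ge0.
  by nng.
have XX : kernel_form TT X X =
    \S_ a \S_ z (T a o * T z o * (T a z * conv3 a z)).
  rewrite /kernel_form (@exch4 (fun p q p' q' =>
    (T p o * T p q) * (T p p' * T q q') * (T p' o * T p' q'))); last first.
    by nng.
  apply: eq_tsum => p; rewrite exchange_tsum; last first.
    by nng.
  apply: eq_tsum => p'.
  rewrite conv3E muleA -tsumZl; first last.
  - by nng.
  - by nng.
  apply: eq_tsum => q; rewrite -tsumZl; first last.
  - by nng.
  - by nng.
  apply: eq_tsum => q'; rewrite (TC q' p').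
  by rewrite (AC ((2*2)*2) (((1*5)*3)*(2*4*6))).
have YY : kernel_form TT Y Y = kernel_form TT X X.
  rewrite /kernel_form.
  have sw : bijective (fun s : V * V => (s.2, s.1)).
    by exists (fun s => (s.2, s.1)) => -[].
  rewrite -(reindex_tsum _ sw); apply: eq_tsum => -[p q].
  rewrite -(reindex_tsum _ sw); apply: eq_tsum => -[p' q'].
  rewrite /X /Y /TT /= (TC q p) (TC q' p') (muleC (T p q)) (muleC (T p' q')).
  by rewrite (muleC (T q q')).
rewrite -XY -XX; apply: double_le.
- by apply: tsum_ge0 => s; apply: tsum_ge0 => t; rewrite !mule_ge0.
- by apply: tsum_ge0 => s; apply: tsum_ge0 => t; rewrite !mule_ge0.
by apply: le_trans (TT_psd X0 Y0) _; rewrite YY.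
Qed.

Variable o : V.

(** The mass-transport principle, for expressions invariant like [T]. *)
Hypothesis mass_transport : forall F : V -> V -> \bar R,
  (forall x y, 0 <= F x y) ->
  (forall f : V -> V, bijective f -> (forall x y, T (f x) (f y) = T x y) ->
     forall x y, F (f x) (f y) = F x y) ->
  \S_ x F o x = \S_ x F x o.

Lemma conv2_inv f : bijective f -> (forall x y, T (f x) (f y) = T x y) ->
  forall x y, conv2 (f x) (f y) = conv2 x y.
Proof.
move=> bf Tf x y; rewrite /conv2 -(reindex_tsum _ bf); apply: eq_tsum => z.
by rewrite !Tf.
Qed.

Lemma conv3_inv f : bijective f -> (forall x y, T (f x) (f y) = T x y) ->
  forall x y, conv3 (f x) (f y) = conv3 x y.
Proof.
move=> bf Tf x y; rewrite /conv3 -(reindex_tsum _ bf); apply: eq_tsum => z.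
by rewrite !Tf conv2_inv.
Qed.

Lemma tsum_conv123_le N : 0 <= N -> (forall x y, conv3 x y <= N) ->
  \S_ z (T o z * conv2 o z * conv3 o z) <= N * N.
Proof.
move=> N0 HN; apply: le_trans (_ : \S_ z (T o z * conv2 o z * N) <= _).
  by apply: le_tsum => z; apply: lee_wpmul2l => //; rewrite mule_ge0 // conv2_ge0.
rewrite tsumZr //; last by move=> z; rewrite mule_ge0 // conv2_ge0.
apply: lee_wpmul2r => //; apply: le_trans (HN o o).
by apply: le_tsum => z; rewrite conv2C.
Qed.

(** One mass transport takes the root from an end of the diagram to the middle of
    a path, where [theta_mirror] applies, and another one takes it back. *)
Lemma theta_le N : 0 <= N -> (forall x y, conv3 x y <= N) ->
  \S_ z (conv2 o z * conv2 o z * conv2 o z) <= N * N.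
Proof.
move=> N0 HN.
have c2 := conv2_ge0; have c3 := conv3_ge0.
pose F a v := \S_ z (T a v * T z v * (conv2 a z * conv2 a z)).
pose F2 v a := \S_ z (T a v * T z v * (T a z * conv3 a z)).
have F0 x y : 0 <= F x y by apply: tsum_ge0 => z; rewrite !mule_ge0.
have F20 x y : 0 <= F2 x y by apply: tsum_ge0 => z; rewrite !mule_ge0.
apply: le_trans (_ : \S_ v F o v <= _).
  rewrite exchange_tsum; last by nng.
  apply: le_tsum => z; rewrite tsumZr; [|by nng|by nng].
  have -> : \S_ v (T o v * T z v) = conv2 o z by apply: eq_tsum => v; rewrite (TC z).
  by rewrite !muleA.
rewrite (mass_transport F0); last first.
  move=> f bf Tf x y; rewrite /F -(reindex_tsum _ bf); apply: eq_tsum => z.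
  by rewrite !Tf !conv2_inv.
apply: le_trans (theta_mirror o) _.
apply: (@le_trans _ _ (\S_ a F2 o a)); first by [].
rewrite (mass_transport F20); last first.
  move=> f bf Tf x y; rewrite /F2 -(reindex_tsum _ bf); apply: eq_tsum => z.
  by rewrite !Tf !conv3_inv.
apply: le_trans (tsum_conv123_le N0 HN).
rewrite /F2 exchange_tsum; last by nng.
apply: le_tsum => z.
rewrite (eq_tsum (g := fun v => T o v * T v z * (T o z * conv3 o z))); last first.
  by move=> v; rewrite (TC z v).
rewrite tsumZr; [|by nng|by nng].
by rewrite muleA (muleC (conv2 o z)).
Qed.

(** Summing over the leaf [x] gives a factor [chi].  The extra lines from the root
    to [u] and [v] close the rest of the tree to two branch points joined by
    three paths, all of length two for the first pairing, and of lengths one,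
    two and three for the others. *)
Lemma tree_diagrams_le chi N : 0 <= N -> 0 <= chi ->
  (forall y, \S_ x T y x = chi) -> (forall x y, conv3 x y <= N) ->
  \S_ x \S_ u \S_ v (T o u * T o v *
    \S_ y \S_ z (T o y * T y x * T y z * T z u * T v z +
                 T o y * T y u * T y z * T z x * T v z +
                 T x y * T y u * T y z * T z o * T v z)) <=
  chi * (N * N + N * N + N * N).
Proof.
move=> N0 chi0 Hchi HN; have c2 := conv2_ge0; have c3 := conv3_ge0.
(* For fixed branch points the three leaves are summed independently. *)
have leaves (c : V -> V -> \bar R) (A B D : V -> V -> V -> \bar R) :
   (forall y z, 0 <= c y z) -> (forall y z x, 0 <= A y z x) ->
   (forall y z x, 0 <= B y z x) -> (forall y z x, 0 <= D y z x) ->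
   \S_ x \S_ u \S_ v \S_ y \S_ z (c y z * A y z x * (B y z u * D y z v)) =
   \S_ y \S_ z (c y z * (\S_ x A y z x) * ((\S_ u B y z u) * (\S_ v D y z v))).
  move=> c0 A0 B0 D0.
  have f0 x u v y z : 0 <= c y z * A y z x * (B y z u * D y z v) by nng.
  have i0 y z x u : 0 <= \S_ v (c y z * A y z x * (B y z u * D y z v)).
    by apply: tsum_ge0.
  transitivity (\S_ x \S_ u \S_ p \S_ v (c p.1 p.2 * A p.1 p.2 x *
       (B p.1 p.2 u * D p.1 p.2 v))).
    apply: eq_tsum => x; apply: eq_tsum => u.
    transitivity (\S_ v \S_ p (c p.1 p.2 * A p.1 p.2 x *
       (B p.1 p.2 u * D p.1 p.2 v))); last by rewrite exchange_tsum.
    apply: eq_tsum => v; rewrite (@tsum_pair _ _ _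
       (fun y z => c y z * A y z x * (B y z u * D y z v))) //.
  transitivity (\S_ x \S_ p \S_ u \S_ v (c p.1 p.2 * A p.1 p.2 x *
       (B p.1 p.2 u * D p.1 p.2 v))).
    by apply: eq_tsum => x; rewrite exchange_tsum // => *; exact: i0.
  rewrite exchange_tsum; last by move=> *; apply: tsum_ge0 => ?; exact: i0.
  rewrite [RHS](@tsum_pair _ _ _ (fun y z => c y z * (\S_ x A y z x) *
    ((\S_ u B y z u) * (\S_ v D y z v)))); last first.
    by move=> y z; rewrite !mule_ge0 //; exact: tsum_ge0.
  apply: eq_tsum => -[y z] /=.
  have BD0 : 0 <= (\S_ u B y z u) * (\S_ v D y z v).
    by rewrite mule_ge0 //; exact: tsum_ge0.
  rewrite -tsumZl // -tsumZr //; last by nng.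
  apply: eq_tsum => x.
  transitivity (\S_ u (c y z * A y z x * (B y z u * \S_ v D y z v))).
    apply: eq_tsum => u; rewrite tsumZl; [|by nng|by nng].
    by congr (_ * _); rewrite tsumZl.
  have D1 : 0 <= \S_ v D y z v by exact: tsum_ge0.
  rewrite tsumZl; [|by nng|by nng].
  by congr (_ * _); rewrite tsumZr.
have t0 (f : V -> V -> \bar R) : (forall y z, 0 <= f y z) -> 0 <= \S_ y \S_ z f y z.
  by move=> f0; apply: tsum_ge0 => y; apply: tsum_ge0.
pose f1 x u v y z := T o y * T y z * T y x * (T o u * T u z * (T o v * T v z)).
pose f2 x u v y z := T o y * T y z * T z x * (T o u * T u y * (T o v * T v z)).
pose f3 x u v y z := T o z * T y z * T y x * (T o u * T u y * (T o v * T v z)).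
apply: (@le_trans _ _ (\S_ x \S_ u \S_ v \S_ y \S_ z
    (f1 x u v y z + f2 x u v y z + f3 x u v y z))).
  apply: le_tsum => x; apply: le_tsum => u; apply: le_tsum => v.
  rewrite -tsumZl; [|by nng|by nng].
  apply: le_tsum => y; rewrite -tsumZl; [|by nng|by nng].
  apply: le_tsum => z; rewrite !ge0_muleDr; try by nng.
  rewrite /f1 /f2 /f3 (TC z u) (TC y u) (TC z o) (TC x y).
  by apply: leeD; [apply: leeD|];
   [rewrite (AC (2*5) ((3*5*4)*((1*6)*(2*7))))|
    rewrite (AC (2*5) ((3*5*6)*((1*4)*(2*7))))|
    rewrite (AC (2*5) ((6*5*3)*((1*4)*(2*7))))].
rewrite tsum5D; try by move=> *; rewrite /f1 /f2 /f3; nng.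
rewrite /f1 /f2 /f3.
rewrite ge0_muleDr; [|by nng|by nng]; rewrite ge0_muleDr; [|by nng|by nng].
apply: leeD; first apply: leeD.
- rewrite (leaves (fun y z => T o y * T y z) (fun y z x => T y x)
    (fun y z u => T o u * T u z) (fun y z v => T o v * T v z)); try by nng.
  apply: le_trans (_ : \S_ y \S_ z (T o y * T y z * (chi * (conv2 o z * conv2 o z))) <= _).
    by apply: le_tsum => y; apply: le_tsum => z; rewrite Hchi -!muleA.
  rewrite exchange_tsum; last by nng.
  apply: le_trans (lee_wpmul2l chi0 (theta_le N0 HN)).
  rewrite -tsumZl //; last by nng.
  apply: le_tsum => z; rewrite tsumZr; [|by move=> y; nng|by nng].
  by rewrite (AC (1*(1*(1*1))) (2*(1*3*4))).
- rewrite (leaves (fun y z => T o y * T y z) (fun y z x => T z x)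
    (fun y z u => T o u * T u y) (fun y z v => T o v * T v z)); try by nng.
  apply: le_trans (_ : \S_ y \S_ z (chi * (T o y * conv2 o y) * (T y z * conv2 z o)) <= _).
    apply: le_tsum => y; apply: le_tsum => z.
    rewrite Hchi -!/(conv2 o _) (conv2C o z).
    by rewrite (AC (2*1*2) (3*(1*4)*(2*5))).
  apply: le_trans (lee_wpmul2l chi0 (tsum_conv123_le N0 HN)).
  rewrite -tsumZl //; last by nng.
  apply: le_tsum => y; rewrite tsumZl; [|by nng|by nng].
  by rewrite -/(conv3 y o) conv3C !muleA.
- rewrite (leaves (fun y z => T o z * T y z) (fun y z x => T y x)
    (fun y z u => T o u * T u y) (fun y z v => T o v * T v z)); try by nng.
  apply: le_trans (_ : \S_ y \S_ z (conv2 o y * T y z * (chi * (T o z * conv2 o z))) <= _).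
    apply: le_tsum => y; apply: le_tsum => z.
    rewrite Hchi -!/(conv2 o _).
    by rewrite (AC (2*1*2) (4*2*(3*(1*5)))).
  rewrite exchange_tsum; last by nng.
  apply: le_trans (lee_wpmul2l chi0 (tsum_conv123_le N0 HN)).
  rewrite -tsumZl //; last by nng.
  apply: le_tsum => z; rewrite tsumZr; [|by nng|by nng].
  by rewrite -conv3E' muleC -!muleA.
Qed.

End Diagrams.

(** * Monotonicity and sprinkling *)

Section Sprinkling.
Context {R : realType} (G : weighted_graph R) (P : R -> probability (config G) R).
Hypothesis hP : forall b : R, (0 <= b)%R -> percolation_law b (P b).
Local Notation V := (vertex G).
Local Notation E := (edge G).
Local Notation config := (config G).
Implicit Types (A : set config) (w : config) (F : seq E) (b c : R).

Definition increasing A :=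
  forall w w', (forall e, (w : E -> bool) e -> (w' : E -> bool) e) -> A w -> A w'.

Definition insert (w : config) (e : E) : config :=
  fun f => (w : E -> bool) f || (f == e).

(** For increasing [A] this is the event that [e] is closed and pivotal; its
    probability times [weight e] is the contribution of [e] to the derivative
    of [P b A] in [b]. *)
Definition pivotal A e : set config := [set w | ~ A w /\ A (insert w e)].

Lemma insert_measurable A e : measurable A ->
  measurable [set w | A (insert w e)].
Proof.
move=> mA; rewrite -[X in measurable X]setTI.
apply: (@measurability _ _ config config [set: config] (fun w => insert w e)
  (@open_events R G)) => //.
move=> _ [_ [f ->]] <-; rewrite setTI.
rewrite (_ : _ @^-1` _ = if f == e then setT else [set w : config | (w : E -> bool) f]).
  case: ifP => // _; exact: measurable_coordinate.
apply/seteqP; split => w; rewrite /insert /=; case: eqP => //= _; rewrite ?orbT ?orbF //.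
Qed.

Lemma pivotal_measurable A e : measurable A -> measurable (pivotal A e).
Proof.
move=> mA; rewrite (_ : pivotal A e = ~` A `&` [set w | A (insert w e)]) //.
by apply: measurableI; [exact: measurableC|exact: insert_measurable].
Qed.

Lemma prob_mono A b c : measurable A -> increasing A -> (0 <= b)%R -> (b <= c)%R ->
  P b A <= P c A.
Proof.
move=> mA iA b0 bc.
have cb0 : (0 <= c - b)%R by rewrite subr_ge0.
have lc : percolation_law (b + (c - b)) (P c).
  by rewrite subrKC; apply: hP; exact: le_trans bc.
have [mU <-] := law_union (hP b0) (hP cb0) lc mA.
apply: (@le_trans _ _ ((P b \x P (c - b)%R) (A `*` setT))).
  by rewrite product_probabilityE // probability_setT mule1.
apply: le_measure_sub => //; first exact: measurableX.
move=> [w1 w2] /= [Aw _]; apply: iA Aw => e we; rewrite /union /=.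
by apply/orP; left.
Qed.

Definition only e F : set config := cyl F (fun f => f == e).

Lemma prob_only_ge b F e : (0 <= b)%R -> uniq F -> e \in F ->
  (b * weight e * expR (- (b * \sum_(f <- F) weight f)))%:E <= P b (only e F).
Proof.
move=> b0 uF eF; rewrite /only /cyl (hP b0) // lee_fin.
rewrite [leRHS](bigD1_seq e) //= eqxx.
have -> : (\sum_(f <- F) weight f = weight e + \sum_(f <- F | f != e) weight f)%R.
  by rewrite (bigD1_seq e).
rewrite (eq_bigr (fun f => expR (- (b * weight f)))); last first.
  by move=> f /negbTE ->.
have -> : (\prod_(f <- F | f != e) expR (- (b * weight f)) =
    expR (- (b * \sum_(f <- F | f != e) weight f)))%R.
  rewrite mulr_sumr -sumrN; elim/big_ind2 : _ => //; first by rewrite expR0.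
  by move=> x1 x2 y1 y2 -> ->; rewrite expRD.
rewrite mulrDr opprD expRD mulrA ler_wpM2r ?expR_ge0 //.
set x := (b * weight e)%R.
have : (expR (- x) * expR x = 1)%R by rewrite -expRD addNr expR0.
have := expR_ge1Dx x; have := expR_gt0 (- x); nra.
Qed.

(** A lower bound in the spirit of Russo's formula, valid for every increment:
    it is enough that the sprinkled configuration restricted to [F] consists of
    a single edge, which is pivotal. *)
Lemma sprinkle A b c F : measurable A -> increasing A -> (0 <= b)%R -> (0 <= c)%R ->
  uniq F ->
  P b A + \sum_(e <- F) ((c * weight e * expR (- (c * \sum_(f <- F) weight f)))%:E
    * P b (pivotal A e)) <= P (b + c)%R A.
Proof.
move=> mA iA b0 c0 uF.
have [mU <-] := law_union (hP b0) (hP c0) (hP (addr_ge0 b0 c0)) mA.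
pose B e := pivotal A e `*` only e F.
have mB e : measurable (B e).
  by apply: measurableX; [exact: pivotal_measurable|exact: cyl_measurable].
apply: (@le_trans _ _ ((P b \x P c) (A `*` setT) +
    \sum_(e <- F) (P b \x P c) (B e))).
  apply: leeD; first by rewrite product_probabilityE // probability_setT mule1.
  rewrite big_seq [leRHS]big_seq; apply: lee_sum => e eF.
  rewrite /B product_probabilityE; [|exact: pivotal_measurable|exact: cyl_measurable].
  by rewrite muleC; apply: lee_wpmul2l => //; exact: prob_only_ge.
have dB e f (w : config * config) : B e w -> B f w -> e \in F -> f \in F -> e = f.
  case: w => w1 w2 [_ oe] [_ of_] eF fF; apply/eqP.
  by have := oe e eF; have := of_ e eF; rewrite /= eqxx => ->.
pose C := \bigcup_(e in [set` F]) B e.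
have mC : measurable C by exact: countable_bigcup_measurable.
have CE : \sum_(e <- F) (P b \x P c) (B e) <= (P b \x P c) C.
  have -> : (P b \x P c) C = \S_ e (P b \x P c) (C `&` (if e \in F then B e else set0)).
    apply: measure_tsum_partition => //.
    - by move=> e; case: ifP.
    - by move=> w [e /= eF Be]; exists e; rewrite eF.
    - by move=> e f w; case: ifP => // eF Be; case: ifP => // fF Bf; exact: dB Be Bf eF fF.
  apply: le_trans (tsum_ge_fsum uF _) => //.
  rewrite big_seq [leRHS]big_seq; apply: lee_sum => e eF; rewrite eF.
  apply: le_measure_sub => //; first exact: measurableI.
  by move=> w Bw; split => //; exists e.
apply: le_trans (leeD (lexx _) CE) _.
rewrite -measureU //; first last.
- by apply/seteqP; split => // -[w1 w2] [[Aw _] [e _ [[nA _] _]]].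
- exact: measurableX.
apply: le_measure_sub => //; first by apply: measurableU => //; exact: measurableX.
move=> [w1 w2] [[Aw _]|[e /= eF [[_ Ae] oe]]].
  by apply: iA Aw => f wf; apply/orP; left.
apply: iA Ae => f /orP[wf|/eqP ->]; apply/orP; [by left|right].
by have := oe e eF; rewrite /= eqxx.
Qed.

End Sprinkling.

(** * Sharpness of the phase transition *)

Section Dini.
Context {R : realType}.
Local Open Scope ring_scope.

(** Negativity propagates to the right when [g] cannot jump up from the left
    and, wherever it is negative, has nonpositive lower right Dini derivative. *)
Lemma dini_negative (g : R -> R) (a c : R) : a <= c ->
  (forall x eta, a < x -> x <= c -> 0 < eta -> exists2 d, 0 < d &
     forall y, a <= y -> x - d < y -> y < x -> g x <= g y + eta) ->
  (forall x eta, a <= x -> x < c -> g x < 0 -> 0 < eta ->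
     exists y, [/\ x < y, y <= c & g y <= g x + eta * (y - x)]) ->
  g a < 0 -> g c < 0.
Proof.
move=> ac left_ right_ ga.
pose eta := - g a / (2 * (c - a) + 1).
have den : 0 < 2 * (c - a) + 1 by move: ac; lra.
have eta0 : 0 < eta by rewrite divr_gt0 // oppr_gt0.
have etac x : a <= x -> x <= c -> g a + eta * (x - a) < 0.
  move=> ax xc; have : eta * (2 * (c - a) + 1) = - g a by rewrite divfK // gt_eqF.
  by move: ax xc eta0; nra.
pose Z := [set x | [/\ a <= x, x <= c & g x <= g a + eta * (x - a)]].
have Za : Z a by split => //; rewrite subrr mulr0 addr0.
have supZ : has_sup Z by split; [exists a|exists c => x []].
pose s := sup Z.
have sa : a <= s by apply: ub_le_sup => //; exact: supZ.2.
have sc : s <= c by apply: ge_sup; [exists a|move=> x []].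
have Zs : Z s.
  split => //; have [->|as_] := eqVneq s a; first by rewrite subrr mulr0 addr0.
  have {}as_ : a < s by rewrite lt_neqAle eq_sym as_.
  apply/ler_addgt0Pr => e e0; have [d d0 H] := left_ s e as_ sc e0.
  have [x Zx xs] := sup_adherent d0 supZ.
  have [ax xc gx] := Zx.
  have xs' : x <= s by apply: ub_le_sup => //; exact: supZ.2.
  have [xs_|xs_] := eqVneq x s; first by rewrite -xs_; move: gx e0; lra.
  have {}xs_ : x < s by rewrite lt_neqAle xs_.
  have := H x ax xs xs_; move: gx eta0 xs_; nra.
have [_ _ gs] := Zs.
have [sE|sc_] := eqVneq s c; first by rewrite -sE; apply: le_lt_trans gs _; exact: etac.
have {}sc_ : s < c by rewrite lt_neqAle sc_.
have [y [sy yc gy]] := right_ s eta sa sc_ (le_lt_trans gs (etac _ sa sc)) eta0.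
have : y <= s.
  apply: ub_le_sup; first exact: supZ.2.
  by split => //; [exact: le_trans sa (ltW sy)|move: gs gy; nra].
by rewrite leNgt sy.
Qed.

Lemma dini_increment (f : R -> R) (a c k : R) : a <= c -> 0 <= k ->
  (forall x y, a <= x -> x <= y -> y <= c -> f x <= f y) ->
  (forall x eta, a <= x -> x < c -> 0 < eta ->
     exists y, [/\ x < y, y <= c & f x + (k - eta) * (y - x) <= f y]) ->
  k * (c - a) <= f c - f a.
Proof.
move=> ac k0 f_nd Hf; apply/ler_addgt0Pr => tau tau0.
pose g x := k * (x - a) - (f x - f a) - tau.
suff : g c < 0 by rewrite /g; lra.
apply: (@dini_negative g a c) => //; last by rewrite /g !subrr mulr0; lra.
  move=> x eta ax xc eta0; exists (eta / (k + 1)); first by rewrite divr_gt0 //; lra.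
  move=> y ay xy yx; rewrite /g; have := f_nd y x ay (ltW yx) xc.
  have : x - y < eta / (k + 1) by lra.
  rewrite ltr_pdivlMr; last lra.
  by move: k0 yx; nra.
move=> x eta ax xc _ eta0; have [y [xy yc fy]] := Hf x eta ax xc eta0.
by exists y; split => //; rewrite /g; move: fy; nra.
Qed.

(** The exponential loss in [sprinkle] is of second order in the increment. *)
Lemma small_increment (Y W k m : R) : 0 <= Y -> 0 <= W -> k < Y -> 0 < m ->
  exists t, [/\ 0 < t, t <= m & k * t <= t * expR (- (t * W)) * Y].
Proof.
move=> Y0 W0 kY m0.
pose t := Num.min m ((Y - k) / (W * Y + 1)).
have WY : 0 < W * Y + 1 by rewrite ltr_wpDl // mulr_ge0.
have t0 : 0 < t by rewrite lt_min m0 /= divr_gt0 // subr_gt0.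
have tW : t * (W * Y + 1) <= Y - k.
  by rewrite -ler_pdivlMr // ge_min lexx orbT.
exists t; split => //; first by rewrite ge_min lexx.
rewrite -mulrA mulrC ler_pM2l //.
apply: le_trans (_ : (1 - t * W) * Y <= _); last first.
  by apply: ler_wpM2r => //; exact: expR_ge1Dx.
move: tW t0; nra.
Qed.

End Dini.

Section Sharpness.
Context {R : realType} (G : weighted_graph R) (P : R -> probability (config G) R).
Hypothesis hP : forall b : R, (0 <= b)%R -> percolation_law b (P b).
Hypothesis htrans : transitive_graph G.
Variable o : vertex G.
Local Notation V := (vertex G).
Local Notation E := (edge G).
Local Notation config := (config G).
Local Notation T b := (conn (P b) setT).
Implicit Types (b c : R) (S : set V) (x y z v a : V) (e : E) (L : {fset V}).

Definition chi b x : \bar R := \S_ y T b x y.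

Lemma chi_ge0 b x : 0 <= chi b x.
Proof. by apply: tsum_ge0 => y; exact: conn_ge0. Qed.

Lemma chi_trans b x y : (0 <= b)%R -> chi b x = chi b y.
Proof.
move=> b0; have [f fa fy] := htrans y x.
have [bf _] := fa; rewrite /chi -(reindex_tsum _ bf) -fy.
by apply: eq_tsum => z; rewrite (conn_aut (hP b0)).
Qed.

Lemma beta_c_le b : (0 <= b)%R -> 0 < P b (infinite_cluster o) -> beta_c P o <= b%:E.
Proof.
move=> b0 pos; apply: ereal_inf_lbound; exists b => //; split => //.
rewrite (_ : [set w | _] = infinite_cluster o) //.
by apply/seteqP; split => w; rewrite /infinite_cluster /Defs.cluster /=;
  congr (infinite_set _) => //; apply/seteqP; split => x /=; move/linked_inE.
Qed.

Lemma linked_increasing x y : increasing (linked_event (G := G) setT x y).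
Proof. by move=> w w' ww' ; apply: linked_in_sub. Qed.

Lemma conn_mono b c x y : (0 <= b)%R -> (b <= c)%R -> T b x y <= T c x y.
Proof.
move=> b0 bc; apply: (prob_mono hP) => //; first exact: linked_event_measurable.
exact: linked_increasing.
Qed.

Lemma chi_mono b c x : (0 <= b)%R -> (b <= c)%R -> chi b x <= chi c x.
Proof. by move=> b0 bc; apply: le_tsum => y; exact: conn_mono. Qed.

(** The quantity of Duminil-Copin and Tassion, with the probability that an edge
    is open replaced by its upper bound [b * weight e]. *)
Definition exit_mean b S : \bar R :=
  \S_ v \S_ a (if a \in ~` S then conn (P b) S o v * (b%:E * coupling v a) else 0).

Let term0 b S v a : (0 <= b)%R ->
  0 <= (if a \in ~` S then conn (P b) S o v * (b%:E * coupling v a) else 0).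
Proof.
by move=> b0; case: ifP => // _; rewrite !mule_ge0 ?conn_ge0 ?coupling_ge0 ?lee_fin.
Qed.

Lemma exit_mean_step b S x : (0 <= b)%R -> S o -> ~ S x -> T b o x <=
  \S_ v \S_ a ((if a \in ~` S then conn (P b) S o v * (b%:E * coupling v a) else 0)
     * T b a x).
Proof.
move=> b0 So Sx; have nSo : ~ (~` S) o by [].
apply: le_trans (conn_boundary b0 (hP b0) nSo Sx) _.
apply: le_tsum => v; apply: le_tsum => a; rewrite setCK; case: ifP => _ //.
by rewrite mul0e.
Qed.

(** Iterating the first exit from translates of [S] bounds the susceptibility by
    a geometric series.  To sum that series, the recursion is applied to the
    supremum over sets of at most [n] vertices, which is finite beforehand. *)
Lemma exit_mean_lt1 b S : (0 <= b)%R -> finite_set S -> S o -> exit_mean b S < 1 ->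
  chi b o < +oo.
Proof.
move=> b0 fS So phi1.
have phi0 : 0 <= exit_mean b S.
  by apply: tsum_ge0 => v; apply: tsum_ge0 => a; exact: term0.
pose m : R := (#|` fset_set S|)%:R.
have [phi phiE] : exists phi : R, exit_mean b S = phi%:E.
  exists (fine (exit_mean b S)); rewrite fineK // ge0_fin_numE //.
  exact: lt_le_trans phi1 (leey _).
have phi_ge0 : (0 <= phi)%R by rewrite -lee_fin -phiE.
have phi_lt1 : (phi < 1)%R by rewrite -lte_fin -phiE.
suff bound n (v : V) (s : seq V) : uniq s -> (size s <= n)%N ->
    \sum_(x <- s) T b v x <= (m / (1 - phi))%:E.
  apply: le_lt_trans (tsum_le (c := (m / (1 - phi))%:E) _) (ltry _) => s us.
  exact: bound (leqnn _).
pose Z := [set r : \bar R | exists (v : V) (s : seq V),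
  [/\ uniq s, (size s <= n)%N & r = \sum_(x <- s) T b v x]].
have ubn : forall r, Z r -> r <= n%:R%:E.
  move=> _ [x [s' [_ sn ->]]]; apply: (@le_trans _ _ (\sum_(x <- s') 1%:E)).
    by apply: lee_sum => y _; exact: conn_le1.
  by rewrite sumEFin big_const_seq count_predT iter_addr_0 lee_fin ler_nat.
pose M := ereal_sup Z.
have M0 : 0 <= M by apply: ereal_sup_ubound; exists o, [::]; rewrite big_nil.
have Mn : M <= n%:R%:E by exact: ge_ereal_sup.
have [r Mr] : exists r : R, M = r%:E.
  by exists (fine M); rewrite fineK // ge0_fin_numE //; exact: le_lt_trans Mn (ltry _).
have step : M <= m%:E + phi%:E * M.
  apply: ge_ereal_sup => _ [x [s' [us' sn ->]]].
  have [f fa fo] := htrans o x; have [[f' ff' f'f] _] := fa.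
  have -> : \sum_(y <- s') T b x y = \sum_(y <- map f' s') T b o y.
    rewrite big_map; apply: eq_bigr => y _.
    by rewrite -fo -{1}(f'f y) (conn_aut (hP b0)).
  have us2 : uniq (map f' s') by rewrite map_inj_uniq //; exact: can_inj f'f.
  rewrite (bigID (fun y => y \in S)) /=; apply: leeD.
    apply: (@le_trans _ _ (\sum_(y <- map f' s' | y \in S) 1%:E)).
      by apply: lee_sum => y _; exact: conn_le1.
    rewrite sumEFin big_const_seq iter_addr_0 lee_fin ler_nat -size_filter.
    apply: uniq_leq_size; first exact: filter_uniq.
    by move=> y; rewrite mem_filter => /andP[yS _]; rewrite in_fset_set.
  apply: (@le_trans _ _ (\sum_(y <- map f' s') \S_ v \S_ a
    ((if a \in ~` S then conn (P b) S o v * (b%:E * coupling v a) else 0) * T b a y))).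
    rewrite [leRHS](bigID (fun y => y \in S)) /= -[leLHS]add0e; apply: leeD.
      apply: sume_ge0 => y _; apply: tsum_ge0 => v'; apply: tsum_ge0 => a.
      by rewrite mule_ge0 ?conn_ge0 // term0.
    apply: lee_sum => y yS; apply: exit_mean_step => //.
    by move=> Sy; move: yS; rewrite mem_set.
  rewrite -phiE /exit_mean -tsumZr //; last first.
    by move=> v'; apply: tsum_ge0 => a; exact: term0.
  rewrite /tsum -esum_sum; last first.
    move=> v' y _ _; apply: (@tsum_ge0 R) => a; rewrite mule_ge0 ?conn_ge0 //.
    exact: term0.
  apply: le_esum => v' _; rewrite -/(tsum _) -[leRHS]tsumZr //; last first.
    by move=> a; exact: term0.
  rewrite -[leLHS]esum_sum; last first.
    by move=> a y _ _; rewrite mule_ge0 ?conn_ge0 // term0.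
  apply: le_esum => a _; rewrite -ge0_sume_distrr; last by move=> y _; exact: conn_ge0.
  apply: lee_wpmul2l; first exact: term0.
  by apply: ereal_sup_ubound; exists a, (map f' s'); rewrite size_map.
move=> us sn; apply: (@le_trans _ _ M); first by apply: ereal_sup_ubound; exists v, s.
rewrite Mr lee_fin ler_pdivlMr ?subr_gt0 //.
move: step; rewrite Mr -EFinM -EFinD lee_fin; lra.
Qed.

(** ** The escape event of a finite box *)

Definition escape L : set config := [set w | exists2 y, y \notin L & linked_in setT w o y].

Lemma escape_measurable L : measurable (escape L).
Proof.
rewrite (_ : escape L = \bigcup_(y in [set y | y \notin L]) linked_event setT o y).
  by apply: countable_bigcup_measurable => y; exact: linked_event_measurable.
by apply/seteqP; split => w [y yL oy]; exists y.
Qed.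

Lemma escape_increasing L : increasing (escape L).
Proof.
by move=> w w' ww' [y yL oy]; exists y => //; apply: linked_in_sub oy.
Qed.

Definition trapped L (w : config) : set V :=
  [set x | forall y, linked_in setT w x y -> y \in L].

Definition trapped_event L S : set config := [set w | trapped L w = S].

Lemma trapped_event_measurable L S : measurable (trapped_event L S).
Proof.
pose A x : set config := \bigcap_(y in [set y | y \notin L]) ~` linked_event setT x y.
have mA x : measurable (A x).
  apply: countable_bigcap_measurable => y; apply: measurableC.
  exact: linked_event_measurable.
have AE x w : trapped L w x <-> A x w.
  split => H y; first by move=> /= /negP yL /H.
  by move=> xy; apply: contrapT => /negP yL; exact: H yL xy.
rewrite (_ : trapped_event L S = \bigcap_(x in setT)
   (if `[< S x >] then A x else ~` A x)).
  by apply: countable_bigcap_measurable => x; case: ifP => _ //; exact: measurableC.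
apply/seteqP; split => w.
  by move=> /= H x _; case: asboolP => Sx; [apply/AE; rewrite H|move/AE; rewrite H].
move=> H; apply/seteqP; split => x.
  by move=> /AE; have := H x I; case: asboolP.
by move=> Sx; apply/AE; have := H x I; rewrite asboolT.
Qed.

Lemma trapped_linked L w x y : linked_in setT w x y -> trapped L w y -> trapped L w x.
Proof.
by move=> xy ty z xz; apply: ty; apply: linked_in_trans xz; exact: linked_in_sym.
Qed.

(** The trapped set is the complement of what an exploration from outside the box
    reaches, and this exploration does not look inside it. *)
Lemma trapped_event_depends L S : depends_on (~` inside S) (trapped_event L S).
Proof.
move=> w w' ww' tS; apply/seteqP; split => x.
  move=> tx; apply: contrapT => Sx.
  have [y xy yL] : exists2 y, linked_in setT w x y & y \notin L.
    apply: contrapT => H; apply: Sx; rewrite -tS => y xy; apply: contrapT => /negP yL.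
    by apply: H; exists y.
  have : linked_in (~` S) w x y.
    move: (linked_in_own_cluster xy); apply: linked_in_sub => // z xz Sz.
    by apply: Sx; rewrite -tS; apply: trapped_linked xz _; rewrite tS.
  move=> [s xs ws]; move/negP: yL; apply; apply: tx; exists s.
    exact: walk_sub xs.
  apply/allP => e es; rewrite -ww'; first exact: (allP ws).
  by move: (walk_inside xs es) => [S1 _] [].
move=> Sx y xy; apply: contrapT => /negP yL.
have Sy : ~ S y.
  move=> Sy; have : trapped L w y by rewrite tS.
  by move/(_ y (linked_in_refl _ I)); rewrite (negbTE yL).
have nSx : ~ (~` S) x by [].
case: xy => s xs ws.
have [s1 [e [s2 [a [c [sE xa ac Sc _]]]]]] := walk_enter xs nSx Sy.
have Sa : S a by have [_ /contrapT] := walk_end xa.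
apply: (Sc); rewrite -tS; apply: (@trapped_linked _ _ _ a); last by rewrite tS.
apply: linked_in_sym; apply: (linked_in_edge _ _ _ ac) => //.
rewrite ww'; first by apply: (allP ws); rewrite sE mem_cat inE eqxx orbT.
by move/(joins_inside _ ac) => [_ /Sc].
Qed.

(** Pivotal edges for escaping are the boundary edges of the trapped set whose
    inner end is joined to [o].  Given the trapped set, [b] times their mean
    total weight is its [exit_mean], hence at least one. *)
Lemma escape_pivotal L b : (0 < b)%R ->
  (forall S, finite_set S -> S o -> 1 <= exit_mean b S) ->
  P b (~` escape L) <= b%:E * \S_ e ((weight e)%:E * P b (pivotal (escape L) e)).
Proof.
move=> b0 H; have b0' := ltW b0.
have mnE : measurable (~` escape L) by apply: measurableC; exact: escape_measurable.
have trap_in w x : trapped L w x -> x \in L by move/(_ x (linked_in_refl _ I)).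
have Ev w : exists S : {fset V}, trapped_event L [set` S] w.
  have ft : finite_set (trapped L w).
    by apply: (@sub_finite_set _ _ [set` L]) => [x /trap_in //|]; exact: finite_fset.
  by exists (fset_set (trapped L w)); rewrite /trapped_event /= fset_setK.
have partition (A : set config) : measurable A ->
   P b A = tsum (fun S : {fset V} => P b (A `&` trapped_event L [set` S])).
  move=> mA; apply: measure_tsum_partition => //.
    by move=> S; exact: trapped_event_measurable.
  move=> S S' w; rewrite /trapped_event /= => -> /seteqP[H1 H2].
  by apply/fsetP => x; apply/idP/idP; [exact: H1|exact: H2].
have w0 e : 0 <= (weight e)%:E :> \bar R by rewrite lee_fin weight_ge0.
have mP e := pivotal_measurable e (escape_measurable L).
apply: (@le_trans _ _ (b%:E * \S_ e tsum (fun S : {fset V} => (weight e)%:E *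
    P b (pivotal (escape L) e `&` trapped_event L [set` S])))); last first.
  apply: lee_wpmul2l; first by rewrite lee_fin.
  by apply: le_tsum => e; rewrite tsumZl // -partition.
rewrite exchange_tsum; last by move=> e S; rewrite mule_ge0.
have b0e : 0 <= b%:E by rewrite lee_fin.
rewrite -tsumZl; [|by move=> S; apply: tsum_ge0 => e; rewrite mule_ge0|by []].
rewrite (partition _ mnE); apply: le_tsum => S.
have [oS|oS] := boolP (o \in S); last first.
  rewrite (_ : _ `&` _ = set0); last first.
    apply/seteqP; split => // w [nE]; rewrite /trapped_event /= => tE.
    have /negP := oS; apply; have : [set` S] o; last by [].
    rewrite -tE => y oy; apply: contrapT => /negP yL; apply: nE; by exists y.
  by rewrite measure0 mule_ge0 // tsum_ge0 // => e; rewrite mule_ge0.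
apply: (@le_trans _ _ (P b (trapped_event L [set` S]))).
  apply: le_measure_sub; [apply: measurableI => //; exact: trapped_event_measurable|
    exact: trapped_event_measurable|by move=> w []].
have mT := trapped_event_measurable L [set` S].
have So : [set` S] o by [].
have fS : finite_set [set` S] by exact: finite_fset.
apply: (@le_trans _ _ (P b (trapped_event L [set` S]) * exit_mean b [set` S])).
  by rewrite -[leLHS]mule1; apply: lee_wpmul2l => //; exact: H.
have c0 := conn_ge0 (P b).
rewrite /exit_mean -[leLHS]tsumZl; [|by move=> v; apply: tsum_ge0 => a; exact: term0|by []].
apply: (@le_trans _ _ (\S_ v \S_ a \S_ e (b%:E * (if (a \in ~` [set` S]) && joins e v a
    then (weight e)%:E * P b (trapped_event L [set` S] `&` linked_event [set` S] o v)
    else 0)))).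
  apply: le_tsum => v; rewrite -tsumZl //; last by move=> a; exact: term0.
  apply: le_tsum => a; case: ifP => aS /=; last first.
    by rewrite mule0; apply: tsum_ge0 => e; rewrite mule0.
  rewrite tsumZl //; last by move=> e; case: ifP => // _; rewrite mule_ge0.
  rewrite (law_indep (I := ~` inside [set` S]) (hP b0') mT
    (linked_event_measurable _ _ _)); first last.
  - by rewrite setCK; exact: linked_in_depends.
  - exact: trapped_event_depends.
  rewrite -/(conn (P b) [set` S] o v) muleA muleCA; apply: lee_wpmul2l => //.
  rewrite /coupling -tsumZl //; [|by move=> e; case: ifP|by nng].
  by apply: le_tsum => e; case: ifP => _; rewrite ?mule0 // muleC.
have pos v a e : 0 <= (if (a \in ~` [set` S]) && joins e v a
    then (weight e)%:E * P b (trapped_event L [set` S] `&` linked_event [set` S] o v)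
    else 0) by case: ifP => // _; rewrite mule_ge0.
rewrite (@tsum_pair _ _ _ (fun v a => \S_ e (b%:E * _))); last first.
  by nng.
rewrite exchange_tsum; last by nng.
rewrite -tsumZl //; last by move=> e; rewrite mule_ge0.
apply: le_tsum => e; rewrite tsumZl //; apply: lee_wpmul2l => //.
(* the edge [e] leaves [S] in at most one way *)
have unique v a v' a' : joins e v a -> joins e v' a' -> v \in S -> a \notin S ->
    v' \in S -> a' \notin S -> (v', a') = (v, a).
  move=> H1 H2 vS aS vS' aS'; have [[-> ->]//|[v'a a'v]] := joins_same H1 H2.
  by rewrite v'a (negbTE aS) in vS'.
have zero v a : v \notin S -> P b (trapped_event L [set` S] `&`
    linked_event [set` S] o v) = 0.
  move=> vS; rewrite (_ : _ `&` _ = set0) ?measure0 //.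
  apply/seteqP; split => // w [_ [s /walk_end /= H' _]].
  by rewrite H' in vS.
have [[[v a] [/= va vS aS]]|noexit] := pselect (exists p : V * V,
    [/\ joins e p.1 p.2, p.1 \in S & p.2 \notin S]).
  rewrite (@tsum_single R _ _ (v, a)) //=; last first.
    move=> [v' a'] /= ne; case: ifP => // /andP[/set_mem /= /negP aS' va'].
    have [vS'|vS'] := boolP (v' \in S); last by rewrite zero // mule0.
    by move: ne; rewrite (unique v a v' a') ?eqxx.
  case: ifP => // [_|_]; last by rewrite mule_ge0.
  apply: lee_wpmul2l => //; apply: le_measure_sub.
  - by apply: measurableI => //; exact: linked_event_measurable.
  - exact: measurableI.
  move=> w [tE ov]; split => //; split.
    move=> [y yL oy]; have : trapped L w o by rewrite tE.
    by move/(_ y oy); rewrite (negbTE yL).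
  have [y yL ay] : exists2 y, y \notin L & linked_in setT w a y.
    apply: contrapT => nH; move/negP: aS; apply; have : [set` S] a; last by [].
    rewrite -tE => y ay; apply: contrapT => /negP yL; apply: nH; by exists y.
  have sub f : (w : E -> bool) f -> (insert w e : E -> bool) f.
    by move=> wf; rewrite /insert wf.
  exists y => //; apply: linked_in_trans (_ : linked_in setT _ o v) _.
    exact: linked_in_sub ov.
  apply: linked_in_trans (linked_in_edge (e := e) _ _ _ va) _ => //.
    by rewrite /insert eqxx orbT.
  exact: linked_in_sub ay.
rewrite (eq_tsum (g := fun=> 0)) ?tsum0 ?mule_ge0 // => -[v a] /=.
case: ifP => // /andP[/set_mem /= /negP aS va].
have [vS|vS] := boolP (v \in S); last by rewrite zero // mule0.
by exfalso; apply: noexit; exists (v, a).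
Qed.

Lemma tsum_gt (W : countType) (f : W -> \bar R) (k : \bar R) : k < tsum f ->
  exists2 s : seq W, uniq s & k < \sum_(x <- s) f x.
Proof.
move=> kf; apply: contrapT => H; move: kf; rewrite ltNge => /negP; apply.
apply: tsum_le => s us; rewrite leNgt; apply/negP => ks.
by apply: H; exists s.
Qed.

(** This is the differential inequality [f' >= (1 - f) / b] for the escape
    probability [f], from [escape_pivotal] by sprinkling. *)
Lemma escape_increment L b c eta : (0 < b)%R -> (b < c)%R -> (0 < eta)%R ->
  (forall S, finite_set S -> S o -> 1 <= exit_mean b S) ->
  exists d, [/\ (b < d)%R, (d <= c)%R &
    (fine (P b (escape L)) +
      ((1 - fine (P b (escape L))) / b - eta) * (d - b) <= fine (P d (escape L)))%R].
Proof.
move=> b0 bc eta0 H; have b0' := ltW b0.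
have mE := escape_measurable L; have iE := @escape_increasing L.
have mP e := pivotal_measurable e mE.
pose f d := fine (P d (escape L)).
have fE d : P d (escape L) = (f d)%:E by rewrite /f fineK // fin_num_measure.
rewrite -/(f b); set k := ((1 - f b) / b)%R.
have k_le : (k - eta)%:E < \S_ e ((weight e)%:E * P b (pivotal (escape L) e)).
  have := escape_pivotal L b0 H; rewrite probability_setC // fE -EFinB.
  set X := tsum _; have X0 : 0 <= X by apply: tsum_ge0 => e; rewrite mule_ge0 // lee_fin weight_ge0.
  case: X X0 => [x| |] // x0; last by rewrite ltry.
  rewrite -EFinM lee_fin lte_fin => Hx.
  have : (k <= x)%R by rewrite /k ler_pdivrMr // mulrC.
  lra.
have [F uF kF] := tsum_gt k_le.
pose W := (\sum_(e <- F) weight e)%R.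
have W0 : (0 <= W)%R by apply: sumr_ge0 => e _; exact: weight_ge0.
pose Y := (\sum_(e <- F) (weight e * fine (P b (pivotal (escape L) e))))%R.
have YE : \sum_(e <- F) ((weight e)%:E * P b (pivotal (escape L) e)) = Y%:E.
  rewrite /Y -sumEFin; apply: eq_bigr => e _.
  by rewrite EFinM fineK // fin_num_measure.
have Y0 : (0 <= Y)%R.
  by apply: sumr_ge0 => e _; rewrite mulr_ge0 ?weight_ge0 // fine_ge0.
rewrite YE lte_fin in kF.
have cb0 : (0 < c - b)%R by rewrite subr_gt0.
have [t [t0 tc kt]] := small_increment Y0 W0 kF cb0.
exists (b + t)%R; split; [lra|lra|].
rewrite -/(f (b + t)%R) (_ : b + t - b = t)%R; last by ring.
rewrite -lee_fin -(fE (b + t)%R).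
apply: le_trans (sprinkle hP mE iE b0' (ltW t0) uF).
rewrite fE (eq_bigr (fun e => (t * expR (- (t * W)))%:E *
   ((weight e)%:E * P b (pivotal (escape L) e)))); last first.
  by move=> e _; rewrite muleA -EFinM mulrAC.
rewrite -ge0_sume_distrr; last by move=> e _; rewrite mule_ge0 // lee_fin weight_ge0.
by rewrite YE -EFinM -EFinD lee_fin lerD2l.
Qed.

(** Otherwise all finite sets have [exit_mean] at least one from [b] on.  Then, at
    a parameter [c] between [b] and [beta_c], the escape probabilities of all
    boxes are bounded below by the same positive number, and so is the
    probability of an infinite cluster. *)
Lemma chi_finite b : (0 < b)%R -> b%:E < beta_c P o -> chi b o < +oo.
Proof.
move=> b0 bbc.
have [c bc cbc] : exists2 c : R, (b < c)%R & c%:E < beta_c P o.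
  case: (beta_c P o) bbc => [r| |] //.
    by rewrite lte_fin => br; exists ((b + r) / 2)%R; rewrite ?lte_fin; lra.
  by move=> _; exists (b + 1)%R; rewrite ?ltry //; lra.
apply: contrapT => chi_oo.
have c0 : (0 < c)%R by exact: lt_trans bc.
have exit1 d S : (b <= d)%R -> finite_set S -> S o -> 1 <= exit_mean d S.
  move=> bd fS So; rewrite leNgt; apply/negP => lt1; apply: chi_oo.
  have d0 : (0 <= d)%R by exact: le_trans (ltW b0) bd.
  exact: le_lt_trans (chi_mono _ (ltW b0) bd) (exit_mean_lt1 d0 fS So lt1).
pose f L d := fine (P d (escape L)).
have mE L := escape_measurable L.
have fE L d : P d (escape L) = (f L d)%:E by rewrite /f fineK // fin_num_measure.
have f01 L d : (0 <= f L d <= 1)%R.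
  by rewrite -!lee_fin -fE measure_ge0 probability_le1.
have f_nd L d d' : (b <= d)%R -> (d <= d')%R -> (f L d <= f L d')%R.
  move=> bd dd; rewrite -lee_fin -!fE; apply: (prob_mono hP) => //.
    exact: escape_increasing.
  exact: le_trans (ltW b0) bd.
pose r := ((c - b) / c)%R.
have r0 : (0 < r)%R by rewrite divr_gt0 // subr_gt0.
have f_ge L : (r / (1 + r) <= f L c)%R.
  have k0 : (0 <= (1 - f L c) / c)%R.
    by rewrite divr_ge0 ?(ltW c0) // subr_ge0; have /andP[] := f01 L c.
  have := @dini_increment _ (f L) b c ((1 - f L c) / c)%R (ltW bc) k0.
  have -> : ((1 - f L c) / c * (c - b) = (1 - f L c) * r)%R by rewrite /r; field; rewrite gt_eqF.
  move=> /(_ _ _)/wrap[].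
  - by move=> x y bx xy _; exact: f_nd.
  - move=> x eta bx xc eta0; have x0 : (0 < x)%R by exact: lt_le_trans bx.
    have [y [xy yc Hy]] := @escape_increment L x c eta x0 xc eta0 (fun S => exit1 x S bx).
    exists y; split => //; apply: le_trans Hy; rewrite lerD2l ler_wpM2r //; first lra.
    rewrite lerD2r -/(f L x).
    apply: (@le_trans _ _ ((1 - f L c) / x)%R).
      have /andP[_ f1] := f01 L c.
      by rewrite ler_wpM2l ?subr_ge0 // lef_pV2 ?posrE // ltW.
    by rewrite ler_wpM2r ?invr_ge0 ?(ltW x0) // lerB // f_nd // ltW.
  move=> Hf; rewrite ler_pdivrMr; last lra.
  by have /andP[fb0 _] := f01 L b; nra.
have fin n : finite_set [set x : V | (choice.pickle x < n)%N].
  have : finite_set (choice.pickle @^-1` `I_n : set V).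
    apply: finite_preimage; last exact: finite_II.
    by move=> x y _ _ /(pcan_inj choice.pickleK).
  by [].
pose box n : {fset V} := fset_set [set x : V | (choice.pickle x < n)%N].
have inbox n x : (x \in box n) = (choice.pickle x < n)%N.
  by rewrite /box in_fset_set //; apply/idP/idP => [/set_mem|H] //; exact/mem_set.
have dec : nonincreasing_seq (fun n => escape (box n)).
  move=> m n mn; apply/subsetPset => w [y yn oy]; exists y => //.
  by move: yn; rewrite !inbox -!leqNgt; exact: leq_trans.
have inf_ge : (r / (1 + r))%:E <= P c (\bigcap_n escape (box n)).
  have cv := @nonincreasing_cvg_mu _ _ _ (P c) (fun n => escape (box n)) _
    (fun n => mE _) _ dec.
  have {}cv : (P c \o (fun n => escape (box n))) @ \oo --> P c (\bigcap_n escape (box n)).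
    apply: cv; first by rewrite -ge0_fin_numE // fin_num_measure.
    by apply: bigcap_measurable => // n _; exact: mE.
  rewrite -(cvg_lim _ cv) //; apply: lime_ge; first by apply/cvg_ex; eexists; exact: cv.
  by apply: nearW => n /=; rewrite fE lee_fin.
have : 0 < P c (infinite_cluster o).
  apply: lt_le_trans (_ : (r / (1 + r))%:E <= _); first by rewrite lte_fin divr_gt0 //; lra.
  apply: le_trans inf_ge _; apply: le_measure_sub.
  - by apply: bigcap_measurable => // n _; exact: mE.
  - exact: infinite_cluster_measurable.
  move=> w H fc; pose C := fset_set [set x | linked_in setT w o x].
  pose n := (\max_(x <- C) choice.pickle x).+1.
  have [y] := H n I; rewrite inbox => /negP yn oy; apply: yn.
  rewrite ltnS; apply: (@leq_bigmax_seq V (enum_fset C) xpredT (fun x => choice.pickle x) y) => //.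
  by rewrite in_fset_set //; apply/mem_set.
by move=> Pc; have := beta_c_le (ltW c0) Pc; rewrite leNgt cbc.
Qed.

End Sharpness.

(** * The differential inequality *)

Section DifferentialInequality.
Context {R : realType} (G : weighted_graph R) (P : R -> probability (config G) R).
Hypothesis hP : forall b : R, (0 <= b)%R -> percolation_law b (P b).
Hypothesis htrans : transitive_graph G.
Variable o : vertex G.
Hypothesis hunim : unimodular o.
Hypothesis hnorm : out_weight o = 1.
Local Notation V := (vertex G).
Local Notation E := (edge G).
Local Notation config := (config G).
Local Notation L := (linked_event (G := G) setT).
Implicit Types (x y z u v a : V) (e : E).

Lemma tsum_coupling_le1 v : \S_ y coupling v y <= 1.
Proof.
have [f fa <-] := htrans o v; have [bf _] := fa.
rewrite -(reindex_tsum _ bf) -hnorm; apply: le_trans (tsum_coupling o).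
by apply: le_tsum => y; rewrite coupling_aut.
Qed.

Variable b : R.
Hypothesis b0 : (0 < b)%R.
Hypothesis hbc : b%:E < beta_c P o.
Local Notation T := (conn (P b) setT).
Local Notation X := (chi P b o).
Local Notation N := (conv3 T o o).

Let b0' : (0 <= b)%R := ltW b0.
Let lP : percolation_law b (P b) := hP b0'.
Let T0 x y : 0 <= T x y. Proof. exact: conn_ge0. Qed.
Let TC x y : T x y = T y x. Proof. exact: conn_sym. Qed.
Let mL x y : measurable (L x y). Proof. exact: linked_event_measurable. Qed.
Let c0 x y : 0 <= coupling x y. Proof. exact: coupling_ge0. Qed.

Lemma chi_root x : \S_ y T x y = X.
Proof. exact: (chi_trans hP htrans x o b0'). Qed.

Lemma transport (F : V -> V -> \bar R) : (forall x y, 0 <= F x y) ->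
  (forall f, automorphism f -> forall x y, F (f x) (f y) = F x y) ->
  \S_ x F o x = \S_ x F x o.
Proof. by move=> F0 inv; have := hunim F0 inv. Qed.

Lemma conn_psd (A B : V -> \bar R) : (forall s, 0 <= A s) -> (forall s, 0 <= B s) ->
  kernel_form T A B + kernel_form T A B <= kernel_form T A A + kernel_form T B B.
Proof.
apply: (@random_equivalence_form _ _ _ (P b) _ (fun w x y => linked_in setT w x y)) => //.
- by move=> w x; exact: linked_in_refl.
- by move=> w x y; exact: linked_in_sym.
- by move=> w x y z; exact: linked_in_trans.
Qed.

(** Equivalence in two independent copies is an equivalence on pairs. *)
Lemma conn_TT_psd (A B : V * V -> \bar R) : (forall s, 0 <= A s) -> (forall s, 0 <= B s) ->
  kernel_form (TT T) A B + kernel_form (TT T) A B <=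
  kernel_form (TT T) A A + kernel_form (TT T) B B.
Proof.
have setE (s t : V * V) : [set w : config * config |
    linked_in setT w.1 s.1 t.1 /\ linked_in setT w.2 s.2 t.2] =
    L s.1 t.1 `*` L s.2 t.2 by [].
apply: (@random_equivalence_form _ _ _ (P b \x P b)%E _ (fun w s t =>
  linked_in setT w.1 s.1 t.1 /\ linked_in setT w.2 s.2 t.2)).
- move=> s t; rewrite setE; apply/esym.
  exact: (product_probabilityE (P b) (P b) (mL _ _) (mL _ _)).
- by move=> s t; rewrite setE; exact: measurableX.
- by move=> w s; split; exact: linked_in_refl.
- by move=> w s t [? ?]; split; exact: linked_in_sym.
- by move=> w s t u [H1 H2] [H3 H4]; split;
    [exact: linked_in_trans H1 H3|exact: linked_in_trans H2 H4].
Qed.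

Lemma conv3_root z : conv3 T z z = N.
Proof.
have [f fa <-] := htrans o z; have [bf _] := fa.
by apply: (conv3_inv bf) => x y; rewrite (conn_aut lP).
Qed.

Lemma conv3_le_root x y : conv3 T x y <= N.
Proof. exact: (conv3_le T0 TC (@conn_psd) _ _ conv3_root). Qed.

Let N0 : 0 <= N. Proof. exact: conv3_ge0. Qed.
Let X0 : 0 <= X. Proof. exact: chi_ge0. Qed.

Lemma conn_transport (F : V -> V -> \bar R) : (forall x y, 0 <= F x y) ->
  (forall f : V -> V, bijective f -> (forall x y, T (f x) (f y) = T x y) ->
     forall x y, F (f x) (f y) = F x y) ->
  \S_ x F o x = \S_ x F x o.
Proof.
move=> F0 inv; apply: transport => // f fa; apply: inv; first by have [] := fa.
by move=> x y; rewrite (conn_aut lP).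
Qed.

Lemma tree_bound :
  \S_ x \S_ u \S_ v (T o u * T o v * P b (L o x `&` L o u `&` L o v)) <=
  X * (N * N + N * N + N * N).
Proof.
apply: le_trans (tree_diagrams_le T0 TC (@conn_TT_psd) (@conn_transport) N0 X0
  chi_root conv3_le_root).
apply: le_tsum => x; apply: le_tsum => u; apply: le_tsum => v.
apply: lee_wpmul2l; first exact: mule_ge0.
exact: (prob_linked4 b0' lP).
Qed.

Lemma one_le_triangle : 1 <= N.
Proof.
apply: le_trans (_ : T o o * conv2 T o o <= _); last first.
  by apply: tsum_ge_term => z; rewrite mule_ge0 // conv2_ge0.
rewrite conn_refl mul1e; apply: le_trans (_ : T o o * T o o <= _).
  by rewrite conn_refl mul1e.
by apply: (@tsum_ge_term _ _ (fun z => T o z * T z o)) => z; rewrite mule_ge0.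
Qed.

Lemma triangle_le_chi : N <= X * X.
Proof.
rewrite -{2}(chi_root o) -tsumZl // /conv3; apply: le_tsum => z.
rewrite muleC; apply: lee_wpmul2r => //; rewrite -(chi_root z).
apply: le_tsum => v; rewrite -[leRHS]mule1; apply: lee_wpmul2l => //.
exact: conn_le1.
Qed.

(** The free leaf [y] of the three-point tree gives a factor [chi], and the extra
    line from [x] to the root closes the rest to a triangle. *)
Lemma three_point_bound :
  \S_ y \S_ x (T x o * P b (L o y `&` L o x)) <= X * N.
Proof.
apply: le_trans (_ : \S_ y \S_ x \S_ z (T x o * (T o z * T z y * T x z)) <= _).
  apply: le_tsum => y; apply: le_tsum => x; rewrite tsumZl //; last first.
    by nng.
  by apply: lee_wpmul2l => //; exact: (prob_linked3 b0' lP).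
rewrite exchange_tsum; last by nng.
apply: le_trans (_ : \S_ x \S_ z (X * (T o z * (T z x * T x o))) <= _).
  apply: le_tsum => x; rewrite exchange_tsum; last by nng.
  apply: le_tsum => z; rewrite (eq_tsum (g := fun y => T z y * (T o z * (T z x * T x o)))).
    by rewrite tsumZr ?chi_root // !mule_ge0.
  by move=> y; rewrite (TC x z) (AC (1*3) (3*(2*(4*1)))).
rewrite exchange_tsum; last by nng.
rewrite -tsumZl //; last by move=> z; rewrite mule_ge0 // conv2_ge0.
apply: le_tsum => z; rewrite tsumZl //; last by nng.
apply: lee_wpmul2l => //; rewrite tsumZl // => x; by nng.
Qed.

Lemma no_infinite_cluster : P b (infinite_cluster o) = 0.
Proof.
apply/eqP; rewrite eq_le measure_ge0 andbT leNgt; apply/negP => H.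
by have := beta_c_le b0' H; rewrite leNgt hbc.
Qed.

(** ** Events determined by the cluster of the root *)

Section ClusterEvents.
Variable Q : set V -> Prop.
Let A : set config := [set w : config | Q [set z | linked_in setT w o z]].
Hypothesis mA : measurable A.

Let cluster_eq (S : set V) w : cluster_event o S w -> [set z | linked_in setT w o z] = S.
Proof. by move=> K; apply/seteqP; split => z /=; move/K. Qed.

Let slice (S : set V) : A `&` cluster_event o S =
  if `[< Q S >] then cluster_event o S else set0.
Proof.
apply/seteqP; split => w; case: asboolP => QS //=.
- by move=> [].
- by move=> [Aw K]; apply: QS; rewrite -(cluster_eq K).
- by move=> K; split => //; rewrite /A /= (cluster_eq K).
Qed.

(** Given the cluster of the root, what remains is independent percolation off
    the cluster, where connections are less likely. *)
Lemma prob_off_cluster_le v x :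
  P b (A `&` ~` L o v `&` L v x) <= P b A * T v x.
Proof.
have mB : measurable (A `&` ~` L o v `&` L v x).
  by apply: measurableI => //; apply: measurableI => //; exact: measurableC.
rewrite (cluster_partition mB no_infinite_cluster).
rewrite (cluster_partition mA no_infinite_cluster) -tsumZr //.
apply: le_tsum => S; have mK := cluster_event_measurable o [set` S].
rewrite slice; case: asboolP => QS; last first.
  rewrite measure0 mul0e (_ : _ `&` _ = set0) ?measure0 //.
  apply/seteqP; split => // w [[[Aw _] _] K]; apply: QS.
  by rewrite -(cluster_eq K).
apply: le_trans (_ : P b (cluster_event o [set` S] `&` linked_event (~` [set` S]) v x) <= _).
  apply: le_measure_sub; [exact: measurableI| |].
    by apply: measurableI => //; exact: linked_event_measurable.
  move=> w [[[Aw nv] vx] K]; split => //; apply/(linked_off_cluster _ K) => //.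
  by move=> Sv; apply: nv; apply/K.
rewrite (cluster_indep lP); apply: lee_wpmul2l => //.
by apply: conn_sub.
Qed.

(** Conversely, what an independent copy does off the cluster [S] may be read in
    the configuration that defines [S]. *)
Lemma prob_off_cluster_ge v x :
  tsum (fun S : {fset V} => if `[< Q [set` S] >] then
    P b (cluster_event o [set` S]) * conn (P b) (~` [set` S]) v x else 0) <=
  P b (A `&` ~` L o v `&` L v x).
Proof.
have mB : measurable (A `&` ~` L o v `&` L v x).
  by apply: measurableI => //; apply: measurableI => //; exact: measurableC.
rewrite (cluster_partition mB no_infinite_cluster).
apply: le_tsum => S; have mK := cluster_event_measurable o [set` S].
case: asboolP => QS //; rewrite -(cluster_indep lP); apply: le_measure_sub.
- by apply: measurableI => //; exact: linked_event_measurable.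
- exact: measurableI.
move=> w [K vx]; have nSv : ~ [set` S] v by case: vx => s /walk_start.
split => //; split; last by apply/(linked_off_cluster _ K).
split; first by rewrite /A /= (cluster_eq K).
by move=> /K.
Qed.

End ClusterEvents.

(** An edge between [a] and [v] would be pivotal for joining [y] to [x]. *)
Definition apart a v y x : set config := L a y `&` ~` L a v `&` L v x.

Lemma apart_measurable a v y x : measurable (apart a v y x).
Proof. by apply: measurableI => //; apply: measurableI => //; exact: measurableC. Qed.

(** A lower bound for the derivative of the susceptibility, rooted at the near end
    of the pivotal edge; see [growth_le_pivotal]. *)
Definition growth : \bar R :=
  \S_ v (coupling o v * \S_ y \S_ x P b (apart o v y x)).

(** Here each event is weighted by the sum of [T o u] over the cluster of [o]. *)
Definition weighted_growth : \bar R :=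
  \S_ u \S_ v (coupling o v * \S_ y \S_ x (T o u * P b (apart o v y x `&` L o u))).

(** A connection from the root to [x] in an independent copy either ends inside
    the root cluster, which is the three-point case, or leaves it for the last
    time along an edge.  Off the root cluster the two copies have the same law,
    so the last part of the connection may be read in the first copy. *)
Lemma leaving_cluster : X * X <= X * N + b%:E * weighted_growth.
Proof.
pose K S := P b (cluster_event o [set` (S : {fset V})]).
have K0 S : 0 <= K S by [].
have mK S := cluster_event_measurable o [set` (S : {fset V})].
pose i (S : {fset V}) y : \bar R := ((y \in S)%:R : R)%:E.
have i0 S y : 0 <= i S y by rewrite lee_fin ler0n.
have Ty y : T o y = tsum (fun S : {fset V} => i S y * K S).
  rewrite /conn (cluster_partition (mL o y) no_infinite_cluster).
  apply: eq_tsum => S; rewrite /i; case: (boolP (y \in S)) => yS.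
    by rewrite mul1e; congr (P b _); apply/seteqP; split => [w []//|w k]; split => //; apply/k.
  rewrite mul0e (_ : _ `&` _ = set0) ?measure0 //; apply/seteqP; split => // w [oy k].
  by move/negP: yS; apply; apply/k.
have Tyx y x : P b (L o y `&` L o x) = tsum (fun S : {fset V} => i S y * i S x * K S).
  rewrite (cluster_partition (measurableI _ _ (mL o y) (mL o x)) no_infinite_cluster).
  apply: eq_tsum => S; rewrite /i; case: (boolP (y \in S)) => yS; last first.
    rewrite !mul0e (_ : _ `&` _ = set0) ?measure0 //; apply/seteqP; split => // w [[oy _] k].
    by move/negP: yS; apply; apply/k.
  case: (boolP (x \in S)) => xS; last first.
    rewrite mule0 mul0e (_ : _ `&` _ = set0) ?measure0 //; apply/seteqP; split => // w [[_ ox] k].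
    by move/negP: xS; apply; apply/k.
  by rewrite !mul1e; congr (P b _); apply/seteqP; split => [w []//|w k];
    split => //; split; apply/k.
have i_le (S : {fset V}) y (r : \bar R) : 0 <= r -> i S y * r = if y \in S then r else 0.
  by rewrite /i; case: (y \in S); rewrite ?mul1e ?mul0e.
have i1 (S : {fset V}) x : i S x <= 1 by rewrite lee_fin; case: (x \in S).
have cn0 U x y := conn_ge0 (P b) U x y.
pose cross (S : {fset V}) x v a := conn (P b) (~` [set` S]) x v * (b%:E * coupling v a) * T a o.
have b0e : 0 <= b%:E by rewrite lee_fin.
have cross0 S x v a : 0 <= cross S x v a by rewrite !mule_ge0.
(* one step, for a root cluster frozen to [S] *)
have step (S : {fset V}) : o \in S ->
    X <= \S_ x (i S x * T x o) + \S_ x \S_ v \S_ a (i S a * cross S x v a).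
  move=> oS; rewrite -(chi_root o) -tsumD; first last.
  - by nng.
  - by nng.
  apply: le_tsum => x; rewrite (TC o x).
  have [xS|xS] := boolP (x \in S).
    rewrite {1}/i xS mul1e leeDl //; apply: tsum_ge0 => v; apply: tsum_ge0 => a.
    by nng.
  rewrite {1}/i (negbTE xS) mul0e add0e.
  apply: le_trans (@conn_boundary _ _ b _ b0' lP [set` S] x o _ _) _ => //; first exact/negP.
  apply: le_tsum => v; apply: le_tsum => a; rewrite i_le //.
  have -> : (a \in [set` S]) = (a \in S) by apply/idP/idP => [/set_mem|H] //; exact/mem_set.
  by [].
have P0 (A : set config) : 0 <= P b A by [].
apply: le_trans (_ : \S_ y tsum (fun S : {fset V} => i S y * K S *
   (\S_ x (i S x * T x o) + \S_ x \S_ v \S_ a (i S a * cross S x v a))) <= _).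
  rewrite -{1}(chi_root o) -tsumZr //; apply: le_tsum => y.
  rewrite Ty -tsumZr //; last by nng.
  apply: le_tsum => S.
  have [oS|oS] := boolP (o \in S); first by apply: lee_wpmul2l (step S oS); rewrite mule_ge0.
  rewrite (_ : K S = 0) ?mule0 ?mul0e // /K (_ : cluster_event _ _ = set0) ?measure0 //.
  apply/seteqP; split => // w k; move/negP: oS; apply.
  by apply/k; exact: linked_in_refl.
rewrite (eq_tsum (g := fun y =>
    tsum (fun S : {fset V} => \S_ x (i S y * K S * (i S x * T x o))) +
    tsum (fun S : {fset V} => \S_ x \S_ v \S_ a (i S y * K S * (i S a * cross S x v a))))); last first.
  move=> y; rewrite -tsumD; first last.
  - move=> S; apply: tsum_ge0 => x; apply: tsum_ge0 => v; apply: tsum_ge0 => a.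
    by nng.
  - by nng.
  apply: eq_tsum => S; rewrite ge0_muleDr; first last.
  - by nng.
  - by nng.
  have iK : 0 <= i S y * K S by nng.
  congr (_ + _).
    by rewrite tsumZl // => x; rewrite mule_ge0.
  rewrite -tsumZl //; last first.
    by nng.
  apply: eq_tsum => x; rewrite -tsumZl //; last first.
    by nng.
  apply: eq_tsum => v; rewrite -tsumZl // => a; by nng.
rewrite tsumD; first last.
- by nng.
- by nng.
apply: leeD.
  apply: le_trans three_point_bound; apply: le_tsum => y.
  rewrite [leLHS]exchange_tsum; last by nng.
  apply: le_tsum => x; rewrite Tyx muleC -tsumZr //; last by nng.
  by apply: le_tsum => S; rewrite (AC (2*2) ((1*3*2)*4)).
(* transport of mass from the root to the inner end of the leaving edge *)
pose F u a := \S_ v (coupling a v * \S_ y \S_ x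
   (T a u * P b (L u y `&` L u a `&` ~` L u v `&` L v x))).
have F0 u a : 0 <= F u a.
  apply: tsum_ge0 => v; rewrite mule_ge0 //; apply: tsum_ge0 => y.
  by nng.
have mF u a v y x : measurable (L u y `&` L u a `&` ~` L u v `&` L v x).
  by apply: measurableI => //; apply: measurableI; [exact: measurableI|exact: measurableC].
apply: (@le_trans _ _ (b%:E * \S_ a F o a)).
  rewrite -tsumZl //.
  apply: le_trans (_ : \S_ a \S_ v \S_ y \S_ x (b%:E * coupling a v * (T a o *
     P b (L o y `&` L o a `&` ~` L o v `&` L v x))) <= _); last first.
    apply: le_tsum => a; rewrite -tsumZl //; last first.
      move=> v; rewrite mule_ge0 //; apply: tsum_ge0 => y.
      by nng.
    apply: le_tsum => v; rewrite [leRHS]muleA.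
    have bc0 : 0 <= b%:E * coupling a v by nng.
    rewrite -[leRHS]tsumZl //; last by nng.
    apply: le_tsum => y; rewrite tsumZl // => x; by nng.
  have g0 y S x v a : 0 <= i S y * K S * (i S a * cross S x v a) by nng.
  apply: le_trans (_ : \S_ y \S_ x \S_ v \S_ a tsum (fun S : {fset V} =>
     i S y * K S * (i S a * cross S x v a)) <= _).
    apply: le_tsum => y; rewrite [leLHS]exchange_tsum; last first.
      by move=> S x; apply: tsum_ge0 => v; apply: tsum_ge0 => a.
    apply: le_tsum => x; rewrite [leLHS]exchange_tsum; last first.
      by move=> S v; apply: tsum_ge0 => a.
    by apply: le_tsum => v; rewrite [leLHS]exchange_tsum.
  have h0 y x v a : 0 <= b%:E * coupling a v * (T a o *
     P b (L o y `&` L o a `&` ~` L o v `&` L v x)) by nng.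
  apply: le_trans (_ : \S_ y \S_ x \S_ v \S_ a (b%:E * coupling a v * (T a o *
     P b (L o y `&` L o a `&` ~` L o v `&` L v x))) <= _).
    apply: le_tsum => y; apply: le_tsum => x; apply: le_tsum => v; apply: le_tsum => a.
    have := @prob_off_cluster_ge (fun C => C y /\ C a) _ v x.
    rewrite (_ : [set w | _] = L o y `&` L o a) // => /(_ (measurableI _ _ (mL o y) (mL o a))).
    rewrite (couplingC a v) muleA => H.
    apply: le_trans (lee_wpmul2l _ H); last by nng.
    rewrite -tsumZl; first last.
    - by nng.
    - by move=> S; case: asboolP => // _; rewrite mule_ge0.
    apply: le_tsum => S; rewrite /i.
    case: (boolP (y \in S)) => yS; last first.
      by rewrite !mul0e mule_ge0 ?mule_ge0 //; case: asboolP => // _; rewrite mule_ge0.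
    case: (boolP (a \in S)) => aS; last first.
      by rewrite !mul0e mule0 mule_ge0 ?mule_ge0 //; case: asboolP => // _; rewrite mule_ge0.
    rewrite asboolT // !mul1e /cross conn_sym.
    by rewrite (AC (1*((1*(1*1))*1)) ((3*4*5)*(1*2))).
  rewrite [leLHS]exchange_tsum; last first.
    by move=> y x; apply: tsum_ge0 => v; apply: tsum_ge0 => a.
  apply: le_trans (_ : \S_ x \S_ a \S_ v \S_ y (b%:E * coupling a v * (T a o *
     P b (L o y `&` L o a `&` ~` L o v `&` L v x))) <= _).
    apply: le_tsum => x; rewrite [leLHS]exchange_tsum; last by move=> y v; apply: tsum_ge0 => a.
    apply: le_trans (_ : \S_ v \S_ a \S_ y (b%:E * coupling a v * (T a o *
      P b (L o y `&` L o a `&` ~` L o v `&` L v x))) <= _).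
      by apply: le_tsum => v; rewrite [leLHS]exchange_tsum.
    by rewrite [leLHS]exchange_tsum // => v a; apply: tsum_ge0 => y.
  rewrite [leLHS]exchange_tsum; last by move=> x a; apply: tsum_ge0 => v; apply: tsum_ge0 => y.
  apply: le_tsum => a; rewrite [leLHS]exchange_tsum; last by move=> x v; apply: tsum_ge0 => y.
  by apply: le_tsum => v; rewrite [leLHS]exchange_tsum.
have Finv f : automorphism f -> forall u a, F (f u) (f a) = F u a.
  move=> fa u a; have [bf _] := fa.
  rewrite /F -(reindex_tsum _ bf); apply: eq_tsum => v; rewrite coupling_aut //.
  congr (_ * _); rewrite -(reindex_tsum _ bf); apply: eq_tsum => y.
  rewrite -(reindex_tsum _ bf); apply: eq_tsum => x; rewrite (conn_aut lP) //.
  congr (_ * _).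
  exact: (@prob_aut _ _ _ _ lP f (fun l => ((l u y /\ l u a) /\ ~ l u v) /\ l v x) fa (mF u a v y x)).
have transportF : \S_ a F o a = \S_ u F u o by exact: transport F0 Finv.
rewrite transportF; apply: lee_wpmul2l; first exact: b0e.
rewrite /weighted_growth {transportF Finv}.
apply: le_tsum => u; apply: le_tsum => v; apply: lee_wpmul2l => //.
apply: le_tsum => y; apply: le_tsum => x; apply: lee_wpmul2l => //.
apply: le_measure_sub => //; first by apply: measurableI => //; exact: apart_measurable.
move=> w [[[uy uo] nuv] vx]; split; last exact: linked_in_sym.
split => //; split.
  by apply: linked_in_trans uy; exact: linked_in_sym.
by move=> ov; apply: nuv; exact: linked_in_trans uo ov.
Qed.

End DifferentialInequality.

Section QuadraticEvent.
Context {R : realType} d {Om : measurableType d} (mu : probability Om R).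
Variables (W : countType) (A : set Om) (B : W -> set Om) (al : W -> \bar R).
Hypotheses (mA : measurable A) (mB : forall u, measurable (B u)).
Hypothesis al0 : forall u, 0 <= al u.

(** The inequality [2 t phi <= t ^ 2 + phi ^ 2] integrated over [A], for
    [phi] the weighted number of events [B u] that occur. *)
Lemma quadratic_event t : 0 <= t ->
  t * (\S_ u (al u * mu (A `&` B u))) + t * (\S_ u (al u * mu (A `&` B u))) <=
  t * t * mu A + \S_ u \S_ v (al u * al v * mu (A `&` B u `&` B v)).
Proof.
move=> t0.
pose i (C : set Om) w : \bar R := (\1_C w)%:E.
have i0 C w : 0 <= i C w by rewrite lee_fin.
have mi C : measurable C -> measurable_fun [set: Om] (i C).
  by move=> mC; apply/measurable_EFinP; exact: measurable_indic.
have ii C : measurable C -> mu C = \int[mu]_w i C w.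
  by move=> mC; rewrite /i integral_indic // setIT.
have mAB u : measurable (A `&` B u) by exact: measurableI.
have mABB u v : measurable (A `&` B u `&` B v) by exact: measurableI.
have mZ (c : \bar R) C : measurable C -> measurable_fun [set: Om] (fun w => c * i C w).
  by move=> mC; apply: emeasurable_funM; [exact: measurable_cst|exact: mi].
have iZ (c : \bar R) C : 0 <= c -> measurable C -> c * mu C = \int[mu]_w (c * i C w).
  by move=> c0 mC; rewrite (ii _ mC) ge0_integralZl //; exact: mi.
pose g w := \S_ u (al u * i (A `&` B u) w).
pose h w := \S_ u \S_ v (al u * al v * i (A `&` B u `&` B v) w).
have g0 w : 0 <= g w by apply: tsum_ge0 => u; rewrite mule_ge0.
have h0 w : 0 <= h w.
  by apply: tsum_ge0 => u; apply: tsum_ge0 => v; rewrite !mule_ge0.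
have mg : measurable_fun [set: Om] g.
  by apply: measurable_tsum => u; [exact: mZ|move=> w; rewrite mule_ge0].
have mh1 u : measurable_fun [set: Om] (fun w => \S_ v (al u * al v * i (A `&` B u `&` B v) w)).
  by apply: measurable_tsum => v; [exact: mZ|move=> w; rewrite !mule_ge0].
have mh : measurable_fun [set: Om] h.
  apply: measurable_tsum => u; first exact: mh1.
  by nng.
have gE : \S_ u (al u * mu (A `&` B u)) = \int[mu]_w g w.
  rewrite integral_tsum; [|by move=> u; exact: mZ|by nng].
  by apply: eq_tsum => u; exact: iZ.
have hE : \S_ u \S_ v (al u * al v * mu (A `&` B u `&` B v)) = \int[mu]_w h w.
  rewrite integral_tsum; [|by []|]; last first.
    by nng.
  apply: eq_tsum => u.
  rewrite integral_tsum; [|by move=> v; exact: mZ|by nng].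
  by apply: eq_tsum => v; apply: iZ => //; rewrite mule_ge0.
have mtg : measurable_fun [set: Om] (fun w => t * g w).
  by apply: emeasurable_funM => //; exact: measurable_cst.
have tg0 w : 0 <= t * g w by nng.
have ti0 w : 0 <= t * t * i A w by nng.
have tgE : t * (\int[mu]_w g w) = \int[mu]_w (t * g w).
  by rewrite ge0_integralZl.
rewrite gE hE tgE iZ //; last by nng.
rewrite -[leLHS]ge0_integralD // -[leRHS]ge0_integralD //; last exact: mZ.
apply: ge0_le_integral => //.
- by move=> w _; rewrite adde_ge0.
- exact: emeasurable_funD.
- by apply: emeasurable_funD => //; exact: mZ.
move=> w _; have [Aw|nAw] := pselect (A w); last first.
  have z C : i (A `&` C) w = 0.
    by rewrite /i indicE memNset // => -[].
  rewrite /g (eq_tsum (g := fun=> 0)); last by move=> u; rewrite z mule0.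
  by rewrite tsum0 mule0 adde0 adde_ge0.
have iAB C : i (A `&` C) w = i C w.
  rewrite /i !indicE; congr ((nat_of_bool _)%:R%:E).
  by apply/idP/idP => /set_mem; [move=> [_ H]|move=> H]; exact/mem_set.
have iI C D : i (C `&` D) w = i C w * i D w.
  by rewrite /i indicI /= -EFinM.
have -> : h w = g w * g w.
  rewrite /h {1}/g -tsumZr //; last by nng.
  apply: eq_tsum => u; rewrite /g -tsumZl; [|by nng|by nng].
  by apply: eq_tsum => v; rewrite iI !iAB muleACA.
have -> : i A w = 1 by rewrite /i indicE mem_set.
by rewrite mule1; exact: mule_amgm.
Qed.

End QuadraticEvent.

Section Increment.
Context {R : realType} (G : weighted_graph R) (P : R -> probability (config G) R).
Hypothesis hP : forall b : R, (0 <= b)%R -> percolation_law b (P b).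
Hypothesis htrans : transitive_graph G.
Variable o : vertex G.
Hypothesis hunim : unimodular o.
Hypothesis hnorm : out_weight o = 1.
Local Notation V := (vertex G).
Local Notation E := (edge G).
Local Notation config := (config G).
Local Notation L := (linked_event (G := G) setT).
Implicit Types (x y z u v a : V) (e : E).
Variable b : R.
Hypothesis b0 : (0 < b)%R.
Hypothesis hbc : b%:E < beta_c P o.
Local Notation T := (conn (P b) setT).
Local Notation X := (chi P b o).
Local Notation N := (conv3 T o o).

Let b0' : (0 <= b)%R := ltW b0.
Let lP : percolation_law b (P b) := hP b0'.
Let T0 x y : 0 <= T x y. Proof. exact: conn_ge0. Qed.
Let mL x y : measurable (L x y). Proof. exact: linked_event_measurable. Qed.
Let c0 x y : 0 <= coupling x y. Proof. exact: coupling_ge0. Qed.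
Let X0 : 0 <= X. Proof. exact: chi_ge0. Qed.
Let mA v y x : measurable (apart o v y x). Proof. exact: apart_measurable. Qed.

(** Off the cluster of [o], the sum over [x] is at most [chi]; the cluster itself
    contains [y], [u] and [u'], to which [tree_bound] applies. *)
Lemma second_moment :
  \S_ v (coupling o v * \S_ y \S_ x \S_ u \S_ u' (T o u * T o u' *
     P b (apart o v y x `&` L o u `&` L o u'))) <=
  X * (X * (N * N + N * N + N * N)).
Proof.
set M := N * N + N * N + N * N.
have N0 : 0 <= N by exact: conv3_ge0.
have M0 : 0 <= M by rewrite !adde_ge0 // mule_ge0.
have XM0 : 0 <= X * (X * M) by nng.
have m3 y u u' : measurable (L o y `&` L o u `&` L o u').
  by apply: measurableI => //; exact: measurableI.
apply: le_trans (_ : \S_ v (coupling o v * (X * (X * M))) <= _); last first.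
  rewrite tsumZr // -[leRHS]mul1e; apply: lee_wpmul2r => //.
  exact: (tsum_coupling_le1 htrans hnorm o).
apply: le_tsum => v; apply: lee_wpmul2l => //.
have pos y u u' : 0 <= T o u * T o u' * P b (L o y `&` L o u `&` L o u').
  by nng.
apply: le_trans (_ : \S_ y \S_ x \S_ u \S_ u'
    (T v x * (T o u * T o u' * P b (L o y `&` L o u `&` L o u'))) <= _).
  apply: le_tsum => y; apply: le_tsum => x; apply: le_tsum => u; apply: le_tsum => u'.
  rewrite muleCA; apply: lee_wpmul2l; first by nng.
  rewrite muleC.
  have := @prob_off_cluster_le _ _ _ hP o b b0 hbc
    (fun C => (C y /\ C u) /\ C u') (m3 y u u') v x.
  apply: le_trans; apply: le_measure_sub.
  - by apply: measurableI => //; exact: measurableI.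
  - by apply: measurableI => //; apply: measurableI => //; [exact: m3|exact: measurableC].
  - by move=> w [[[[oy nv] vx] ou] ou'].
have treeB := tree_bound hP htrans hunim b0.
rewrite -/M in treeB.
apply: le_trans (lee_wpmul2l X0 treeB).
rewrite -tsumZl; last 2 first.
- by move=> y; apply: tsum_ge0 => u; apply: tsum_ge0 => u'.
- exact: X0.
apply: le_tsum => y.
have s2 : 0 <= \S_ u \S_ u' (T o u * T o u' * P b (L o y `&` L o u `&` L o u')).
  by apply: tsum_ge0 => u; apply: tsum_ge0.
rewrite -(chi_root hP htrans o b0 v) -[leRHS]tsumZr //.
apply: le_tsum => x; rewrite -[leRHS]tsumZl //; last by move=> u; apply: tsum_ge0.
by apply: le_tsum => u; rewrite -[leRHS]tsumZl.
Qed.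

(** The Cauchy--Schwarz inequality, linearised by the multiplier [t]. *)
Lemma quadratic_growth t : 0 <= t ->
  t * weighted_growth P o b + t * weighted_growth P o b <=
  t * t * growth P o b + X * (X * (N * N + N * N + N * N)).
Proof.
move=> t0; apply: le_trans (leeD (lexx _) second_moment).
pose f v y x u := T o u * P b (apart o v y x `&` L o u).
pose q v y x := \S_ u \S_ u' (T o u * T o u' * P b (apart o v y x `&` L o u `&` L o u')).
have f0 v y x u : 0 <= f v y x u by rewrite mule_ge0.
have q0 v y x : 0 <= q v y x.
  by apply: tsum_ge0 => u; apply: tsum_ge0 => u'; rewrite !mule_ge0.
have sf0 v y x : 0 <= \S_ u f v y x u by apply: tsum_ge0.
have sf1 v y u : 0 <= \S_ x f v y x u by apply: tsum_ge0.
have sf2 v y : 0 <= \S_ x \S_ u f v y x u by apply: tsum_ge0.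
have sf3 v u : 0 <= \S_ y \S_ x f v y x u by apply: tsum_ge0.
have p0 v y : 0 <= \S_ x P b (apart o v y x) by apply: tsum_ge0.
have p1 v : 0 <= \S_ y \S_ x P b (apart o v y x) by apply: tsum_ge0.
have tt0 : 0 <= t * t by nng.
have WE : weighted_growth P o b = \S_ v (coupling o v * \S_ y \S_ x \S_ u f v y x u).
  rewrite /weighted_growth exchange_tsum; last first.
    by move=> u v; rewrite mule_ge0 //; exact: (sf3 v u).
  apply: eq_tsum => v.
  transitivity (coupling o v * \S_ u \S_ y \S_ x f v y x u).
    exact: (tsumZl (sf3 v) (c0 o v)).
  congr (_ * _); transitivity (\S_ y \S_ u \S_ x f v y x u).
    by apply: exchange_tsum => u y; exact: sf1.
  by apply: eq_tsum => y; apply: exchange_tsum => u x.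
have tW : t * weighted_growth P o b =
    \S_ v (coupling o v * \S_ y \S_ x (t * \S_ u f v y x u)).
  rewrite WE -tsumZl //; last by move=> v; rewrite mule_ge0 //; exact: tsum_ge0.
  apply: eq_tsum => v; rewrite muleCA; congr (_ * _).
  rewrite -tsumZl //; apply: eq_tsum => y; by rewrite -tsumZl.
have tf0 v y x : 0 <= t * \S_ u f v y x u by nng.
have tf1 v y : 0 <= \S_ x (t * \S_ u f v y x u) by apply: tsum_ge0.
have tf2 v : 0 <= \S_ y \S_ x (t * \S_ u f v y x u) by apply: tsum_ge0.
rewrite tW -tsumD; [|by nng|by nng].
have tG : t * t * growth P o b =
    \S_ v (coupling o v * \S_ y \S_ x (t * t * P b (apart o v y x))).
  rewrite /growth -tsumZl //; last by nng.
  apply: eq_tsum => v; rewrite muleCA; congr (_ * _).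
  by rewrite -tsumZl //; apply: eq_tsum => y; rewrite -tsumZl.
have tp0 v y x : 0 <= t * t * P b (apart o v y x) by nng.
have sq0 v y : 0 <= \S_ x q v y x by apply: tsum_ge0.
have tp1 v y : 0 <= \S_ x (t * t * P b (apart o v y x)) by apply: tsum_ge0.
have tp2 v : 0 <= \S_ y \S_ x (t * t * P b (apart o v y x)) by apply: tsum_ge0.
have sq1 v : 0 <= \S_ y \S_ x q v y x by apply: tsum_ge0.
rewrite tG -[leRHS]tsumD; first last.
- by move=> v; apply: mule_ge0; [|exact: sq1].
- by move=> v; apply: mule_ge0; [|exact: tp2].
apply: le_tsum => v.
rewrite -[leLHS]ge0_muleDr // -[leRHS]ge0_muleDr; [|exact: tp2|exact: sq1].
apply: lee_wpmul2l => //.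
rewrite -[leLHS]tsumD // -[leRHS]tsumD; [|exact: tp1|exact: sq0].
apply: le_tsum => y; rewrite -[leLHS]tsumD // -[leRHS]tsumD; [|exact: tp0|exact: q0].
by apply: le_tsum => x; exact: (quadratic_event (P b) (mA v y x) (mL o) (T0 o) t0).
Qed.

(** The events for the two orientations of [e] are disjoint, because [o] is joined
    to the first end and not to the second. *)
Lemma pivotal_edge_ends x e :
  \S_ a \S_ v (if joins e a v then P b (L a o `&` ~` L a v `&` L v x) else 0) <=
  P b (pivotal (L o x) e).
Proof.
pose f a v := P b (L a o `&` ~` L a v `&` L v x).
have f0 a v : 0 <= f a v by [].
have mf a v : measurable (L a o `&` ~` L a v `&` L v x) by exact: apart_measurable.
have pv : measurable (pivotal (L o x) e) by exact: pivotal_measurable.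
set p := (ends e).1; set r := (ends e).2.
have piv a v : joins e a v -> L a o `&` ~` L a v `&` L v x `<=` pivotal (L o x) e.
  move=> av w [[ao nav] vx]; split.
    by move=> ox; apply: nav; apply: linked_in_trans ao (linked_in_trans ox _);
      exact: linked_in_sym.
  have sub g : (w : E -> bool) g -> (insert w e : E -> bool) g.
    by move=> wg; rewrite /insert wg.
  apply: linked_in_trans (_ : linked_in setT _ o a) _.
    by apply: linked_in_sub (linked_in_sym ao).
  apply: linked_in_trans (linked_in_edge (e := e) _ _ _ av) _ => //.
    by rewrite /insert eqxx orbT.
  exact: linked_in_sub vx.
have pr : joins e p r by rewrite /joins -surjective_pairing eqxx.
have rp : joins e r p by rewrite joinsC.
apply: (@le_trans _ _ (f p r + f r p)).
  apply: (@le_trans _ _ (\S_ a \S_ v (((v == r)%:R)%:E * (((a == p)%:R)%:E * f a v) +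
     ((v == p)%:R)%:E * (((a == r)%:R)%:E * f a v)))).
    apply: le_tsum => a; apply: le_tsum => v.
    have n0 (c : bool) : 0 <= (c%:R)%:E :> \bar R by rewrite lee_fin ler0n.
    case: ifP => [av|_]; last by rewrite adde_ge0 // !mule_ge0.
    have [[-> ->]|[-> ->]] := joins_same pr av; rewrite !eqxx !mul1e.
      by rewrite leeDl // !mule_ge0.
    by rewrite leeDr // !mule_ge0.
  have d0 (s s' : V) (k : V -> V -> \bar R) : (forall a v, 0 <= k a v) ->
      \S_ a \S_ v (((v == s)%:R)%:E * (((a == s')%:R)%:E * k a v)) = k s' s.
    move=> k0; transitivity (\S_ a (((a == s')%:R)%:E * k a s)); last by rewrite tsum_delta.
    apply: eq_tsum => a; rewrite (@tsum_delta _ _ (fun v => ((a == s')%:R)%:E * k a v)) // => v.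
    by rewrite mule_ge0 // lee_fin ler0n.
  rewrite (eq_tsum (g := fun a => \S_ v (((v == r)%:R)%:E * (((a == p)%:R)%:E * f a v)) +
     \S_ v (((v == p)%:R)%:E * (((a == r)%:R)%:E * f a v)))); last first.
    by move=> a; rewrite tsumD // => v; rewrite !mule_ge0 // lee_fin ler0n.
  rewrite tsumD; try by move=> a; apply: tsum_ge0 => v; rewrite !mule_ge0 // lee_fin ler0n.
  by rewrite !d0.
rewrite /f -measureU //; last first.
  apply/seteqP; split => // w [[[po npr] _] [[ro _] _]]; apply: npr.
  by apply: linked_in_trans po _; exact: linked_in_sym.
apply: le_measure_sub => //; first exact: measurableU.
by move=> w [H|H]; [exact: piv pr _ H|exact: piv rp _ H].
Qed.

Lemma tsum_coupling_edges (f : V -> V -> V -> \bar R) : (forall x a v, 0 <= f x a v) ->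
  \S_ a \S_ v (coupling a v * \S_ x f x a v) =
  \S_ e ((weight e)%:E * \S_ x \S_ a \S_ v (if joins e a v then f x a v else 0)).
Proof.
move=> f0; have w0 e : 0 <= (weight e)%:E :> \bar R by rewrite lee_fin weight_ge0.
have i0 e x a v : 0 <= (if joins e a v then f x a v else 0) by case: ifP.
have j0 e a v : 0 <= (if joins e a v then (weight e)%:E else 0) :> \bar R by case: ifP.
have sf0 a v : 0 <= \S_ x f x a v by apply: tsum_ge0.
have i1 e x a : 0 <= \S_ v (if joins e a v then f x a v else 0) by apply: tsum_ge0.
have i2 e a v : 0 <= \S_ x (if joins e a v then f x a v else 0) by apply: tsum_ge0.
have i3 e a : 0 <= \S_ v \S_ x (if joins e a v then f x a v else 0) by apply: tsum_ge0.
have js0 e a v : 0 <= (if joins e a v then (weight e)%:E else 0) * \S_ x f x a v.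
  by nng.
transitivity (\S_ a \S_ e \S_ v ((if joins e a v then (weight e)%:E else 0) * \S_ x f x a v)).
  apply: eq_tsum => a; rewrite -exchange_tsum //; apply: eq_tsum => v.
  by rewrite -tsumZr.
rewrite exchange_tsum; last by move=> a e; apply: tsum_ge0.
apply: eq_tsum => e.
have -> : \S_ x \S_ a \S_ v (if joins e a v then f x a v else 0) =
    \S_ a \S_ v \S_ x (if joins e a v then f x a v else 0).
  rewrite exchange_tsum //; apply: eq_tsum => a; exact: exchange_tsum.
rewrite -tsumZl //; apply: eq_tsum => a; rewrite -tsumZl //; apply: eq_tsum => v.
by case: (joins e a v) => //; rewrite mul0e tsum0 mule0.
Qed.

(** Mass transport takes the root [o] of Russo's formula to the near end of the
    pivotal edge. *)
Lemma growth_le_pivotal :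
  growth P o b <= \S_ e ((weight e)%:E * \S_ x P b (pivotal (L o x) e)).
Proof.
pose F y a := \S_ v (coupling a v * \S_ x P b (L a y `&` ~` L a v `&` L v x)).
have m3 y a v x : measurable (L a y `&` ~` L a v `&` L v x) by exact: apart_measurable.
have s0 y a v : 0 <= \S_ x P b (L a y `&` ~` L a v `&` L v x) by apply: tsum_ge0.
have F0 y a : 0 <= F y a by apply: tsum_ge0 => v; rewrite mule_ge0.
have Finv f : automorphism f -> forall y a, F (f y) (f a) = F y a.
  move=> fa y a; have [bf _] := fa.
  rewrite /F -(reindex_tsum _ bf); apply: eq_tsum => v; rewrite coupling_aut //.
  congr (_ * _); rewrite -(reindex_tsum _ bf); apply: eq_tsum => x.
  exact: (@prob_aut _ _ _ _ lP f (fun l => (l a y /\ ~ l a v) /\ l v x) fa (m3 y a v x)).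
have transportF : \S_ a F o a = \S_ y F y o by exact: (transport hunim F0 Finv).
have -> : growth P o b = \S_ y F y o.
  rewrite /growth /F exchange_tsum; last by nng.
  by apply: eq_tsum => v; rewrite tsumZl.
rewrite -transportF {transportF Finv F0}.
rewrite (tsum_coupling_edges (f := fun x a v => P b (L a o `&` ~` L a v `&` L v x))); last by [].
apply: le_tsum => e; apply: lee_wpmul2l; first by rewrite lee_fin weight_ge0.
by apply: le_tsum => x; exact: pivotal_edge_ends.
Qed.

End Increment.

Section SusceptibilityIncrement.
Context {R : realType} (G : weighted_graph R) (P : R -> probability (config G) R).
Hypothesis hP : forall b : R, (0 <= b)%R -> percolation_law b (P b).
Hypothesis htrans : transitive_graph G.
Variable o : vertex G.
Hypothesis hunim : unimodular o.
Hypothesis hnorm : out_weight o = 1.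
Local Notation V := (vertex G).
Local Notation E := (edge G).
Local Notation L := (linked_event (G := G) setT).
Implicit Types (b c k : R) (x y : V) (e : E).

Definition chiR b : R := fine (chi P b o).
Definition triR b : R := fine (conv3 (conn (P b) setT) o o).

Lemma chiRE b : (0 < b)%R -> b%:E < beta_c P o -> chi P b o = (chiR b)%:E.
Proof.
move=> b0 bc; rewrite /chiR fineK // ge0_fin_numE ?chi_ge0 //.
exact: chi_finite.
Qed.

Lemma triRE b : (0 < b)%R -> b%:E < beta_c P o ->
  conv3 (conn (P b) setT) o o = (triR b)%:E.
Proof.
move=> b0 bc; have N0 : 0 <= conv3 (conn (P b) setT) o o.
  by apply: conv3_ge0 => x y; exact: conn_ge0.
rewrite /triR fineK // ge0_fin_numE //.
apply: le_lt_trans (triangle_le_chi hP htrans o b0) _.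
by rewrite (chiRE b0 bc) -EFinM ltry.
Qed.

Lemma triR_ge1 b : (0 < b)%R -> b%:E < beta_c P o -> (1 <= triR b)%R.
Proof. by move=> b0 bc; rewrite -lee_fin -triRE //; exact: one_le_triangle. Qed.

Lemma chiR_ge1 b : (0 < b)%R -> b%:E < beta_c P o -> (1 <= chiR b)%R.
Proof.
move=> b0 bc; rewrite -lee_fin -chiRE //.
apply: le_trans (_ : conn (P b) setT o o <= _); first by rewrite conn_refl.
by apply: tsum_ge_term => y; exact: conn_ge0.
Qed.

Lemma chiR_mono b c : (0 < b)%R -> (b <= c)%R -> c%:E < beta_c P o ->
  (chiR b <= chiR c)%R.
Proof.
move=> b0 bc cbc; have c0 : (0 < c)%R by exact: lt_le_trans bc.
have bbc : b%:E < beta_c P o by apply: le_lt_trans cbc; rewrite lee_fin.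
by rewrite -lee_fin -!chiRE // chi_mono // ltW.
Qed.

Lemma triR_mono b c : (0 < b)%R -> (b <= c)%R -> c%:E < beta_c P o ->
  (triR b <= triR c)%R.
Proof.
move=> b0 bc cbc; have c0 : (0 < c)%R by exact: lt_le_trans bc.
have bbc : b%:E < beta_c P o by apply: le_lt_trans cbc; rewrite lee_fin.
have T0 d x y : 0 <= conn (P d) setT x y by exact: conn_ge0.
have Tm x y : conn (P b) setT x y <= conn (P c) setT x y.
  by apply: conn_mono => //; exact: ltW.
rewrite -lee_fin -!triRE // /conv3; apply: le_tsum => z; apply: lee_pmul => //.
  by apply: conv2_ge0.
by apply: le_tsum => v; apply: lee_pmul.
Qed.

(** From [quadratic_growth] with the best multiplier and the lower bound for
    [weighted_growth] in [leaving_cluster]. *)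
Lemma growth_lower b : (0 < b)%R -> b%:E < beta_c P o ->
  ((Num.max (chiR b - triR b) 0) ^+ 2 / (3 * b ^+ 2 * triR b ^+ 2))%:E <= growth P o b.
Proof.
move=> b0 bc.
have c1 := chiR_ge1 b0 bc; have n1 := triR_ge1 b0 bc.
have gr0 : 0 <= growth P o b.
  apply: tsum_ge0 => v; apply: mule_ge0; first exact: coupling_ge0.
  by apply: tsum_ge0 => y; apply: tsum_ge0.
have W0 : 0 <= weighted_growth P o b.
  apply: tsum_ge0 => u; apply: tsum_ge0 => v; apply: mule_ge0; first exact: coupling_ge0.
  by apply: tsum_ge0 => y; apply: tsum_ge0 => x; apply: mule_ge0.
have leave := leaving_cluster hP htrans hunim b0 bc.
have quad t := @quadratic_growth _ _ _ hP htrans _ hunim hnorm _ b0 bc t.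
rewrite (chiRE b0 bc) (triRE b0 bc) in leave quad.
move: c1 n1 leave quad; set X := chiR b; set N := triR b => c1 n1 leave quad.
have [NX|NX] := leP (X - N)%R 0%R.
  by rewrite expr0n /= mul0r.
case: (growth P o b) gr0 quad => [g| |] // g0 quad; last by rewrite leey.
have := quad 1%:E; rewrite lee_fin ler01 => /(_ isT).
case: (weighted_growth P o b) W0 leave quad => [w| |] // w0 leave quad _; last first.
  by have := quad 1%:E; rewrite lee_fin ler01 => /(_ isT); rewrite mul1e.
move: leave; rewrite -!EFinM -EFinD lee_fin => leave.
have {}quad t : (0 <= t)%R -> (2 * t * w <= t ^+ 2 * g + 3 * X ^+ 2 * N ^+ 2)%R.
  move=> t0; have := quad t%:E; rewrite lee_fin => /(_ t0).
  by repeat first [rewrite -EFinM | rewrite -EFinD]; rewrite lee_fin; lra.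
(* [t] maximises [(2 t w - 3 X ^ 2 N ^ 2) / t ^ 2] for [w = X (X - N) / b]. *)
pose t := (3 * b * X * N ^+ 2 / (X - N))%R.
have X0 : (0 < X)%R by lra.
have N0 : (0 < N)%R by lra.
have t0 : (0 < t)%R by rewrite /t divr_gt0 // !mulr_gt0 // exprn_gt0.
have := quad t (ltW t0).
have bw : (X * (X - N) / b <= w)%R by rewrite ler_pdivrMr //; lra.
have tw : (2 * t * (X * (X - N) / b) <= 2 * t * w)%R by rewrite ler_wpM2l //; lra.
have e1 : (2 * t * (X * (X - N) / b) = 6 * X ^+ 2 * N ^+ 2)%R.
  by rewrite /t; field; rewrite !gt_eqF.
have e2 : ((X - N) ^+ 2 / (3 * b ^+ 2 * N ^+ 2) = 3 * X ^+ 2 * N ^+ 2 / t ^+ 2)%R.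
  by rewrite /t; field; rewrite !gt_eqF.
rewrite e1 in tw; rewrite lee_fin e2 ler_pdivrMr ?exprn_gt0 //.
lra.
Qed.

(** Finitely many edges already account for more than [k] of the sum in
    [growth_le_pivotal], and only these are sprinkled. *)
Lemma chiR_increment b c k : (0 < b)%R -> (b < c)%R -> c%:E < beta_c P o ->
  k%:E < growth P o b ->
  exists d, [/\ (b < d)%R, (d <= c)%R & (chiR b + k * (d - b) <= chiR d)%R].
Proof.
move=> b0 bc cbc kg.
have bbc : b%:E < beta_c P o by apply: lt_trans cbc; rewrite lte_fin.
have pm x e : measurable (pivotal (L o x) e).
  by apply: pivotal_measurable; exact: linked_event_measurable.
have w0 e : 0 <= (weight e)%:E :> \bar R by rewrite lee_fin weight_ge0.
have s0 e : 0 <= \S_ x P b (pivotal (L o x) e) by apply: tsum_ge0.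
have [F uF kF] := tsum_gt (lt_le_trans kg (growth_le_pivotal hP hunim b0)).
pose W := (\sum_(e <- F) weight e)%R.
have W0 : (0 <= W)%R by apply: sumr_ge0 => e _; exact: weight_ge0.
pose Y := \sum_(e <- F) ((weight e)%:E * \S_ x P b (pivotal (L o x) e)).
have Y0 : 0 <= Y by apply: sume_ge0 => e _; rewrite mule_ge0.
have key t : (0 < t)%R -> chi P b o + (t * expR (- (t * W)))%:E * Y <= chi P (b + t)%R o.
  move=> t0; have te0 : 0 <= (t * expR (- (t * W)))%:E.
    by rewrite lee_fin mulr_ge0 ?expR_ge0 // ltW.
  rewrite ge0_sume_distrr; last by move=> e _; rewrite mule_ge0.
  apply: (@le_trans _ _ (\S_ x (conn (P b) setT o x +
    \sum_(e <- F) ((t * weight e * expR (- (t * W)))%:E * P b (pivotal (L o x) e))))).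
    rewrite tsumD; first last.
    - by move=> x; apply: sume_ge0 => e _; rewrite mule_ge0 // lee_fin
        !mulr_ge0 ?expR_ge0 ?weight_ge0 // ltW.
    - by move=> x; exact: conn_ge0.
    apply: leeD; first by [].
    rewrite [leRHS]/tsum [leRHS]esum_sum; last first.
      by move=> x e _ _; rewrite mule_ge0 // lee_fin !mulr_ge0 ?expR_ge0 ?weight_ge0 // ltW.
    apply: lee_sum => e _; rewrite -/(tsum _) tsumZl //; last first.
      by rewrite lee_fin !mulr_ge0 ?expR_ge0 ?weight_ge0 // ltW.
    by rewrite muleA -EFinM mulrAC.
  apply: le_tsum => x; apply: (sprinkle hP) => //; [| |exact: ltW|exact: ltW].
    exact: linked_event_measurable.
  exact: linked_increasing.
have cb0 : (0 < c - b)%R by rewrite subr_gt0.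
have [y YE] : exists y : R, Y = y%:E.
  exists (fine Y); rewrite fineK // ge0_fin_numE // ltNge; apply/negP.
  rewrite leye_eq => /eqP YE; have := key _ cb0.
  rewrite YE gt0_muley; last by rewrite lte_fin mulr_gt0 // expR_gt0.
  have c0 : (0 < c)%R by exact: lt_trans bc.
  by rewrite subrKC (chiRE b0 bbc) (chiRE c0 cbc) addey.
have ky : (k < y)%R by rewrite -lte_fin -YE.
have y0 : (0 <= y)%R by rewrite -lee_fin -YE.
have [t [t0 tc kt]] := small_increment y0 W0 ky cb0.
exists (b + t)%R; split; [lra|lra|].
have btc : (b + t)%:E < beta_c P o by apply: le_lt_trans cbc; rewrite lee_fin; lra.
rewrite (_ : b + t - b = t)%R; last by ring.
have := key t t0; rewrite YE (chiRE b0 bbc) (chiRE _ btc); last lra.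
by rewrite -EFinM -EFinD lee_fin; lra.
Qed.

End SusceptibilityIncrement.

(** * Integrating the differential inequality *)

Section Integration.
Context {R : realType}.
Local Open Scope ring_scope.

(** [1 / X] decreases at rate [k / X ^ 2] to first order; a margin between [c1] and
    [g / X ^ 2] absorbs the second order. *)
Lemma inverse_increment (X g c1 : R) : 0 < X -> 0 <= g -> c1 * X ^+ 2 < g ->
  exists m k, [/\ 0 < m, k < g & forall t X', 0 < t -> t <= m -> X <= X' ->
    X + k * t <= X' -> X'^-1 <= X^-1 - c1 * t].
Proof.
move=> X0 g0 c1g.
have [c10|c10] := leP c1 0.
  exists 1, (g - 1); split => //; first lra.
  move=> t X' t0 _ XX' _; have X'0 : 0 < X' by lra.
  have : X'^-1 <= X^-1 by rewrite lef_pV2.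
  by move: c10 t0; nra.
pose k := (c1 * X ^+ 2 + g) / 2.
have kg : k < g by rewrite /k; lra.
have k0 : 0 < k.
  have : 0 < c1 * X ^+ 2 by rewrite mulr_gt0 // exprn_gt0.
  by rewrite /k; lra.
have kc : 0 < k - c1 * X ^+ 2 by rewrite /k; lra.
have c1Xk : 0 < c1 * X * k by apply: mulr_gt0 => //; exact: mulr_gt0.
exists ((k - c1 * X ^+ 2) / (c1 * X * k)), k; split => //; first exact: divr_gt0.
move=> t X' t0 tm _ XX'.
have Xt : 0 < X + k * t by rewrite addr_gt0 // mulr_gt0.
have X'0 : 0 < X' by lra.
apply: (@le_trans _ _ (X + k * t)^-1); first by rewrite lef_pV2.
have tm' : t * (c1 * X * k) <= k - c1 * X ^+ 2 by rewrite -ler_pdivlMr.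
rewrite -subr_ge0.
have -> : X^-1 - c1 * t - (X + k * t)^-1 =
    t * (k - c1 * X ^+ 2 - t * (c1 * X * k)) / (X * (X + k * t)).
  by field; rewrite !gt_eqF.
by rewrite divr_ge0 ?mulr_ge0 //; lra.
Qed.

(** In the variable [s = (1 / l - 1 / B) / 3] the hypothesis on [y] reads
    [y' >= (h - y)_+ ^ 2] and that on [H] reads [H' <= h ^ 2].  Either
    [y (1 + s) >= s], which dominates [H] because [h <= 1]; or
    [y < s / (1 + s)], and then [(h - y)_+ ^ 2 (1 + s) + y >= h ^ 2], so that
    [y (1 + s)] grows at least as fast as [H]. *)
Lemma integrate_inequality (a B : R) (y h H : R -> R) : 0 < a -> a <= B ->
  (forall l, a <= l -> l <= B -> 0 <= y l) ->
  (forall l m, a <= l -> l <= m -> m <= B -> y m <= y l) ->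
  (forall l, a <= l -> l <= B -> 0 <= h l <= 1) ->
  (forall l m, a <= l -> l <= m -> m <= B ->
     H l - H m <= h l ^+ 2 / (3 * l ^+ 2) * (m - l)) ->
  H B = 0 ->
  (forall l c1 c, a <= l -> l < c -> c <= B ->
     c1 < (Num.max (h l - y l) 0) ^+ 2 / (3 * l ^+ 2) ->
     exists d, [/\ l < d, d <= c & y d <= y l - c1 * (d - l)]) ->
  H a <= y a * (1 + (a^-1 - B^-1) / 3).
Proof.
move=> a0 aB y0 y_ni h01 HH HB dini.
pose s l := (l^-1 - B^-1) / 3.
have pos l : a <= l -> 0 < l by move=> al; exact: lt_le_trans al.
have sE l d : a <= l -> l <= d -> s d = s l - (d - l) / (3 * (l * d)).
  move=> al ld; have l0 := pos l al; have d0 : 0 < d by exact: lt_le_trans ld.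
  by rewrite /s; field; rewrite !gt_eqF // (lt_le_trans a0).
have s_ni l d : a <= l -> l <= d -> s d <= s l.
  move=> al ld; have l0 := pos l al; have d0 : 0 < d by exact: lt_le_trans ld.
  by rewrite (sE l d) // lerBlDr lerDl divr_ge0 ?subr_ge0 // !mulr_ge0 // ltW.
have s0 l : a <= l -> l <= B -> 0 <= s l.
  by move=> al lB; have := s_ni l B al lB; rewrite /s subrr mul0r.
(* replacing [1 / (l d)] by [1 / l ^ 2] costs a second order term *)
have sq l d : a <= l -> l <= d ->
    (l ^+ 2)^-1 - (d - l) / l ^+ 3 <= (l * d)^-1.
  move=> al ld; have l0 := pos l al; have d0 : 0 < d by exact: lt_le_trans ld.
  rewrite -subr_ge0 (_ : _ - _ = (d - l) ^+ 2 / (l ^+ 3 * d)); last first.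
    by field; rewrite !gt_eqF.
  by rewrite divr_ge0 ?sqr_ge0 // mulr_ge0 ?exprn_ge0 // ltW.
have h2 l : a <= l -> l <= B -> h l ^+ 2 <= 1.
  by move=> al lB; have /andP[? ?] := h01 l al lB; rewrite expr_le1.
have H_lip l m : a <= l -> l <= m -> m <= B -> H l - H m <= (m - l) / (3 * a ^+ 2).
  move=> al lm mB; apply: le_trans (HH l m al lm mB) _.
  have l0 := pos l al.
  rewrite mulrC ler_wpM2l ?subr_ge0 //.
  apply: le_trans (_ : 1 / (3 * l ^+ 2) <= _).
    by rewrite ler_pM2r ?h2 ?(le_trans lm) // invr_gt0 mulr_gt0 // exprn_gt0.
  rewrite mul1r lef_pV2 ?posrE ?mulr_gt0 ?exprn_gt0 // ler_pM2l //.
  by rewrite ler_pXn2r // nnegrE ltW.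
(* Increments bounded by [C (x - z)] exclude upward jumps from the left. *)
have left_jump (g : R -> R) (C : R) : 0 <= C ->
    (forall z x, a <= z -> z <= x -> x <= B -> g x <= g z + C * (x - z)) ->
    forall x eta, a < x -> x <= B -> 0 < eta -> exists2 d, 0 < d &
      forall z, a <= z -> x - d < z -> z < x -> g x <= g z + eta.
  move=> C0 gC x eta ax xB eta0; exists (eta / (C + 1)); first by rewrite divr_gt0 //; lra.
  move=> z az xz zx; apply: le_trans (gC z x az (ltW zx) xB) _; rewrite lerD2l.
  have : x - z < eta / (C + 1) by lra.
  rewrite ltr_pdivlMr; last lra.
  by move: C0 zx; nra.
have ia0 : 0 <= (3 * a ^+ 2)^-1 by rewrite invr_ge0 mulr_ge0 // exprn_ge0 // ltW.
have Hs l : a <= l -> l <= B -> H l <= s l.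
  move=> al lB; rewrite -subr_ge0 leNgt; apply/negP => neg.
  have l0 := pos l al.
  suff : s B - H B < 0 by rewrite HB /s subrr mul0r subr0 ltxx.
  apply: (@dini_negative _ (fun x => s x - H x) l B) => //.
    move=> x eta lx xB eta0.
    have [d d0 Hd] := @left_jump (fun x => s x - H x) _ ia0 (fun z x az zx xB => ltac:(
       have := H_lip z x az zx xB; have := s_ni z x az zx; lra)) x eta (le_lt_trans al lx) xB eta0.
    by exists d => // z lz; apply: Hd; exact: le_trans lz.
  move=> x eta lx xB _ eta0; have ax := le_trans al lx; have x0 := pos x ax.
  pose d := Num.min B (x + eta * x ^+ 3).
  have x3 : 0 < x ^+ 3 by rewrite exprn_gt0.
  have xd : x < d by rewrite lt_min xB ltrDl mulr_gt0.
  have dB : d <= B by rewrite ge_min lexx.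
  have dx : d - x <= eta * x ^+ 3 by rewrite lerBlDl ge_min lexx orbT.
  exists d; split => //.
  have HHx := HH x d ax (ltW xd) dB.
  have hx := h2 x ax (ltW xB).
  have sx := sE x d ax (ltW xd); have sqx := sq x d ax (ltW xd).
  have i2 : 0 < (x ^+ 2)^-1 by rewrite invr_gt0 exprn_gt0.
  have dx3 : (d - x) / x ^+ 3 <= eta by rewrite ler_pdivrMr.
  have e1 : (d - x) / (3 * (x * d)) = (d - x) * (x * d)^-1 / 3.
    have d0 : 0 < d by exact: lt_trans xd.
    by field; rewrite !gt_eqF.
  have e2 : h x ^+ 2 / (3 * x ^+ 2) * (d - x) = (d - x) * (h x ^+ 2 * (x ^+ 2)^-1) / 3.
    by field; rewrite gt_eqF.
  have p1 : (d - x) * (h x ^+ 2 * (x ^+ 2)^-1) <= (d - x) * (x ^+ 2)^-1.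
    by apply: ler_wpM2l; [lra|rewrite ler_piMl // ltW].
  have p2 : (d - x) * ((x ^+ 2)^-1 - eta) <= (d - x) * (x * d)^-1.
    by apply: ler_wpM2l; lra.
  have p3 : 0 <= eta * (d - x) by rewrite mulr_ge0 //; lra.
  by rewrite sx e1; move: HHx; rewrite e2; lra.
pose Phi l := y l * (1 + s l) - H l.
suff : 0 <= Phi a by rewrite /Phi /s subr_ge0.
rewrite leNgt; apply/negP => neg.
suff : Phi B < 0.
  rewrite /Phi HB subr0 /s subrr mul0r addr0 mulr1.
  by rewrite ltNge y0.
apply: (@dini_negative _ Phi a B) => //.
  apply: (left_jump Phi _ ia0) => z x az zx xB; rewrite /Phi.
  have := H_lip z x az zx xB; have := s_ni z x az zx.
  have := y_ni z x az zx xB; have := y0 x (le_trans az zx) xB.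
  have := s0 x (le_trans az zx) xB.
  have : y x * (1 + s x) <= y z * (1 + s z).
    apply: ler_pM; [exact: y0 (le_trans az zx) xB| |exact: y_ni|].
      by have := s0 x (le_trans az zx) xB; lra.
    by rewrite lerD2l; exact: s_ni.
  lra.
move=> x eta ax xB Phix eta0; have x0 := pos x ax.
have xB' := ltW xB.
set q := (Num.max (h x - y x) 0) ^+ 2.
have q0 : 0 <= q by exact: sqr_ge0.
have yx := y0 x ax xB'; have sx0 := s0 x ax xB'.
have /andP[hx0 hx1] := h01 x ax xB'.
(* The derivative of [y (1 + s)] is at least that of [H]. *)
have drift : h x ^+ 2 <= q * (1 + s x) + y x.
  have Hsx := Hs x ax xB'.
  have ys : y x * (1 + s x) < s x by move: Phix; rewrite /Phi; lra.
  have y1 : y x < 1 by nra.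
  have one : 1 <= (1 - y x) * (1 + s x) by nra.
  rewrite /q; have [hy|hy] := leP (h x - y x) 0.
    by rewrite expr0n /= mul0r add0r; nra.
  have k1 : (h x ^+ 2 - y x) * (1 - y x) <= (h x - y x) ^+ 2.
    have : 0 <= y x * (1 - h x) ^+ 2 by rewrite mulr_ge0 ?sqr_ge0.
    nra.
  have k2 : (h x - y x) ^+ 2 <= (h x - y x) ^+ 2 * ((1 - y x) * (1 + s x)).
    by rewrite ler_peMr ?sqr_ge0.
  have k3 : 0 < 1 - y x by lra.
  rewrite -lerBlDr -(ler_pM2r k3); lra.
set D := (3 * x ^+ 2)^-1.
have D0 : 0 < D by rewrite invr_gt0 mulr_gt0 // exprn_gt0.
pose del := eta / (2 * (1 + s x)).
have del0 : 0 < del by rewrite divr_gt0 //; lra.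
pose K := q * D * D + del * D + y x / (3 * x ^+ 3) + 1.
have K1 : 1 <= K.
  have p1 := mulr_ge0 (mulr_ge0 q0 (ltW D0)) (ltW D0).
  have p2 := mulr_ge0 (ltW del0) (ltW D0).
  have p3 : 0 <= y x / (3 * x ^+ 3).
    by rewrite divr_ge0 // mulr_ge0 // exprn_ge0 // ltW.
  by rewrite /K; lra.
have K0 : 0 < K by exact: lt_le_trans K1.
have K2 : 0 < 2 * K by exact: mulr_gt0.
pose c := Num.min B (x + eta / (2 * K)).
have xc : x < c by rewrite lt_min xB ltrDl divr_gt0.
have cB : c <= B by rewrite ge_min lexx.
have [|d [xd dc yd]] := dini x (q * D - del) c ax xc cB.
  by rewrite -/q -/D ltrBlDr ltrDl.
have dB : d <= B by exact: le_trans cB.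
have dx : (d - x) * (2 * K) <= eta.
  by rewrite -ler_pdivlMr // lerBlDl (le_trans dc) // ge_min lexx orbT.
exists d; split => //.
have sd := sE x d ax (ltW xd); have sqd := sq x d ax (ltW xd).
have HHx := HH x d ax (ltW xd) dB.
have sdn : s d <= s x by exact: s_ni (ltW xd).
have sd0 := s0 d (le_trans ax (ltW xd)) dB.
have d0 : 0 < d by exact: lt_trans xd.
have ed : 0 < d - x by lra.
have sd_ge : s x - (d - x) * D <= s d.
  rewrite sd lerD2l lerN2; apply: ler_wpM2l; first exact: ltW.
  have xd0 : 0 < x * d by exact: mulr_gt0.
  have xx0 : 0 < x ^+ 2 by exact: exprn_gt0.
  rewrite /D lef_pV2 ?posrE ?mulr_gt0 // ler_pM2l // expr2 ler_pM2l //.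
  exact: ltW.
rewrite /Phi.
have t1 : y d * (1 + s d) <= (y x - (q * D - del) * (d - x)) * (1 + s d).
  by apply: ler_wpM2r => //; lra.
have t2 : y x * s d <= y x * (s x - (d - x) * D + (d - x) ^+ 2 / (3 * x ^+ 3)).
  apply: ler_wpM2l => //; rewrite sd.
  have -> : (d - x) / (3 * (x * d)) = (d - x) / 3 * (x * d)^-1.
    by field; rewrite !gt_eqF.
  have : (d - x) / 3 * ((x ^+ 2)^-1 - (d - x) / x ^+ 3) <= (d - x) / 3 * (x * d)^-1.
    by apply: ler_wpM2l => //; rewrite divr_ge0 // ltW.
  have -> : (d - x) / 3 * ((x ^+ 2)^-1 - (d - x) / x ^+ 3) =
      (d - x) * D - (d - x) ^+ 2 / (3 * x ^+ 3).
    by rewrite /D; field; rewrite gt_eqF.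
  lra.
have t3 : q * D * (s x - (d - x) * D) <= q * D * s d.
  by apply: ler_wpM2l => //; exact: mulr_ge0 q0 (ltW D0).
have t4 : del * (1 + s d) <= eta / 2.
  apply: le_trans (_ : del * (1 + s x) <= _); first by rewrite ler_pM2l // lerD2l.
  rewrite /del le_eqVlt; apply/orP; left; apply/eqP; field.
  by rewrite gt_eqF //; lra.
have t5 : h x ^+ 2 * D <= (q * (1 + s x) + y x) * D by rewrite ler_pM2r.
have HHx' : H x - H d <= h x ^+ 2 * D * (d - x) by [].
have small : (d - x) * (q * D * D + y x / (3 * x ^+ 3)) <= eta / 2.
  have : (d - x) * (q * D * D + y x / (3 * x ^+ 3)) <= (d - x) * K.
    apply: ler_wpM2l; first exact: ltW.
    by have p2 := mulr_ge0 (ltW del0) (ltW D0); rewrite /K; lra.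
  lra.
set Z := y x / (3 * x ^+ 3) in small.
have t2' : y x * s d <= y x * s x - (d - x) * (y x * D) + (d - x) * ((d - x) * Z).
  apply: le_trans t2 _; rewrite le_eqVlt; apply/orP; left; apply/eqP.
  by rewrite /Z; field; rewrite gt_eqF.
have m1 := ler_wpM2l (ltW ed) t3.
have m2 := ler_wpM2l (ltW ed) t4.
have m3 := ler_wpM2l (ltW ed) t5.
have m4 := ler_wpM2l (ltW ed) small.
lra.
Qed.

End Integration.

(** * The integral up to the critical parameter *)

Section MonotoneIntegral.
Context {R : realType}.
Local Notation mu := (@lebesgue_measure R).
Implicit Types (a b c B l m : R) (k : R -> R).

(** Extending [k] by its values at the ends makes it monotone everywhere. *)
Lemma nonincreasing_measurable_itv k a B :
  (forall l m, (a <= l)%R -> (l <= m)%R -> (m <= B)%R -> (k m <= k l)%R) ->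
  measurable_fun `]a, B] (EFin \o k).
Proof.
move=> k_ni; have [aB|Ba] := leP a B; last first.
  by rewrite set_itv_ge ?bnd_simp -?leNgt ?ltW //; exact: measurable_fun_set0.
pose k' l := k (Num.max a (Num.min l B)).
have k'_ni : nonincreasing_fun k'.
  move=> l m lm; apply: k_ni; first by rewrite le_max lexx.
    by rewrite ge_max !le_max lexx /= le_min !ge_min lm lexx !orbT.
  by rewrite ge_max aB ge_min lexx orbT.
apply/measurable_EFinP.
apply: (@eq_measurable_fun _ _ _ _ _ k'); last exact: nonincreasing_measurable.
move=> l; rewrite inE /= in_itv /= => /andP[al lB].
by rewrite /k' (min_idPl lB) (max_idPr (ltW al)).
Qed.

(** [H l] is the integral from [l] to [B], whose increments are bounded by the value
    of [k] at the left end. *)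
Lemma tail_integral k a B : (a <= B)%R ->
  (forall l, (a <= l)%R -> (l <= B)%R -> (0 <= k l)%R) ->
  (forall l m, (a <= l)%R -> (l <= m)%R -> (m <= B)%R -> (k m <= k l)%R) ->
  exists H : R -> R, [/\ H B = 0%R,
    \int[mu]_(x in `]a, B]) (k x)%:E = (H a)%:E &
    forall l m, (a <= l)%R -> (l <= m)%R -> (m <= B)%R ->
      (H l - H m <= k l * (m - l))%R].
Proof.
move=> aB k0 k_ni.
have mk l m : (a <= l)%R -> (m <= B)%R -> measurable_fun `]l, m] (EFin \o k).
  move=> al mB; apply: nonincreasing_measurable_itv => x z lx xz zm.
  by apply: k_ni => //; [exact: le_trans lx|exact: le_trans mB].
have piece l m : (a <= l)%R -> (l <= m)%R -> (m <= B)%R ->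
    \int[mu]_(x in `]l, m]) (k x)%:E <= (k l * (m - l))%:E.
  move=> al lm mB.
  apply: le_trans (_ : \int[mu]_(x in `]l, m]) cst (k l)%:E x <= _).
    apply: ge0_le_integral => //.
    - move=> x /=; rewrite in_itv /= lee_fin => /andP[lx xm].
      by apply: k0; [exact: ltW (le_lt_trans al lx)|exact: le_trans mB].
    - exact: mk.
    - move=> x /=; rewrite in_itv /= lee_fin => /andP[lx xm].
      by apply: k_ni => //; [exact: ltW|exact: le_trans mB].
  rewrite integral_cst //= lebesgue_measure_itv /= lte_fin.
  have [lm'|ml] := ltP l m; first by rewrite -EFinB -EFinM.
  by rewrite mule0 lee_fin mulr_ge0 ?subr_ge0 // k0 // (le_trans lm).
have int_ge0 l : (a <= l)%R -> 0 <= \int[mu]_(x in `]l, B]) (k x)%:E.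
  move=> al; apply: integral_ge0 => x /=; rewrite in_itv /= lee_fin => /andP[lx xB].
  by apply: k0 => //; exact: ltW (le_lt_trans al lx).
have int_fin l : (a <= l)%R -> (l <= B)%R -> \int[mu]_(x in `]l, B]) (k x)%:E \is a fin_num.
  move=> al lB; rewrite ge0_fin_numE ?int_ge0 //.
  by apply: le_lt_trans (piece l B al lB (lexx _)) _; rewrite ltry.
exists (fun l => fine (\int[mu]_(x in `]l, B]) (k x)%:E)); split.
- by rewrite set_itvoc0 integral_set0.
- by rewrite fineK // int_fin.
move=> l m al lm mB; have am := le_trans al lm.
rewrite lerBlDr -lee_fin EFinD !fineK ?int_fin ?(le_trans lm) //.
have U : `]l, B]%classic = `]l, m] `|` `]m, B].
  by apply: itv_bndbnd_setU; rewrite bnd_simp.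
rewrite U ge0_integral_setU //=.
- by rewrite leeD2r // piece.
- by have := mk l B al (lexx B); rewrite U.
- move=> x lmB; have : `]l, B]%classic x by rewrite U.
  rewrite /= in_itv /= lee_fin => /andP[lx xB].
  by apply: k0 => //; exact: ltW (le_lt_trans al lx).
- apply/disj_setPS => x [] /=; rewrite !in_itv /= => /andP[_ xm] /andP[mx _].
  by move: (le_lt_trans xm mx); rewrite ltxx.
Qed.

(** The domain is exhausted by intervals that end strictly below [bc]. *)
Lemma integral_exhaust (f : R -> \bar R) (b C : R) (bc : \bar R) :
  b%:E < bc -> (0 <= C)%R ->
  (forall l, 0 <= f l) ->
  (forall B, (b < B)%R -> B%:E < bc -> measurable_fun `]b, B] f) ->
  (forall B, (b < B)%R -> B%:E < bc -> \int[mu]_(x in `]b, B]) f x <= C%:E) ->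
  \int[mu]_(x in [set l : R | (b < l)%R /\ l%:E < bc]) f x <= C%:E.
Proof.
move=> bbc C0 f0 mf intf.
suff [B [Bmono Bbc Bcover]] : exists B : nat -> R,
    [/\ {homo B : i j / (i <= j)%N >-> (i <= j)%R}, (forall n, (B n)%:E < bc) &
      forall l, l%:E < bc -> exists n, (l <= B n)%R].
  have DE : [set l : R | (b < l)%R /\ l%:E < bc] = \bigcup_n `]b, B n]%classic.
    apply/seteqP; split => [l [bl lbc]|l [n _] /=].
      by have [n lB] := Bcover l lbc; exists n => //=; rewrite in_itv /= bl.
    rewrite in_itv /= => /andP[bl lB]; split => //.
    by apply: le_lt_trans (Bbc n); rewrite lee_fin.
  have empty n : ~~ (b < B n)%R -> `]b, B n]%classic = set0.
    by move=> bB; rewrite set_itv_ge // bnd_simp.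
  rewrite DE; apply: (cvge_le _ (ge0_nondecreasing_set_cvg_integral _ _ _ _)).
  - apply: nearW => n; have [bB|bB] := boolP (b < B n)%R; first exact: intf.
    by rewrite empty // integral_set0 lee_fin.
  - apply/nondecreasing_seqP => n; apply/subsetPset => l /=.
    rewrite !in_itv /= => /andP[-> lB] /=; apply: le_trans lB _.
    exact: Bmono.
  - by move=> n; exact: measurable_itv.
  - move=> n; have [bB|bB] := boolP (b < B n)%R; first exact: mf.
    by rewrite empty //; exact: measurable_fun_set0.
  - by move=> *; exact: f0.
case: bc bbc {mf intf} => [c| |] // bbc.
  exists (fun n => c - n.+1%:R^-1)%R; split.
  - move=> i j ij /=; rewrite lerD2l lerN2 lef_pV2 ?posrE ?ltr0n //.
    by rewrite ler_nat ltnS.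
  - by move=> n; rewrite lte_fin ltrBlDr ltrDl invr_gt0 ltr0n.
  - by move=> l; rewrite lte_fin => /ltr_add_invr[n ln]; exists n; rewrite lerBrDr ltW.
exists (fun n => n%:R); split.
- by move=> i j ij; rewrite ler_nat.
- by move=> n; rewrite ltry.
- by move=> l _; exists (Num.truncn l).+1; rewrite ltW // truncnS_gt.
Qed.

End MonotoneIntegral.

Section Conclusion.
Context {R : realType} (G : weighted_graph R) (P : R -> probability (config G) R).
Hypothesis hP : forall b : R, (0 <= b)%R -> percolation_law b (P b).
Hypothesis htrans : transitive_graph G.
Variable o : vertex G.
Hypothesis hunim : unimodular o.
Hypothesis hnorm : out_weight o = 1.
Local Notation V := (vertex G).
Implicit Types (b c l B : R).

Lemma susceptibilityE b : susceptibility P o b = chi P b o.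
Proof.
have lm x : measurable ([set w | linked w o x] : set (config G)).
  have -> : [set w | linked w o x] = linked_event setT o x :> set (config G).
    by apply/seteqP; split => w /=; move/linked_inE.
  exact: linked_event_measurable.
rewrite /susceptibility /chi.
under eq_integral do rewrite countingE.
have tE w x : ((\1_(Defs.cluster o w) x : R)%:E =
    (\1_([set w' : config G | linked w' o x]) w)%:E).
  by rewrite !indicE; congr (_ %:R%:E); apply/idP/idP; rewrite !inE.
under eq_integral => w _ do (under eq_tsum do rewrite tE).
rewrite integral_tsum.
- by apply: eq_tsum => x; rewrite integral_indic // setIT; exact: two_pointE.
- by move=> x; apply/measurable_EFinP; exact: measurable_indic.
- by move=> x w; rewrite lee_fin.
Qed.

Lemma triangle_conv3 b : triangle P o b = conv3 (conn (P b) setT) o o.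
Proof.
rewrite triangleE; last by move=> x y; exact: conn_ge0.
by rewrite /triangle /two_point; apply: eq_esum => p _; rewrite !two_pointE.
Qed.

Let y b : R := ((chiR P o b)^-1)%R.
Let h b : R := ((triR P o b)^-1)%R.
Let kappa b : R := (h b ^+ 2 / (3 * b ^+ 2))%R.

Let below b B l : (0 < b)%R -> B%:E < beta_c P o -> (b <= l)%R -> (l <= B)%R ->
  (0 < l)%R /\ l%:E < beta_c P o.
Proof.
move=> b0 Bbc bl lB; split; first exact: lt_le_trans bl.
by apply: le_lt_trans Bbc; rewrite lee_fin.
Qed.

Let h01 l : (0 < l)%R -> l%:E < beta_c P o -> (0 <= h l <= 1)%R.
Proof.
move=> l0 lbc; have N1 := triR_ge1 hP htrans l0 lbc.
by rewrite /h invr_ge0 (le_trans ler01) //= invf_le1 ?(lt_le_trans ltr01).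
Qed.

Lemma integrandE l : (0 < l)%R -> l%:E < beta_c P o ->
  ((3 * l ^+ 2)%:E * triangle P o l ^+ 2)^-1 = (kappa l)%:E.
Proof.
move=> l0 lbc; rewrite triangle_conv3 (triRE hP htrans) //.
have N0 : (0 < triR P o l)%R := lt_le_trans ltr01 (triR_ge1 hP htrans l0 lbc).
rewrite -EFin_expe -EFinM inver gt_eqF; last by rewrite !mulr_gt0 // exprn_gt0.
by congr EFin; rewrite /kappa /h exprVn invfM mulrC.
Qed.

Let kappa_ge0 l : (0 < l)%R -> (0 <= kappa l)%R.
Proof. by move=> l0; rewrite divr_ge0 ?sqr_ge0 // mulr_ge0 // sqr_ge0. Qed.

Let kappa_ni l m : (0 < l)%R -> (l <= m)%R -> m%:E < beta_c P o ->
  (kappa m <= kappa l)%R.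
Proof.
move=> l0 lm mbc; have [m0 lbc] := below l0 mbc lm (lexx m).
have lbc' : l%:E < beta_c P o by apply: le_lt_trans mbc; rewrite lee_fin.
have N0 := lt_le_trans ltr01 (triR_ge1 hP htrans l0 lbc').
have := triR_mono hP htrans l0 lm mbc; rewrite /kappa /h.
move: N0; move: (triR P o l) (triR P o m) => N N' N0 NN'.
have N0' := lt_le_trans N0 NN'.
apply: ler_pM; [exact: sqr_ge0|by rewrite invr_ge0 mulr_ge0 ?sqr_ge0| |].
  by rewrite ler_pXn2r ?nnegrE ?invr_ge0 ?(ltW N0) ?(ltW N0') // lef_pV2.
rewrite lef_pV2 ?posrE ?mulr_gt0 ?exprn_gt0 // ler_pM2l //.
by rewrite ler_pXn2r // nnegrE ltW.
Qed.

(** For the inverse [y] of the susceptibility the lower bound on the growth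
    rate becomes [- y' >= (h - y)_+ ^ 2 / (3 l ^ 2)]. *)
Lemma inverse_decrement l c1 c : (0 < l)%R -> (l < c)%R -> c%:E < beta_c P o ->
  (c1 < (Num.max (h l - y l) 0) ^+ 2 / (3 * l ^+ 2))%R ->
  exists d, [/\ (l < d)%R, (d <= c)%R & (y d <= y l - c1 * (d - l))%R].
Proof.
move=> l0 lc cbc c1h.
have lbc : l%:E < beta_c P o by apply: lt_trans cbc; rewrite lte_fin.
have X1 := chiR_ge1 hP htrans l0 lbc; have N1 := triR_ge1 hP htrans l0 lbc.
have gr := growth_lower hP htrans hunim hnorm l0 lbc.
set X := chiR P o l in X1 gr *; set N := triR P o l in N1 gr *.
have X0 : (0 < X)%R by lra.
have N0 : (0 < N)%R by lra.
set g : R := ((Num.max (X - N) 0) ^+ 2 / (3 * l ^+ 2 * N ^+ 2))%R in gr.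
have g0 : (0 <= g)%R.
  rewrite /g; apply: divr_ge0; first exact: sqr_ge0.
  by apply: mulr_ge0; [apply: mulr_ge0 => //|]; exact: sqr_ge0.
have hg : ((Num.max (h l - y l) 0) ^+ 2 / (3 * l ^+ 2) = g / X ^+ 2)%R.
  have -> : (h l - y l = (X - N) / (X * N))%R.
    by rewrite /h /y -/X -/N; field; rewrite !gt_eqF.
  have -> : (Num.max ((X - N) / (X * N)) 0 = Num.max (X - N) 0 / (X * N))%R.
    by rewrite maxr_pMl ?mul0r // invr_ge0 mulr_ge0 // ltW.
  by rewrite /g; field; rewrite !gt_eqF.
have c1g : (c1 * X ^+ 2 < g)%R by rewrite -ltr_pdivlMr ?exprn_gt0 // -hg.
have [m [k [m0 kg step]]] := inverse_increment X0 g0 c1g.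
pose c' := (Num.min c (l + m))%R.
have lc' : (l < c')%R by rewrite lt_min lc ltrDl.
have c'c : (c' <= c)%R by rewrite ge_min lexx.
have c'bc : c'%:E < beta_c P o by apply: le_lt_trans cbc; rewrite lee_fin.
have [d [ld dc' inc]] : exists d, [/\ (l < d)%R, (d <= c')%R &
    (chiR P o l + k * (d - l) <= chiR P o d)%R].
  by apply: chiR_increment => //; apply: lt_le_trans gr; rewrite lte_fin.
exists d; split => //; first exact: le_trans c'c.
apply: step; rewrite ?subr_gt0 // -/X //.
- by rewrite lerBlDl (le_trans dc') // ge_min lexx orbT.
- by apply: (chiR_mono hP htrans) => //; [exact: ltW|apply: le_lt_trans c'bc; rewrite lee_fin].
Qed.

Lemma integral_to_B b B : (0 < b)%R -> (b < B)%R -> B%:E < beta_c P o ->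
  \int[lebesgue_measure]_(l in `]b, B]) ((3 * l ^+ 2)%:E * triangle P o l ^+ 2)^-1
  <= (y b * (1 + (b^-1 - B^-1) / 3))%:E.
Proof.
move=> b0 bB Bbc.
have inside l : l \in `]b, B]%classic -> (0 < l)%R /\ l%:E < beta_c P o.
  by rewrite inE /= in_itv /= => /andP[bl lB]; exact: below b0 Bbc (ltW bl) lB.
under eq_integral => l /inside[l0 lbc] do rewrite integrandE //.
have [||H [HB -> Hinc]] := @tail_integral _ kappa b B (ltW bB).
- by move=> l bl _; apply: kappa_ge0; exact: lt_le_trans bl.
- move=> l m bl lm mB; have [l0 _] := below b0 Bbc bl (le_trans lm mB).
  by apply: kappa_ni => //; apply: le_lt_trans Bbc; rewrite lee_fin.
rewrite lee_fin; apply: (@integrate_inequality _ _ _ y h) => //; first exact: ltW.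
- move=> l bl lB; have [l0 lbc] := below b0 Bbc bl lB.
  by rewrite /y invr_ge0 (le_trans ler01) //; exact: chiR_ge1 lbc.
- move=> l m bl lm mB; have [l0 lbc] := below b0 Bbc bl (le_trans lm mB).
  have [m0 mbc] := below b0 Bbc (le_trans bl lm) mB.
  have X1 := chiR_ge1 hP htrans l0 lbc.
  have Xm := chiR_mono hP htrans l0 lm mbc.
  by rewrite /y lef_pV2 ?posrE //; lra.
- by move=> l bl lB; have [l0 lbc] := below b0 Bbc bl lB; exact: h01.
move=> l c1 c bl lc cB c1h; apply: inverse_decrement => //.
  exact: lt_le_trans bl.
by apply: le_lt_trans Bbc; rewrite lee_fin.
Qed.

Lemma integral_to_beta_c b : (0 < b)%R -> b%:E < beta_c P o ->
  \int[lebesgue_measure]_(l in [set l : R | (b < l)%R /\ l%:E < beta_c P o])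
    ((3 * l ^+ 2)%:E * triangle P o l ^+ 2)^-1
  <= (y b * (1 + critical_gap b (beta_c P o) / 3))%:E.
Proof.
move=> b0 bbc.
have y0 : (0 <= y b)%R.
  by rewrite /y invr_ge0 (le_trans ler01) //; exact: chiR_ge1 bbc.
have gap B : (b <= B)%R -> B%:E < beta_c P o ->
    (0 <= b^-1 - B^-1 <= critical_gap b (beta_c P o))%R.
  move=> bB; have B0 : (0 < B)%R by exact: lt_le_trans bB.
  rewrite subr_ge0 lef_pV2 // bB /critical_gap.
  case: (beta_c P o) bbc => [c| |] // bbc; last by rewrite lerBlDr lerDl invr_ge0 ltW.
  rewrite !lte_fin in bbc * => Bc; have c0 : (0 < c)%R by exact: lt_trans Bc.
  have -> : ((c - b) / (b * c) = b^-1 - c^-1)%R by field; rewrite !gt_eqF.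
  by rewrite lerD2l lerN2 lef_pV2 // ltW.
apply: integral_exhaust => //.
- rewrite mulr_ge0 //; have := gap b (lexx b) bbc; lra.
- move=> l; have T0 : 0 <= triangle P o l.
    by rewrite triangle_conv3; apply: conv3_ge0 => u v; exact: conn_ge0.
  by rewrite inve_ge0 mule_ge0 ?expe_ge0 // lee_fin mulr_ge0 ?sqr_ge0.
- move=> B bB Bbc; apply: (@eq_measurable_fun _ _ _ _ _ (EFin \o kappa)).
    move=> l; rewrite inE /= in_itv /= => /andP[bl lB].
    by have [l0 lbc] := below b0 Bbc (ltW bl) lB; rewrite integrandE.
  apply: nonincreasing_measurable_itv => l m bl lm mB; apply: kappa_ni => //.
    exact: lt_le_trans bl.
  by apply: le_lt_trans Bbc; rewrite lee_fin.
- move=> B bB Bbc; apply: le_trans (integral_to_B b0 bB Bbc) _; rewrite lee_fin.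
  by apply: ler_wpM2l => //; have := gap B (ltW bB) Bbc; lra.
Qed.

Lemma susceptibility_le b : (0 < b)%R -> b%:E < beta_c P o ->
  susceptibility P o b <= (1 + critical_gap b (beta_c P o) / 3)%:E *
    (\int[lebesgue_measure]_(l in [set l : R | (b < l)%R /\ l%:E < beta_c P o])
       ((3 * l ^+ 2)%:E * triangle P o l ^+ 2)^-1)^-1.
Proof.
move=> b0 bbc; have X1 := chiR_ge1 hP htrans b0 bbc.
have X0 := lt_le_trans ltr01 X1.
have := integral_to_beta_c b0 bbc.
set I := \int[_]_(_ in _) _; set A := (1 + _)%R => IA.
have I0 : 0 <= I.
  apply: integral_ge0 => l [bl lbc]; rewrite integrandE ?lee_fin //.
    by apply: kappa_ge0; exact: lt_trans bl.
  exact: lt_trans bl.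
have A0 : (0 < A)%R.
  rewrite /A /critical_gap; case: (beta_c P o) bbc => [c| |] // bc.
    rewrite ltr_wpDr // divr_ge0 // divr_ge0 ?mulr_ge0 ?subr_ge0 ?(ltW b0) //.
      by rewrite -lee_fin ltW.
    by rewrite lte_fin in bc; lra.
  by rewrite ltr_wpDr // divr_ge0 // invr_ge0 ltW.
rewrite susceptibilityE (chiRE hP htrans) //.
case: I I0 IA => [r| |] //; rewrite !lee_fin => r0 rA.
rewrite inver; case: eqP => [_|/eqP r_neq0]; first by rewrite gt0_muley ?lte_fin // leey.
have {r_neq0}r0 : (0 < r)%R by rewrite lt_neqAle eq_sym r_neq0.
rewrite -EFinM lee_fin ler_pdivlMr //.
have XA : (chiR P o b * r <= chiR P o b * (y b * A))%R by rewrite ler_pM2l.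
by rewrite (le_trans XA) // mulrA /y divff ?mul1r // gt_eqF.
Qed.

End Conclusion.

Local Close Scope ereal_scope.

Theorem corollary1p2 (R : realType) (G : weighted_graph R) (o : vertex G)
    (P : R -> probability (config G) R)
    (hconn : connected_graph G)
    (htrans : transitive_graph G)
    (hunim : unimodular o)
    (hnorm : out_weight o = 1%E)
    (hP : forall b : R, 0 <= b -> percolation_law b (P b))
    (b : R) (hb : 0 < b) (hbc : (b%:E < beta_c P o)%E) :
  (susceptibility P o b
   <= (1 + critical_gap b (beta_c P o) / 3)%:E
      * (\int[lebesgue_measure]_(l in [set l : R | (b < l)%R /\ l%:E < beta_c P o])
           ((3 * l ^+ 2)%:E * triangle P o l ^+ 2)^-1)^-1)%E.
Proof. exact: susceptibility_le. Qed.
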